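(* Let $p\in H^\infty\cap C(\overline{\mathbb D})$ and let $\lambda\in\mathbb C$ be a complex number that is not in the essential spectrum of the Bergman-space Toeplitz operator $T_{\overline{z}+p}$. Then $\lambda$ is an eigenvalue of $T_{\overline{z}+p}$ if and only if either the function $1+z[p(z)-\lambda]$ has no zeros in the open unit disk $\mathbb D$, or $1+z[p(z)-\lambda]$ has finitely many zeros $z_1,\dots,z_k$ in $\mathbb D$, all of them simple, which satisfy $$z_j^2p'(z_j)=\frac{n_j+2}{n_j+1}$$ for some integer $n_j\in\{0,1,2,\dots\}$, for each $j=1,\dots,k$.
   Context: $\mathbb D$ is the open unit disk in $\mathbb C$, $dA$ is Lebesgue area measure on $\mathbb D$ normalized so that $A(\mathbb D)=1$. The Bergman space $L^2_a$ is the closed subspace of $L^2(\mathbb D,dA)$ consisting of functions analytic on $\mathbb D$, and $P$ is the orthogonal projection of $L^2(\mathbb D,dA)$ onto $L^2_a$. For $\varphi\in L^\infty(\mathbb D,dA)$, the Toeplitz operator $T_\varphi$ on $L^2_a$ is $T_\varphi f=P(\varphi f)$. $H^\infty\cap C(\overline{\mathbb D})$ is the disk algebra (bounded analytic functions on $\mathbb D$ extending continuously to $\overline{\mathbb D}$). The essential spectrum of an operator $T$ is the set of $\lambda$ for which $T-\lambda I$ is not Fredholm. *)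

(* Defs.v *)
(* Complex numbers are mathcomp-real-closed's
   [complex R] = R[i] over an abstract [R : realType]; the unit disk is
   identified with {(x,y) : x^2+y^2<1} in R*R, with area measure
   (lebesgue \x lebesgue)/pi, so that A(D) = 1. *)
From mathcomp Require Import all_boot all_order all_algebra.
From mathcomp Require Import all_classical all_reals all_analysis.
From mathcomp Require Export complex.
Import Order.TTheory GRing.Theory Num.Theory.
Import numFieldNormedType.Exports.
Set Implicit Arguments. Unset Strict Implicit. Unset Printing Implicit Defensive.
Local Open Scope ring_scope.
Local Open Scope classical_set_scope.

Section Bergman.
Variable R : realType.
Local Notation C := (complex R).

Definition toC (p : R * R) : C := Complex p.1 p.2.
Definition sqn (z : C) : R := complex.Re z ^+ 2 + complex.Im z ^+ 2.
Definition inD (z : C) : Prop := sqn z < 1.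
Definition diskxy : set (R * R) := [set p | p.1 ^+ 2 + p.2 ^+ 2 < 1].
Definition leb2 := (@lebesgue_measure R \x @lebesgue_measure R)%E.

Definition holoD (f : C -> C) : Prop :=
  forall z, inD z -> derivable (f : C^o -> C^o) z 1.

Definition L2D (f : C -> C) : Prop :=
  [/\ measurable_fun diskxy (fun p => complex.Re (f (toC p))),
      measurable_fun diskxy (fun p => complex.Im (f (toC p))) &
      leb2.-integrable diskxy (fun p => (sqn (f (toC p)))%:E)].

(* Bergman space L^2_a : analytic functions on D which are in L^2(D,dA)
   (values outside D are irrelevant; see eqD) *)
Definition Bergman (f : C -> C) : Prop := holoD f /\ L2D f.

Definition eqD (f g : C -> C) : Prop := forall z, inD z -> f z = g z.

Definition integD (F : C -> C) : C :=
  Complex (Rintegral leb2 diskxy (fun p => complex.Re (F (toC p))) / pi)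
          (Rintegral leb2 diskxy (fun p => complex.Im (F (toC p))) / pi).

Definition innerD (f g : C -> C) : C := integD (fun z => f z * Num.conj (g z)).
Definition normD (f : C -> C) : R :=
  Num.sqrt (Rintegral leb2 diskxy (fun p => sqn (f (toC p))) / pi).

(* toeplitz phi f g  <->  g = T_phi f = P(phi f), i.e. g is in L^2_a and
   phi f - g is orthogonal to L^2_a *)
Definition toeplitz (phi f g : C -> C) : Prop :=
  Bergman g /\ forall h, Bergman h -> innerD (fun z => phi z * f z - g z) h = 0.

Definition TmL (phi : C -> C) (lam : C) (f g : C -> C) : Prop :=
  exists t, toeplitz phi f t /\ eqD g (fun z => t z - lam * f z).

Definition lincomb (s : seq (C -> C)) (c : nat -> C) : C -> C :=
  fun z => \sum_(i < size s) c i * nth (fun _ => 0) s i z.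

Definition fin_dim_kernel (phi : C -> C) (lam : C) : Prop :=
  exists s : seq (C -> C), (forall h, h \in s -> Bergman h) /\
    forall f, Bergman f -> TmL phi lam f (fun _ => 0) ->
      exists c, eqD f (lincomb s c).

Definition closed_range (phi : C -> C) (lam : C) : Prop :=
  forall (y : nat -> C -> C) (g : C -> C),
    (forall n, exists f, Bergman f /\ TmL phi lam f (y n)) ->
    Bergman g ->
    (fun n => normD (fun z => y n z - g z)) @ \oo --> (0 : R) ->
    exists f, Bergman f /\ TmL phi lam f g.

Definition fin_codim_range (phi : C -> C) (lam : C) : Prop :=
  exists s : seq (C -> C), (forall h, h \in s -> Bergman h) /\
    forall g, Bergman g -> exists f t c,
      [/\ Bergman f, TmL phi lam f t & eqD g (fun z => t z + lincomb s c z)].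

Definition Fredholm_TmL (phi : C -> C) (lam : C) : Prop :=
  [/\ fin_dim_kernel phi lam, closed_range phi lam & fin_codim_range phi lam].

Definition ess_spec (phi : C -> C) (lam : C) : Prop := ~ Fredholm_TmL phi lam.

Definition toeplitz_eigenvalue (phi : C -> C) (lam : C) : Prop :=
  exists f, [/\ Bergman f, ~ eqD f (fun _ => 0) & TmL phi lam f (fun _ => 0)].

Definition disk_algebra (p : C -> C) : Prop :=
  [/\ holoD p,
      exists M : R, forall z, inD z -> sqn (p z) <= M &
      {within [set z : C^o | sqn z <= 1], continuous (p : C^o -> C^o)}].

End Bergman.

(* Main.v *)
(** Write q(z) = 1 + z (p(z) - lambda).  Pairing (T - lambda) f = 0 with the monomials turns
    it into the differential equation z q F' = F for the primitive F of f with F(0) = 0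
    (Stokes' formula on disks of radius r < 1 moves the multiplication by the conjugate of z
    onto F).  If F vanishes to order k at a zero a of q, comparing orders in z q F' = F gives
    k a q'(a) = 1, that is a^2 p'(a) = (k + 1) / k.  Conversely, when these conditions hold at
    the finitely many zeros, F = z * prod_a (z - a)^(k_a) * exp H solves the equation, for H a
    primitive of a bounded analytic function, and F' is bounded.

    The Fredholm hypothesis enters through the finite codimension of the range: it forces
    q <> 0 on the unit circle, hence |q| is bounded below near the circle and q has finitely
    many zeros.  If q(zeta) = 0 with |zeta| = 1, the symbol vanishes at zeta, and polynomials
    E_j = z^(N_j) * (constant) * ((1 + conj(zeta) z) / 2)^(n_j) with disjoint degree ranges are
    orthonormal with |phi E_j| decaying like 4^(-j); from m + 1 interlaced series
    sum_j 2^(-j) E_j one gets a nonzero combination lying in a range of codimension m, against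
    the decay of its coefficients <phi f, E_j>. *)
Require Import Defs.
From mathcomp Require Import all_boot all_order all_algebra.
From mathcomp Require Import all_classical all_reals all_analysis.
From mathcomp Require Import measurable_realfun complex ring lra.
Import Order.TTheory GRing.Theory Num.Theory.
Import numFieldNormedType.Exports.
Local Open Scope ring_scope.
Local Open Scope classical_set_scope.
Set Implicit Arguments. Unset Strict Implicit. Unset Printing Implicit Defensive.

(** * Complex modulus and derivatives *)

(** The operator theory needs analytic facts (analyticity of derivatives, division by z - a,
    uniqueness, counting of zeros) starting from bare pointwise complex differentiability. They are
    drawn from area integrals, because Stokes' formula with the weight |z|^2 - r^2 has no boundary
    term. That formula asks for continuous derivatives, which differentiability does not give at
    once. Goursat's theorem on rectangles breaks the circle: a function has a primitive, a second
    primitive has a continuous second derivative, Bergman's formula applies to it, and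
    differentiation under the integral sign leads back to the function and beyond. Uniqueness at 0
    comes from the moments against z^n; a zero of infinite order elsewhere is carried to 0 by a
    Jensen inequality, which also bounds the number of zeros. Stokes' formula is applied on radii r
    < 1, as a Bergman function has no boundary values, and dominated convergence leads to the unit
    disk. Recurrent factors 2 come from estimating real and imaginary parts separately. *)

Section Cabs.
Variable R : realType.
Local Notation C := (complex R).
Implicit Types (z w : C).

Definition cabs z : R := Normc.normc z.
Arguments cabs : simpl never.

Lemma normr_cabs z : `|z| = (cabs z)%:C%C.
Proof. by []. Qed.

Lemma cabs0 : cabs 0 = 0. Proof. exact: Normc.normc0. Qed.
Lemma cabs1 : cabs 1 = 1. Proof. exact: Normc.normc1. Qed.
Lemma cabsM z w : cabs (z * w) = cabs z * cabs w. Proof. exact: Normc.normcM. Qed.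
Lemma cabsV z : cabs z^-1 = (cabs z)^-1. Proof. exact: Normc.normcV. Qed.
Lemma cabsD z w : cabs (z + w) <= cabs z + cabs w. Proof. exact: le_normcD. Qed.
Lemma cabsN z : cabs (- z) = cabs z. Proof. exact: normcN. Qed.
Lemma cabsB z w : cabs (z - w) <= cabs z + cabs w.
Proof. by rewrite (le_trans (cabsD _ _)) // cabsN. Qed.
Lemma cabsC z w : cabs (z - w) = cabs (w - z).
Proof. by rewrite -cabsN opprB. Qed.
Lemma cabs_ge0 z : 0 <= cabs z. Proof. by case: z => a b; exact: sqrtr_ge0. Qed.
Lemma cabs_eq0 z : (cabs z == 0) = (z == 0).
Proof.
apply/eqP/eqP => [/Normc.eq0_normc//|->]; exact: cabs0.
Qed.
Lemma cabs_gt0 z : (0 < cabs z) = (z != 0).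
Proof. by rewrite lt_neqAle cabs_ge0 andbT eq_sym cabs_eq0. Qed.
Lemma cabsX z n : cabs (z ^+ n) = cabs z ^+ n.
Proof. by elim: n => [|n IH]; rewrite ?expr0 ?cabs1// !exprS cabsM IH. Qed.
Lemma sqn_cabs z : sqn z = cabs z ^+ 2.
Proof. by case: z => a b; rewrite /sqn /cabs /= sqr_sqrtr// addr_ge0// sqr_ge0. Qed.
Lemma inD_cabs z : inD z <-> cabs z < 1.
Proof.
rewrite /inD sqn_cabs; split; last by move=> h; rewrite expr_lt1// cabs_ge0.
by rewrite expr_lt1// cabs_ge0.
Qed.
Lemma cabs_Re z : `|complex.Re z| <= cabs z.
Proof.
rewrite -(@ler_pXn2r _ 2)// ?nnegrE ?cabs_ge0//.
by rewrite -sqn_cabs real_normK ?num_real// /sqn lerDl sqr_ge0.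
Qed.
Lemma cabs_Im z : `|complex.Im z| <= cabs z.
Proof.
rewrite -(@ler_pXn2r _ 2)// ?nnegrE ?cabs_ge0//.
by rewrite -sqn_cabs real_normK ?num_real// /sqn lerDr sqr_ge0.
Qed.
Lemma cabs_le_ReIm z : cabs z <= `|complex.Re z| + `|complex.Im z|.
Proof.
rewrite -(@ler_pXn2r _ 2)// ?nnegrE ?cabs_ge0// ?addr_ge0//.
rewrite -sqn_cabs /sqn sqrrD !real_normK ?num_real// addrAC lerDl.
by rewrite mulrn_wge0// mulr_ge0.
Qed.
Lemma cabs_conj z : cabs (Num.conj z) = cabs z.
Proof. by case: z => a b; rewrite /cabs/= sqrrN. Qed.
Lemma cabs_real (x : R) : cabs x%:C%C = `|x|.
Proof. by rewrite /cabs /= expr0n addr0 sqrtr_sqr. Qed.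
Lemma cabs_nat n : cabs n%:R = n%:R.
Proof.
rewrite -[X in cabs X](rmorph_nat (real_complex R)) cabs_real ger0_norm//.
Qed.
Lemma cabs_dist z w : `|cabs z - cabs w| <= cabs (z - w).
Proof.
have h u v : cabs u - cabs v <= cabs (u - v).
  by rewrite lerBlDr -{1}(subrK v u) cabsD.
by rewrite ler_norml h andbT lerNl opprB cabsC h.
Qed.
Lemma cabs_prod (I : Type) (s : seq I) (P : pred I) (F : I -> C) :
  cabs (\prod_(i <- s | P i) F i) = \prod_(i <- s | P i) cabs (F i).
Proof. by elim/big_ind2: _ => [|u a v b <- <-|//]; rewrite ?cabs1 ?cabsM. Qed.
Lemma sqr_cabs z : (cabs z ^+ 2)%:C%C = z * Num.conj z.
Proof.
by rewrite -sqn_cabs; case: z => a b; rewrite /sqn/=; simpc; congr Complex; ring.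
Qed.

Lemma eps_half (z : C) : (forall e : R, 0 < e -> cabs z <= e) -> z = 0.
Proof.
move=> h; apply/eqP; rewrite -cabs_eq0 eq_le cabs_ge0 andbT.
by apply/ler_addgt0Pl => e e0; rewrite addr0 h.
Qed.
End Cabs.
Arguments cabs : simpl never.

Section Cder.
Variable R : realType.
Local Notation C := (complex R).
Implicit Types (f g : C -> C) (z w d : C).

Definition cder f z d := is_derive (z : C^o) (1 : C^o) (f : C^o -> C^o) d.

Let scE (a b : C) : a *: (b : C^o) = a * b. Proof. by []. Qed.

(** The norm of [C^o] takes values in the complex field itself, where 0 < e means a positive real
    part and a zero imaginary part. This criterion passes once and for all to the real-valued
    [cabs]. *)
Lemma cderP f z d : cder f z d <->
  forall e : R, 0 < e -> exists2 r : R, 0 < r &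
    forall h, cabs h < r -> cabs (f (z + h) - f z - d * h) <= e * cabs h.
Proof.
have key : ((h^-1 *: (((f : C^o -> C^o) \o shift (z:C^o)) (h *: (1:C^o)) - f z)) @[h --> (0:C^o)^'] --> (d : C^o))
   <-> forall e : R, 0 < e -> exists2 r : R, 0 < r &
    forall h, cabs h < r -> cabs (f (z + h) - f z - d * h) <= e * cabs h.
  split=> [/cvgrPdist_le h e e0|H].
    have /h : 0 < (e%:C)%C by rewrite ltcR.
    rewrite /prop_near1 /dnbhs /= => -[r /= r0 hr].
    exists (complex.Re r); first by move: r0; rewrite ltcE => /andP[].
    move=> k kr; have [->|k0] := eqVneq k 0.
      by rewrite addr0 mulr0 subrr subr0 cabs0 mulr0.
    have := hr k; rewrite /= sub0r normrN normr_cabs.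
    have -> : ((cabs k)%:C%C < r).
      by move: r0; rewrite !ltcE /= => /andP[-> _].
    move=> /(_ isT k0); rewrite normr_cabs lecR.
    have -> : f (z + k) - f z - d * k = - (d - k^-1 *: (f (k *: 1 + z) - f z)) * k.
      rewrite !scE mulr1 (addrC k z); field.
      by rewrite k0.
    by rewrite cabsM cabsN => /ler_wpM2r; apply; exact: cabs_ge0.
  apply/cvgrPdist_le => e; rewrite ltcE /= => /andP[/eqP e2 e1].
  have [r r0 hr] := H _ e1.
  rewrite /prop_near1 /dnbhs /=; exists r%:C%C; first by rewrite /= ltcR.
  move=> k /=; rewrite sub0r normrN !normr_cabs ltcR => kr k0.
  rewrite lecE /= -e2 eqxx /=.
  have -> : d - k^-1 *: (f (k *: 1 + z) - f z) = - (f (z + k) - f z - d * k) / k.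
    rewrite !scE mulr1 (addrC k z); field.
    by rewrite k0.
  rewrite cabsM cabsN cabsV ler_pdivrMr ?cabs_gt0//; exact: hr.
split=> [[dv de]|/key h].
  by apply/key; rewrite -de; exact: dv.
split; first by apply/cvg_ex; exists d.
exact: cvg_lim h.
Qed.
End Cder.

Section CderRules.
Variable R : realType.
Local Notation C := (complex R).
Implicit Types (f g : C -> C) (z w d : C).

Lemma cder_cst c z : cder (fun=> c : C) z 0.
Proof. exact: is_derive_cst. Qed.
Lemma cder_id z : cder id z 1.
Proof. exact: is_derive_id. Qed.
Lemma cderD f g z a b : cder f z a -> cder g z b -> cder (fun w => f w + g w) z (a + b).
Proof. by move=> ? ?; exact: is_deriveD. Qed.
Lemma cderN f z a : cder f z a -> cder (fun w => - f w) z (- a).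
Proof. by move=> ?; exact: is_deriveN. Qed.
Lemma cderB f g z a b : cder f z a -> cder g z b -> cder (fun w => f w - g w) z (a - b).
Proof. by move=> ? ?; exact: is_deriveB. Qed.
Lemma cder_eq f z a b : cder f z a -> a = b -> cder f z b.
Proof. by move=> ? <-. Qed.
Lemma cderM f g z a b : cder f z a -> cder g z b ->
  cder (fun w => f w * g w) z (a * g z + f z * b).
Proof.
move=> fa gb; apply: (@cder_eq _ _ (f z *: (b : C^o) + g z *: (a : C^o))).
  exact: is_deriveM.
by rewrite addrC (mulrC a).
Qed.
Lemma cderZ c f z a : cder f z a -> cder (fun w => c * f w) z (c * a).
Proof. by move=> fa; apply: cder_eq (cderM (cder_cst c z) fa) _; rewrite mul0r add0r. Qed.
Lemma cderX f n z a : cder f z a -> cder (fun w => f w ^+ n) z (n%:R * f z ^+ n.-1 * a).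
Proof.
move=> fa; elim: n => [|n IH].
  by rewrite mul0r mul0r; exact: cder_cst.
under eq_fun do rewrite exprS.
apply: cder_eq (cderM fa IH) _ => /=; case: n {IH} => [|n].
  by rewrite !expr0; ring.
by rewrite /= exprS (_ : n.+2%:R = n.+1%:R + 1 :> C) ?natr1//; ring.
Qed.
Lemma cderV f z a : f z != 0 -> cder f z a -> cder (fun w => (f w)^-1) z (- a / f z ^+ 2).
Proof.
move=> f0 [fa fe]; have dV := @derivableV _ (C^o) f z 1 f0 fa.
split; first exact: dV.
have := @deriveV _ (C^o) f z 1 f0 fa; rewrite fe => ->.
have scE (u v : C) : u *: (v : C^o) = u * v by [].
by rewrite scE mulNr mulrC mulNr.
Qed.
Lemma cder_ext f g z a : (exists2 r : R, 0 < r & forall w, cabs (w - z) < r -> f w = g w) ->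
  cder f z a -> cder g z a.
Proof.
move=> [r r0 fg] /cderP h; apply/cderP => e /h[s s0 hs].
exists (Order.min r s); first by rewrite lt_min r0.
move=> k; rewrite lt_min => /andP[kr ks].
rewrite -!fg ?subrr ?cabs0//; first exact: hs.
by rewrite addrC addKr.
Qed.
Lemma cder_unique f z a b : cder f z a -> cder f z b -> a = b.
Proof. by move=> [_ <-] [_ <-]. Qed.
Lemma cder_comp f g z a b : cder f (g z) a -> cder g z b -> cder (f \o g) z (a * b).
Proof.
move=> /cderP fa /cderP gb; apply/cderP => e e0.
(* The increment of [g] is at most (|b| + 1)|h| once its own error is at most |h|, which the minimum
   with 1 in [e2] ensures; each of the two error terms then gets e/2. *)
have e1 : 0 < e / 2 / (cabs b + 1).
  by rewrite !divr_gt0// ltr_wpDl// cabs_ge0.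
have [r r0 hr] := fa _ e1.
have e2 : 0 < Order.min 1 (e / 2 / (cabs a + 1)).
  by rewrite lt_min ltr01 !divr_gt0// ltr_wpDl// cabs_ge0.
have [s s0 hs] := gb _ e2.
exists (Order.min s (r / (cabs b + 1))).
  by rewrite lt_min s0 divr_gt0// ltr_wpDl// cabs_ge0.
move=> h; rewrite lt_min => /andP[/hs hhs hr'].
set k := g (z + h) - g z.
have kb : cabs k <= (cabs b + 1) * cabs h.
  have -> : k = (k - b * h) + b * h by ring.
  rewrite (le_trans (cabsD _ _))// cabsM mulrDl mul1r addrC lerD2l.
  rewrite (le_trans hhs)// ler_piMl ?cabs_ge0// ge_min lexx//.
have b1 : 0 < cabs b + 1 by rewrite ltr_wpDl// cabs_ge0.
have kr : cabs k < r.
  by rewrite (le_lt_trans kb)// mulrC -ltr_pdivlMr.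
have gk : g z + k = g (z + h) by rewrite /k addrC subrK.
have h1 := hr _ kr; rewrite gk in h1; rewrite /=.
have -> : f (g (z + h)) - f (g z) - a * b * h = (f (g (z + h)) - f (g z) - a * k) + a * (k - b * h) by ring.
rewrite (le_trans (cabsD _ _))// (_ : e = e / 2 + e / 2) ?mulrDl; last by field.
apply: lerD.
  rewrite (le_trans h1)// -mulrA ler_pM2l ?divr_gt0//.
  by rewrite mulrC ler_pdivrMr// mulrC.
rewrite cabsM; apply: (@le_trans _ _ (cabs a * (e / 2 / (cabs a + 1) * cabs h))).
  rewrite ler_wpM2l ?cabs_ge0// (le_trans hhs)// ler_wpM2r ?cabs_ge0//.
  by rewrite ge_min lexx orbT.
have a1 : 0 < cabs a + 1 by rewrite ltr_wpDl// cabs_ge0.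
rewrite mulrA ler_wpM2r ?cabs_ge0// mulrCA ler_piMr//; first by rewrite ltW// divr_gt0.
by rewrite ler_pdivrMr// mul1r lerDl.
Qed.

Definition ccont f z := {for (z : C^o), continuous (f : C^o -> C^o)}.

Lemma ccontP f z : ccont f z <-> forall e : R, 0 < e -> exists2 r : R, 0 < r &
  forall w, cabs (w - z) < r -> cabs (f w - f z) < e.
Proof.
split=> [/cvgrPdist_lt h e e0|H].
  have /h : 0 < (e%:C)%C by rewrite ltcR.
  rewrite /prop_near1 /= => -[r /= r0 hr].
  exists (complex.Re r); first by move: r0; rewrite ltcE => /andP[].
  move=> k kr; have := hr k; rewrite /= !normr_cabs.
  have -> : ((cabs (z - k))%:C%C < r).
    by move: r0; rewrite !ltcE /= cabsC => /andP[-> _].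
  by rewrite ltcR cabsC; apply.
apply/(@cvgrPdist_lt _ _ (C^o) (nbhs (z : C^o)) _) => e.
rewrite ltcE /= => /andP[/eqP e2 e1].
have [r r0 hr] := H _ e1.
rewrite /prop_near1 /=; exists r%:C%C; first by rewrite /= ltcR.
move=> k /=; rewrite !normr_cabs ltcR ltcE /= -e2 eqxx /= => kr.
by rewrite cabsC hr // cabsC.
Qed.
Lemma ccont_cst c z : ccont (fun=> c) z. Proof. exact: cst_continuous. Qed.
Lemma ccont_id z : ccont id z. Proof. by []. Qed.
Lemma ccontD f g z : ccont f z -> ccont g z -> ccont (fun w => f w + g w) z.
Proof. exact: continuousD. Qed.
Lemma ccontB f g z : ccont f z -> ccont g z -> ccont (fun w => f w - g w) z.
Proof. exact: continuousB. Qed.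
Lemma ccontM f g z : ccont f z -> ccont g z -> ccont (fun w => f w * g w) z.
Proof. exact: continuousM. Qed.
Lemma ccontV f z : f z != 0 -> ccont f z -> ccont (fun w => (f w)^-1) z.
Proof. by move=> f0 fc; exact: continuousV. Qed.
Lemma ccontX f n z : ccont f z -> ccont (fun w => f w ^+ n) z.
Proof.
move=> fc; elim: n => [|n IH]; first exact: ccont_cst.
by (under eq_fun do rewrite exprS); exact: (ccontM fc IH).
Qed.
Lemma ccont_conj f z : ccont f z -> ccont (fun w => Num.conj (f w)) z.
Proof.
move=> /ccontP h; apply/ccontP => e /h[r r0 hr]; exists r => // w /hr.
by rewrite -(cabs_conj (f w - _)) rmorphB.
Qed.
Lemma ccont_comp f g z : ccont f (g z) -> ccont g z -> ccont (fun w => f (g w)) z.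
Proof. exact: (fun fc gc => @continuous_comp _ _ _ (g : C^o -> C^o) (f : C^o -> C^o) _ gc fc). Qed.
Lemma cder_ccont f z a : cder f z a -> ccont f z.
Proof.
move=> [fa _]; apply: differentiable_continuous.
exact/derivable1_diffP.
Qed.
End CderRules.

(** * Curves in the complex plane and mean value inequalities *)

Section Rder.
Variable R : realType.
Local Notation C := (complex R).

(** Curves are differentiated componentwise, so that the real mean value theorem and the real
    fundamental theorem of calculus apply to each part. *)
Definition rder (W : R -> C) (t : R) (d : C) : Prop :=
  is_derive t 1 (fun s => complex.Re (W s)) (complex.Re d) /\
  is_derive t 1 (fun s => complex.Im (W s)) (complex.Im d).

Let scE (a b : R) : a *: (b : R^o) = a * b. Proof. by []. Qed.

Lemma is_derive_eps (u : R -> R) (t d : R) :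
  (forall e : R, 0 < e -> exists2 r : R, 0 < r &
    forall h, `|h| < r -> `|u (t + h) - u t - d * h| <= e * `|h|) ->
  is_derive t 1 u d.
Proof.
move=> H.
have h : ((h^-1 *: ((u \o shift t) (h *: 1) - u t)) @[h --> 0^'] --> d).
  apply/cvgrPdist_le => e e0; have [r r0 hr] := H _ e0.
  rewrite /prop_near1 /dnbhs /=; exists r => //.
  move=> k /=; rewrite sub0r normrN => kr k0.
  have -> : d - k^-1 *: (u (k *: 1 + t) - u t) = - (u (t + k) - u t - d * k) / k.
    rewrite !scE mulr1 (addrC k t); field.
    by rewrite k0.
  by rewrite normrM normrN normfV ler_pdivrMr ?normr_gt0//; exact: hr.
split; first by apply/cvg_ex; exists d.
exact: cvg_lim h.
Qed.

Lemma rder_eq W t a b : rder W t a -> a = b -> rder W t b.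
Proof. by move=> ? <-. Qed.
Lemma rder_cst c t : rder (fun=> c) t 0.
Proof. by split; exact: is_derive_cst. Qed.
Lemma rderD W Z t a b : rder W t a -> rder Z t b -> rder (fun s => W s + Z s) t (a + b).
Proof.
move=> [a1 a2] [b1 b2]; split; rewrite raddfD /=.
  by (under eq_fun do rewrite raddfD); exact: is_deriveD.
by (under eq_fun do rewrite raddfD); exact: is_deriveD.
Qed.
Lemma rderN W t a : rder W t a -> rder (fun s => - W s) t (- a).
Proof.
move=> [a1 a2]; split; rewrite raddfN /=.
  by (under eq_fun do rewrite raddfN); exact: is_deriveN.
by (under eq_fun do rewrite raddfN); exact: is_deriveN.
Qed.
Lemma rderB W Z t a b : rder W t a -> rder Z t b -> rder (fun s => W s - Z s) t (a - b).
Proof. by move=> ha hb; apply: rderD => //; exact: rderN. Qed.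
Lemma ReD (a b : C) : complex.Re (a + b) = complex.Re a + complex.Re b.
Proof. by case: a b => [? ?] [? ?]. Qed.
Lemma ImD (a b : C) : complex.Im (a + b) = complex.Im a + complex.Im b.
Proof. by case: a b => [? ?] [? ?]. Qed.
Lemma ReB (a b : C) : complex.Re (a - b) = complex.Re a - complex.Re b.
Proof. by case: a b => [? ?] [? ?]. Qed.
Lemma ImB (a b : C) : complex.Im (a - b) = complex.Im a - complex.Im b.
Proof. by case: a b => [? ?] [? ?]. Qed.
Lemma ReM (a b : C) : complex.Re (a * b) =
  complex.Re a * complex.Re b - complex.Im a * complex.Im b.
Proof. by case: a b => [? ?] [? ?]. Qed.
Lemma ImM (a b : C) : complex.Im (a * b) =
  complex.Re a * complex.Im b + complex.Im a * complex.Re b.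
Proof. by case: a b => [? ?] [? ?]. Qed.
Lemma rderM W Z t a b : rder W t a -> rder Z t b ->
  rder (fun s => W s * Z s) t (a * Z t + W t * b).
Proof.
move=> [a1 a2] [b1 b2]; split.
  under eq_fun do rewrite ReM.
  apply: is_derive_eq; rewrite !scE ReD !ReM; ring.
under eq_fun do rewrite ImM.
apply: is_derive_eq; rewrite !scE ImD !ImM; ring.
Qed.
Lemma rderZ c W t a : rder W t a -> rder (fun s => c * W s) t (c * a).
Proof. by move=> fa; apply: rder_eq (rderM (rder_cst c t) fa) _; rewrite mul0r add0r. Qed.
Lemma rder_conj W t a : rder W t a -> rder (fun s => Num.conj (W s)) t (Num.conj a).
Proof.
have Rc (b : C) : complex.Re (Num.conj b) = complex.Re b by case: b.
have Ic (b : C) : complex.Im (Num.conj b) = - complex.Im b by case: b.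
move=> [a1 a2]; split; first by rewrite Rc; under eq_fun do rewrite Rc.
by rewrite Ic; under eq_fun do rewrite Ic; exact: is_deriveN.
Qed.

Lemma rder_line (f : C -> C) (z v d : C) (t : R) : cder f (z + t%:C%C * v) d ->
  rder (fun s : R => f (z + s%:C%C * v)) t (d * v).
Proof.
move=> /cderP H.
have key : forall e : R, 0 < e -> exists2 r : R, 0 < r &
    forall h : R, `|h| < r -> cabs (f (z + (t + h)%:C%C * v) - f (z + t%:C%C * v) - (d * v) * h%:C%C) <= e * `|h|.
  move=> e e0; have v1 : 0 < cabs v + 1 by rewrite ltr_wpDl// cabs_ge0.
  have /H[r r0 hr] : 0 < e / (cabs v + 1) by rewrite divr_gt0.
  exists (r / (cabs v + 1)); first by rewrite divr_gt0.
  move=> h hh; have := hr (h%:C%C * v).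
  have -> : z + t%:C%C * v + h%:C%C * v = z + (t + h)%:C%C * v by rewrite rmorphD; ring.
  rewrite (_ : d * v * _ = d * (h%:C%C * v)); last by ring.
  rewrite cabsM cabs_real.
  have hv : `|h| * cabs v <= `|h| * (cabs v + 1) by rewrite ler_wpM2l// lerDl.
  have lt : `|h| * cabs v < r.
    by rewrite (le_lt_trans hv)// -ltr_pdivlMr.
  move=> /(_ lt) H1; apply: (le_trans H1).
  by rewrite -mulrA ler_pM2l// mulrC ler_pdivrMr.
split; apply: is_derive_eps => e /key[r r0 hr]; exists r => // h /hr; apply: le_trans.
  apply: le_trans (cabs_Re _).
  by rewrite !ReB (ReM _ h%:C%C) /= mulr0 subr0.
apply: le_trans (cabs_Im _).
by rewrite !ImB (ImM _ h%:C%C) /= mulr0 add0r.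
Qed.

(** The mean value theorem with equality fails for complex values; it is applied to the real and to
    the imaginary part, whence the factor 2. *)
Lemma rder_MVI (W dW : R -> C) (a b M : R) : a <= b ->
  (forall t, a <= t <= b -> rder W t (dW t)) ->
  (forall t, a <= t <= b -> cabs (dW t) <= M) ->
  cabs (W b - W a) <= 2 * M * (b - a).
Proof.
move=> ab dW' hM.
have aux (u du : R -> R) : (forall t, a <= t <= b -> is_derive t 1 u (du t)) ->
    (forall t, a <= t <= b -> `|du t| <= M) -> `|u b - u a| <= M * (b - a).
  move=> h1 h2.
  have [|x /=|c] := @MVT_segment R u du a b ab.
  - by move=> x /[!in_itv]/= /andP[x1 x2]; apply: h1; rewrite !ltW.
  - apply: continuous_in_subspaceT x => x /[!inE] /=; rewrite in_itv/= => /h1 [hx _].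
    apply: differentiable_continuous; exact/derivable1_diffP.
  - rewrite in_itv /= => cab ->.
    rewrite normrM (ger0_norm (_ : 0 <= b - a)) ?subr_ge0// ler_wpM2r ?subr_ge0//.
    exact: h2.
rewrite (le_trans (cabs_le_ReIm _))// ReB ImB (_ : 2 * M * _ = M * (b - a) + M * (b - a)); last by ring.
apply: lerD.
  apply: (aux (fun t => complex.Re (W t)) (fun t => complex.Re (dW t))) => t tab; first by case: (dW' _ tab).
  by rewrite (le_trans (cabs_Re _)) ?hM.
apply: (aux (fun t => complex.Im (W t)) (fun t => complex.Im (dW t))) => t tab; first by case: (dW' _ tab).
by rewrite (le_trans (cabs_Im _)) ?hM.
Qed.

Lemma cder_MVI (f df : C -> C) (z w : C) (M : R) :
  (forall t : R, 0 <= t <= 1 -> cder f (z + t%:C%C * (w - z)) (df (z + t%:C%C * (w - z)))) ->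
  (forall t : R, 0 <= t <= 1 -> cabs (df (z + t%:C%C * (w - z))) <= M) ->
  cabs (f w - f z) <= 2 * M * cabs (w - z).
Proof.
move=> h1 h2.
have := @rder_MVI (fun t => f (z + t%:C%C * (w - z)))
  (fun t => df (z + t%:C%C * (w - z)) * (w - z)) 0 1 (M * cabs (w - z)) ler01.
rewrite mul0r mul1r addr0 subr0 mulr1 (addrC z) subrK mulrA; apply.
  by move=> t t01; apply: rder_line; exact: h1.
by move=> t t01; rewrite cabsM ler_wpM2r ?cabs_ge0// h2.
Qed.
End Rder.

(** * Integration over disks *)

Section Disk.
Variable R : realType.
Local Notation C := (complex R).
Local Notation TR := (measurableTypeR R).
Local Notation mu := (@lebesgue_measure R \x @lebesgue_measure R)%E.

Definition disk (r : R) : set (R * R) := [set p | p.1 ^+ 2 + p.2 ^+ 2 < r ^+ 2].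

Lemma disk1 : disk 1 = @diskxy R.
Proof. by rewrite /disk /diskxy expr1n. Qed.

Lemma diskE (r : R) p : 0 <= r -> disk r p <-> cabs (toC p) < r.
Proof.
move=> r0; rewrite /disk /= -(@ltr_pXn2r _ 2 _ (cabs _))// ?nnegrE ?cabs_ge0//.
by rewrite -sqn_cabs.
Qed.

Lemma subset_disk (r s : R) : 0 <= r <= s -> disk r `<=` disk s.
Proof.
move=> /andP[r0 rs] p /(diskE _ r0) h; apply/diskE; first exact: le_trans rs.
exact: lt_le_trans rs.
Qed.

(** Measurability refers to the product sigma-algebra. An open set is the countable union of the
    rational boxes that it contains; the other boxes are replaced by the empty set. *)
Lemma open_measurable2 (U : set (R * R)) :
  (forall p, U p -> exists2 d : R, 0 < d &
     forall q, `|q.1 - p.1| < d -> `|q.2 - p.2| < d -> U q) -> measurable U.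
Proof.
move=> oU.
pose box (i : rat * rat * (rat * rat)) : set (R * R) :=
  `]ratr i.1.1, ratr i.1.2[%classic `*` `]ratr i.2.1, ratr i.2.2[%classic.
pose F i := if `[< box i `<=` U >] then box i else set0.
have -> : U = \bigcup_i F i.
  apply/seteqP; split=> [p Up|p [i _]]; last first.
    by rewrite /F; case: asboolP => // h /h.
  have [d d0 hd] := oU _ Up.
  have [a1 ha1] := @rat_in_itvoo R (p.1 - d) p.1 (ltac:(by rewrite gtrBl)).
  have [b1 hb1] := @rat_in_itvoo R p.1 (p.1 + d) (ltac:(by rewrite ltrDl)).
  have [a2 ha2] := @rat_in_itvoo R (p.2 - d) p.2 (ltac:(by rewrite gtrBl)).
  have [b2 hb2] := @rat_in_itvoo R p.2 (p.2 + d) (ltac:(by rewrite ltrDl)).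
  move: ha1 hb1 ha2 hb2; rewrite !in_itv /= => /andP[? ?] /andP[? ?] /andP[? ?] /andP[? ?].
  exists ((a1, b1), (a2, b2)) => //; rewrite /F.
  case: asboolP => [_|[]]; first by split; rewrite /= in_itv/=; apply/andP.
  move=> q [/=]; rewrite !in_itv /= => /andP[? ?] /andP[? ?].
  by apply: hd; rewrite ltr_norml; apply/andP; split; lra.
apply: countable_bigcupT_measurable => // i; rewrite /F.
case: asboolP => _; last exact: measurable0.
by apply: measurableX; exact: measurable_itv.
Qed.

Lemma measurable_disk (r : R) : measurable (disk r : set (TR * TR)).
Proof.
suff : measurable (disk r) by [].
have -> : disk r = [set: R * R] `&` (fun p : R * R => p.1 ^+ 2 + p.2 ^+ 2) @^-1` `]-oo, r ^+ 2[%classic.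
  by apply/seteqP; split => p /=; rewrite in_itv/= ?setTI// => -[].
have m : measurable_fun [set: R * R] (fun p : R * R => p.1 ^+ 2 + p.2 ^+ 2).
  by apply: measurable_funD; apply: measurable_funX;
    [exact: measurable_fst|exact: measurable_snd].
exact: m.
Qed.
Hint Resolve measurable_disk : core.

Lemma cabs_toC_lt (p q : R * R) (d : R) : `|q.1 - p.1| < d / 2 -> `|q.2 - p.2| < d / 2 ->
  cabs (toC q - toC p) < d.
Proof.
move=> h1 h2; rewrite (le_lt_trans (cabs_le_ReIm _))// ReB ImB /=.
rewrite (_ : d = d / 2 + d / 2); last by field.
exact: ltrD.
Qed.

Lemma measurable_disk_eps (u : C -> R) (r : R) : 0 <= r ->
  (forall z, cabs z < r -> forall e : R, 0 < e -> exists2 d : R, 0 < d &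
     forall w, cabs (w - z) < d -> `|u w - u z| < e) ->
  measurable_fun (disk r) (u \o @toC R).
Proof.
move=> r0 hu mD; apply: (measurability _ (RGenOInfty.measurableE R)) => //.
move=> _ [_ [a ->] <-]; apply: open_measurable2 => p [Dp /=].
rewrite in_itv/= andbT => ap.
have zr : cabs (toC p) < r by apply/diskE.
have /(hu _ zr)[d d0 hd] : 0 < u (toC p) - a by rewrite subr_gt0.
have m0 : 0 < Order.min d (r - cabs (toC p)) by rewrite lt_min d0 subr_gt0.
exists (Order.min d (r - cabs (toC p)) / 2); first by rewrite divr_gt0.
move=> q q1 q2; have := cabs_toC_lt q1 q2; rewrite lt_min => /andP[qd qr]; split.
  apply/diskE => //; rewrite -(subrK (toC p) (toC q)).
  by rewrite (le_lt_trans (cabsD _ _))// -ltrBrDr.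
by rewrite /= in_itv/= andbT; move: (hd _ qd); rewrite ltr_norml => /andP[? _]; lra.
Qed.

Lemma ccont_measurable (f : C -> C) (r : R) : 0 <= r ->
  (forall z, cabs z < r -> ccont f z) ->
  measurable_fun (disk r) (fun p => complex.Re (f (toC p))) /\
  measurable_fun (disk r) (fun p => complex.Im (f (toC p))).
Proof.
move=> r0 hf; split.
  apply: (@measurable_disk_eps (fun z => complex.Re (f z))) => // z /hf /ccontP h e /h[d d0 hd].
  by exists d => // w /hd; apply: le_lt_trans; rewrite -ReB cabs_Re.
apply: (@measurable_disk_eps (fun z => complex.Im (f z))) => // z /hf /ccontP h e /h[d d0 hd].
by exists d => // w /hd; apply: le_lt_trans; rewrite -ImB cabs_Im.
Qed.

Lemma compact_cdisk (r : R) : compact [set p : R * R | p.1 ^+ 2 + p.2 ^+ 2 <= r ^+ 2].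
Proof.
have : compact (`[- `|r|, `|r|]%classic `*` `[- `|r|, `|r|]%classic : set (R * R)).
  by apply: compact_setX; exact: segment_compact.
move=> cB; apply: subclosed_compact _ cB _.
  have -> : [set p : R * R | p.1 ^+ 2 + p.2 ^+ 2 <= r ^+ 2] =
    (fun p : R * R => p.1 ^+ 2 + p.2 ^+ 2) @^-1` `]-oo, r ^+ 2]%classic.
    by apply/seteqP; split => p /=; rewrite in_itv.
  apply: preimage_closed; last exact: interval_closed.
  move=> p _; apply: cvgD; rewrite ?expr2; apply: cvgM; (exact: cvg_fst || exact: cvg_snd).
move=> [a b] /= h; rewrite !in_itv /= -!ler_norml -(@ler_pXn2r _ 2 (leqnSn 1) `|a|) ?nnegrE//.
rewrite -(@ler_pXn2r _ 2 _ `|b|) ?nnegrE// !real_normK ?num_real//.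
by split; apply: le_trans h; rewrite ?lerDl ?lerDr sqr_ge0.
Qed.

(** Continuity is asked relative to the closed disk, because at r = 1 the lemma is applied to a
    function built from the disk algebra, about which nothing is known outside. *)
Lemma cdisk_EVT (u : C -> R) (r : R) : 0 <= r ->
  (forall z, cabs z <= r -> forall e : R, 0 < e -> exists2 d : R, 0 < d &
     forall w, cabs w <= r -> cabs (w - z) < d -> `|u w - u z| < e) ->
  exists2 c, cabs c <= r & forall z, cabs z <= r -> u c <= u z.
Proof.
move=> r0 hu.
have inA p : p.1 ^+ 2 + p.2 ^+ 2 <= r ^+ 2 <-> cabs (toC p) <= r.
  by rewrite -(@ler_pXn2r _ 2 _ (cabs _))// ?nnegrE ?cabs_ge0// -sqn_cabs.
have [||c] := @compact_EVT_min _ R (u \o @toC R) _ _ (@compact_cdisk r).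
- by exists (0, 0); rewrite /= expr0n /= addr0 sqr_ge0.
- apply/subspace_continuousP => p /inA pA; apply/cvgrPdist_lt => e e0.
  have [d d0 hd] := hu _ pA _ e0.
  rewrite /prop_near1 /within /=; apply/nbhs_ballP; exists (d / 2); first by rewrite /= divr_gt0.
  move=> q [q1 q2] /inA qA; rewrite distrC; apply: hd => //.
  by apply: cabs_toC_lt; rewrite distrC.
- rewrite inE /= => /inA cA hc; exists (toC c) => // z zA.
  have -> : z = toC (complex.Re z, complex.Im z) by case: z {zA}.
  by apply: hc; rewrite inE; apply/(inA (complex.Re z, complex.Im z)); case: z zA.
Qed.

Lemma ccont_bounded (f : C -> C) (r : R) : 0 <= r ->
  (forall z, cabs z <= r -> ccont f z) ->
  exists2 M : R, 0 <= M & forall z, cabs z <= r -> cabs (f z) <= M.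
Proof.
move=> r0 hf; have [|c c1 hc] := @cdisk_EVT (fun z => - cabs (f z)) r r0.
  move=> z /hf /ccontP h e /h[d d0 hd]; exists d => // w _ /hd; apply: le_lt_trans.
  by rewrite -opprD normrN cabs_dist.
by exists (cabs (f c)); rewrite ?cabs_ge0// => z /hc; rewrite lerN2.
Qed.

Lemma ccont_lbounded (f : C -> C) (r : R) : 0 <= r ->
  (forall z, cabs z <= r -> ccont f z) ->  (forall z, cabs z <= r -> f z != 0) ->
  exists2 m : R, 0 < m & forall z, cabs z <= r -> m <= cabs (f z).
Proof.
move=> r0 hf f0; have [|c c1 hc] := @cdisk_EVT (fun z => cabs (f z)) r r0.
  move=> z /hf /ccontP h e /h[d d0 hd]; exists d => // w _ /hd; apply: le_lt_trans.
  by rewrite cabs_dist.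
by exists (cabs (f c)) => //; rewrite cabs_gt0 f0.
Qed.

Lemma mu_disk_lty (r : R) : (mu (disk r) < +oo)%E.
Proof.
apply: (@le_lt_trans _ _ (mu (`[- `|r|, `|r|]%classic `*` `[- `|r|, `|r|]%classic))).
  apply: le_measure; rewrite ?inE//; first exact: measurableX.
  move=> [a b]; rewrite /disk /= => /ltW h.
  rewrite !in_itv /= -!ler_norml -(@ler_pXn2r _ 2 (leqnSn 1) `|a|) ?nnegrE//.
  rewrite -(@ler_pXn2r _ 2 _ `|b|) ?nnegrE// !real_normK ?num_real//.
  by split; apply: le_trans h; rewrite ?lerDl ?lerDr sqr_ge0.
rewrite product_measure1E//= !lebesgue_measure_itv /=.
by case: ifPn => _; rewrite ?mule0 ?ltry// -EFinD -EFinM ltry.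
Qed.

Definition area (r : R) : R := fine (mu (disk r)).

Lemma area_gt0 (r : R) : 0 < r -> 0 < area r.
Proof.
move=> r0; rewrite /area fine_gt0// mu_disk_lty andbT.
apply: (@lt_le_trans _ _ (mu (`[0, r / 2]%classic `*` `[0, r / 2]%classic))).
  rewrite product_measure1E//= !lebesgue_measure_itv /= lte_fin divr_gt0//.
  by rewrite -EFinD -EFinM lte_fin subr0 mulr_gt0// divr_gt0.
apply: le_measure; rewrite ?inE//; first exact: measurableX.
move=> [a b]; rewrite /disk /= !in_itv /= => -[/andP[a0 ar] /andP[b0 br]].
have : a ^+ 2 <= (r / 2) ^+ 2 by rewrite ler_sqr ?nnegrE// divr_ge0// ltW.
have : b ^+ 2 <= (r / 2) ^+ 2 by rewrite ler_sqr ?nnegrE// divr_ge0// ltW.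
have : 0 < r ^+ 2 by rewrite exprn_gt0.
rewrite expr_div_n; lra.
Qed.

Lemma le_area (r s : R) : 0 <= r <= s -> area r <= area s.
Proof.
move=> rs; apply: fine_le; rewrite ?ge0_fin_numE ?mu_disk_lty//.
by apply: le_measure; rewrite ?inE//; exact: subset_disk.
Qed.
End Disk.
#[global] Hint Resolve measurable_disk : core.

Section ComplexIntegral.
Variable R : realType.
Local Notation C := (complex R).
Local Notation TR := (measurableTypeR R).
Local Notation mu := (@lebesgue_measure R \x @lebesgue_measure R)%E.
Implicit Types (A : set (TR * TR)) (F G : C -> C) (u v : C -> R).

Definition rint A u := mu.-integrable A (EFin \o (u \o @toC R)).
Definition rI A u : R := \int[mu]_(p in A) u (toC p).
Definition cint A F :=
  rint A (fun z => complex.Re (F z)) /\ rint A (fun z => complex.Im (F z)).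
Definition cI A F : C :=
  Complex (rI A (fun z => complex.Re (F z))) (rI A (fun z => complex.Im (F z))).

Lemma integD_cI F : integD F = cI (disk 1) F / (pi%:C)%C.
Proof.
rewrite /integD /cI /rI disk1 (_ : _ / _ = (pi^-1)%:C%C * cI (@diskxy R) F).
  by rewrite /cI /rI; simpc; rewrite !(mulrC pi^-1).
by rewrite mulrC fmorphV.
Qed.

Lemma rI_ext A u v : (forall p, A p -> u (toC p) = v (toC p)) -> rI A u = rI A v.
Proof. by move=> h; apply: eq_Rintegral => p /set_mem /h. Qed.
Lemma rint_ext A u v : measurable A -> (forall p, A p -> u (toC p) = v (toC p)) -> rint A u -> rint A v.
Proof.
move=> mA h; apply: eq_integrable => // p /set_mem /h /= ->//.
Qed.
Lemma cI_ext A F G : (forall p, A p -> F (toC p) = G (toC p)) -> cI A F = cI A G.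
Proof. by move=> h; congr Complex; apply: rI_ext => p /h ->. Qed.
Lemma cint_ext A F G : measurable A -> (forall p, A p -> F (toC p) = G (toC p)) -> cint A F -> cint A G.
Proof. by move=> mA h [a b]; split; [apply: rint_ext a|apply: rint_ext b] => // p /h ->. Qed.

Lemma rintD A u v : measurable A -> rint A u -> rint A v -> rint A (fun z => u z + v z).
Proof. by move=> mA a b; have := integrableD mA a b; apply: eq_integrable. Qed.
Lemma rintZ A (k : R) u : measurable A -> rint A u -> rint A (fun z => k * u z).
Proof. by move=> mA a; have := integrableZl mA k a; apply: eq_integrable. Qed.
Lemma rIZ A (k : R) u : measurable A -> rint A u -> rI A (fun z => k * u z) = k * rI A u.
Proof. by move=> mA a; rewrite /rI RintegralZl. Qed.
Lemma rID A u v : measurable A -> rint A u -> rint A v ->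
  rI A (fun z => u z + v z) = rI A u + rI A v.
Proof. by move=> mA a b; rewrite /rI RintegralD. Qed.
Lemma rI_le A u v : measurable A -> rint A u -> rint A v ->
  (forall p, A p -> u (toC p) <= v (toC p)) -> rI A u <= rI A v.
Proof. by move=> mA a b h; exact: le_Rintegral. Qed.
Lemma rI_ge0 A u : (forall p, A p -> 0 <= u (toC p)) -> 0 <= rI A u.
Proof. exact: Rintegral_ge0. Qed.
Lemma rint_le A u v : measurable A -> measurable_fun A (u \o @toC R) -> rint A v ->
  (forall p, A p -> `|u (toC p)| <= v (toC p)) -> rint A u.
Proof.
move=> mA mu' a h; apply: le_integrable a => //; first exact/measurable_EFinP.
move=> p Ap /=; rewrite lee_fin (le_trans (h _ Ap))// ler_norm//.
Qed.

Lemma cintD A F G : measurable A -> cint A F -> cint A G -> cint A (fun z => F z + G z).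
Proof.
move=> mA [a1 a2] [b1 b2]; split.
  by apply: (@rint_ext A (fun z => complex.Re (F z) + complex.Re (G z))) => // [p _|];
    [rewrite ReD|exact: rintD].
by apply: (@rint_ext A (fun z => complex.Im (F z) + complex.Im (G z))) => // [p _|];
  [rewrite ImD|exact: rintD].
Qed.
Lemma cID A F G : measurable A -> cint A F -> cint A G ->
  cI A (fun z => F z + G z) = cI A F + cI A G.
Proof.
move=> mA [a1 a2] [b1 b2]; rewrite {1}/cI.
rewrite (@rI_ext A _ (fun z => complex.Re (F z) + complex.Re (G z))); last by move=> p _; rewrite ReD.
rewrite (@rI_ext A (fun z => complex.Im (_ + _)) (fun z => complex.Im (F z) + complex.Im (G z)));
  last by move=> p _; rewrite ImD.
by rewrite !rID.
Qed.
Lemma cintZ A (k : C) F : measurable A -> cint A F -> cint A (fun z => k * F z).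
Proof.
move=> mA [a1 a2]; split.
  apply: (@rint_ext A (fun z => complex.Re k * complex.Re (F z) + - complex.Im k * complex.Im (F z))) => //.
    by move=> p _; rewrite ReM mulNr.
  by apply: rintD => //; apply: rintZ.
apply: (@rint_ext A (fun z => complex.Re k * complex.Im (F z) + complex.Im k * complex.Re (F z))) => //.
  by move=> p _; rewrite ImM.
by apply: rintD => //; apply: rintZ.
Qed.
Lemma cIZ A (k : C) F : measurable A -> cint A F -> cI A (fun z => k * F z) = k * cI A F.
Proof.
move=> mA [a1 a2]; rewrite {1}/cI.
rewrite (@rI_ext A _ (fun z => complex.Re k * complex.Re (F z) + - complex.Im k * complex.Im (F z)));
  last by move=> p _; rewrite ReM mulNr.
rewrite (@rI_ext A (fun z => complex.Im (_ * _))
  (fun z => complex.Re k * complex.Im (F z) + complex.Im k * complex.Re (F z))); last by move=> p _; rewrite ImM.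
rewrite !rID ?rIZ//; try exact: rintZ.
by case: k => a b; rewrite /cI; simpc.
Qed.
Lemma cintN A F : measurable A -> cint A F -> cint A (fun z => - F z).
Proof. by move=> mA a; apply: cint_ext (cintZ (-1) mA a) => // p _; rewrite mulN1r. Qed.
Lemma cIN A F : measurable A -> cint A F -> cI A (fun z => - F z) = - cI A F.
Proof.
move=> mA a; rewrite (@cI_ext _ _ (fun z => -1 * F z)) ?cIZ ?mulN1r// => p _.
by rewrite mulN1r.
Qed.
Lemma cintB A F G : measurable A -> cint A F -> cint A G -> cint A (fun z => F z - G z).
Proof. by move=> mA a b; apply: cintD => //; exact: cintN. Qed.
Lemma cIB A F G : measurable A -> cint A F -> cint A G ->
  cI A (fun z => F z - G z) = cI A F - cI A G.
Proof. by move=> mA a b; rewrite cID ?cIN//; exact: cintN. Qed.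
Lemma cint0 A : measurable A -> cint A (fun=> 0).
Proof. by move=> mA; split; rewrite /rint; apply: eq_integrable (integrable0 _ _). Qed.
Lemma cI0 A : measurable A -> cI A (fun=> 0) = 0.
Proof. by move=> mA; rewrite -(mulr0 0) (@cIZ A 0 (fun=> 0)) ?mul0r//; exact: cint0. Qed.
Lemma cint_sum A (I : Type) (s : seq I) (F : I -> C -> C) : measurable A ->
  (forall i, cint A (F i)) -> cint A (fun z => \sum_(i <- s) F i z).
Proof.
move=> mA h; elim: s => [|i s IH].
  by apply: cint_ext (cint0 mA) => // p _; rewrite big_nil.
by apply: cint_ext (cintD mA (h i) IH) => // p _; rewrite big_cons.
Qed.
Lemma cI_sum A (I : Type) (s : seq I) (F : I -> C -> C) : measurable A ->
  (forall i, cint A (F i)) -> cI A (fun z => \sum_(i <- s) F i z) = \sum_(i <- s) cI A (F i).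
Proof.
move=> mA h; elim: s => [|i s IH].
  by rewrite big_nil (@cI_ext _ _ (fun=> 0)) ?cI0// => p _; rewrite big_nil.
rewrite big_cons -IH -cID//; last exact: cint_sum.
by apply: cI_ext => p _; rewrite big_cons.
Qed.
Lemma cI_conj A F : measurable A -> cint A F -> cI A (fun z => Num.conj (F z)) = Num.conj (cI A F).
Proof.
move=> mA [a b]; rewrite /cI /=; congr Complex.
  by apply: rI_ext => p _; case: (F _).
rewrite -mulN1r -rIZ//; apply: rI_ext => p _; case: (F _) => x y /=.
by rewrite mulN1r.
Qed.

Lemma cI_le A F u : measurable A -> cint A F -> rint A u ->
  (forall p, A p -> cabs (F (toC p)) <= u (toC p)) -> cabs (cI A F) <= 2 * rI A u.
Proof.
move=> mA [a b] ui h; rewrite (le_trans (cabs_le_ReIm _))//= (_ : 2 * _ = rI A u + rI A u); last by ring.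
have aux v : rint A v -> (forall p, A p -> `|v (toC p)| <= u (toC p)) -> `|rI A v| <= rI A u.
  move=> vi hv; rewrite (le_trans (le_normr_Rintegral _ _))//.
  apply: le_Rintegral => //.
  by have := integrable_norm vi; apply: eq_integrable.
by apply: lerD; apply: aux => // p /h; apply: le_trans; rewrite ?cabs_Re ?cabs_Im.
Qed.

Lemma rint_cst (r c : R) : rint (disk r) (fun=> c).
Proof.
apply/integrableP; split.
  by apply/measurable_EFinP; apply: measurable_cst.
rewrite /= integral_cst; last exact: measurable_disk.
by rewrite lte_mul_pinfty// mu_disk_lty.
Qed.
Lemma rI_cst (r c : R) : rI (disk r) (fun=> c) = c * area r.
Proof. by rewrite /rI Rintegral_cst//; exact: measurable_disk. Qed.
Lemma cI_cst (r : R) (c : C) : cI (disk r) (fun=> c) = c * (area r)%:C%C.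
Proof. by case: c => a b; rewrite /cI /= !rI_cst; simpc. Qed.

Lemma cint_bounded (r M : R) F : 0 <= r -> (forall z, cabs z < r -> ccont F z) ->
  (forall z, cabs z < r -> cabs (F z) <= M) -> cint (disk r) F.
Proof.
move=> r0 /(ccont_measurable r0)[m1 m2] FM.
have mD := @measurable_disk R r.
split; apply: rint_le (rint_cst r M) _ => // p /(diskE _ r0) /FM; apply: le_trans;
  by rewrite ?cabs_Re ?cabs_Im.
Qed.
Lemma cint_ccont (r : R) F : 0 <= r -> (forall z, cabs z <= r -> ccont F z) -> cint (disk r) F.
Proof.
move=> r0 h; have [M _ hM] := ccont_bounded r0 h.
by apply: (@cint_bounded r M) => // z /ltW; [exact: h|exact: hM].
Qed.
Lemma cI_bounded (r M : R) F : 0 <= r -> (forall z, cabs z < r -> ccont F z) ->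
  (forall z, cabs z < r -> cabs (F z) <= M) -> cabs (cI (disk r) F) <= 2 * M * area r.
Proof.
move=> r0 h FM; rewrite -mulrA -rI_cst; apply: cI_le; [exact: measurable_disk| |exact: rint_cst|].
  exact: cint_bounded FM.
by move=> p /(diskE _ r0) /FM.
Qed.
End ComplexIntegral.

(** * Stokes' formula on disks *)

Section Stokes.
Variable R : realType.
Local Notation C := (complex R).
Local Notation TR := (measurableTypeR R).
Local Notation leb := (@lebesgue_measure R).
Local Notation mu := (@lebesgue_measure R \x @lebesgue_measure R)%E.

Lemma integral_slice (U u : R -> R) (s : R) : 0 < s ->
  (forall t : R, `|t| <= s -> is_derive t 1 U (u t)) ->
  (forall t : R, `|t| <= s -> {for t, continuous u}) -> U s = 0 -> U (- s) = 0 ->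
  (\int[leb]_(t in `](- s)%R, s[) (u t)%:E = 0)%E.
Proof.
move=> s0 dU cu Us UNs.
have ss : - s < s by lra.
have inN t : t \in `[- s, s]%R -> `|t| <= s by rewrite in_itv/= ler_norml.
have inNo t : t \in `]- s, s[%R -> `|t| <= s.
  by rewrite in_itv/= ler_norml => /andP[/ltW-> /ltW->].
have cont t : `|t| <= s -> {for t, continuous U}.
  move=> /dU[h _]; apply: differentiable_continuous; exact/derivable1_diffP.
have cw : {within `[- s, s], continuous u}.
  by apply: continuous_in_subspaceT => t /set_mem /= /inN /cu.
have m1 : measurable_fun `[- s, s] (EFin \o u).
  apply/measurable_EFinP; apply: subspace_continuous_measurable_fun => //.
rewrite -(@integral_itv_bndoo _ _ _ _ true false); last first.
  by apply: measurable_funS m1 => //; exact: subset_itv_oo_cc.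
rewrite (@continuous_FTC2 _ u U) ?Us ?UNs ?subee//.
  split.
  - by move=> t /inNo /dU [].
  - by apply/cvg_at_right_filter; apply: cont; rewrite normrN ger0_norm// ltW.
  - by apply/cvg_at_left_filter; apply: cont; rewrite ger0_norm// ltW.
by move=> t /inNo /dU [_ <-]; rewrite derive1E.
Qed.

(** The slice at height y is the interval (-s, s) with s^2 = r^2 - y^2, whose endpoints lie on the
    circle where [U] vanishes; it is empty when y^2 >= r^2. *)
Let slice_lemma (v : R -> R) (U : R -> R) (r y : R) : 0 < r ->
  (forall x : R, x ^+ 2 + y ^+ 2 <= r ^+ 2 -> is_derive x 1 U (v x)) ->
  (forall x : R, x ^+ 2 + y ^+ 2 <= r ^+ 2 -> {for x, continuous v}) ->
  (forall x : R, x ^+ 2 + y ^+ 2 = r ^+ 2 -> U x = 0) ->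
  (\int[leb]_x ((EFin \o v) \_ [set x : R | (x ^+ 2 + y ^+ 2 < r ^+ 2)%R]) x = 0)%E.
Proof.
move=> r0 dU cv U0; rewrite -integral_mkcond.
have [yr|ry] := ltP (y ^+ 2) (r ^+ 2); last first.
  rewrite (_ : [set x : R | _] = set0) ?integral_set0//.
  by apply/seteqP; split => x //= h; have := sqr_ge0 x; lra.
pose s := Num.sqrt (r ^+ 2 - y ^+ 2).
have s2 : s ^+ 2 = r ^+ 2 - y ^+ 2 by rewrite sqr_sqrtr// subr_ge0 ltW.
have s0 : 0 < s by rewrite sqrtr_gt0 subr_gt0.
have s0' := ltW s0.
have le (t : R) : `|t| <= s -> t ^+ 2 + y ^+ 2 <= r ^+ 2.
  by rewrite -(@ler_pXn2r _ 2 _ `|t|) ?nnegrE// real_normK ?num_real// s2; lra.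
rewrite (_ : [set x : R | _] = `](- s)%R, s[%classic); last first.
  apply/seteqP; split => x /=.
    rewrite in_itv/= -ltr_norml -(@ltr_pXn2r _ 2 _ `|x|) ?nnegrE// real_normK ?num_real// s2.
    by move=> ?; lra.
  rewrite in_itv/= -ltr_norml -(@ltr_pXn2r _ 2 _ `|x|) ?nnegrE// real_normK ?num_real// s2.
  by move=> ?; lra.
apply: (@integral_slice U) => //.
- by move=> t /le /dU.
- by move=> t /le /cv.
- by apply: U0; rewrite s2; ring.
- by apply: U0; rewrite sqrrN s2; ring.
Qed.

Let rI_restrict (v : C -> R) (r : R) : rint (disk r) v ->
  mu.-integrable setT ((EFin \o (v \o @toC R)) \_ (disk r)) /\
  rI (disk r) v = fine (\int[mu]_p ((EFin \o (v \o @toC R)) \_ (disk r)) p)%E.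
Proof.
have mD := @measurable_disk R r.
by move=> vi; split; [rewrite -integrable_mkcond|rewrite /rI /Rintegral integral_mkcond].
Qed.

(** Fubini with x integrated first: every horizontal slice contributes the variation of [U] between
    two points of the circle. *)
Lemma rI_dx0 (v : C -> R) (U : R -> R -> R) (r : R) : 0 < r -> rint (disk r) v ->
  (forall x y : R, x ^+ 2 + y ^+ 2 <= r ^+ 2 -> is_derive x 1 (U y) (v (Complex x y))) ->
  (forall x y : R, x ^+ 2 + y ^+ 2 <= r ^+ 2 -> {for x, continuous (fun t => v (Complex t y))}) ->
  (forall x y : R, x ^+ 2 + y ^+ 2 = r ^+ 2 -> U y x = 0) -> rI (disk r) v = 0.
Proof.
move=> r0 vi dU cv U0; have [fi ->] := rI_restrict vi.
rewrite -(integral21_prod_meas1 fi) /fubini_G.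
rewrite (eq_integral (fun=> 0%E)) ?integral0// => y _.
rewrite -[RHS](@slice_lemma (fun t => v (Complex t y)) (U y) r y r0).
- apply: eq_integral => x _; rewrite /patch /=.
  congr (if _ then _ else _); by apply/idP/idP; rewrite !inE.
- by move=> x /cv.
- by move=> x /U0.
Qed.

Lemma rI_dy0 (v : C -> R) (U : R -> R -> R) (r : R) : 0 < r -> rint (disk r) v ->
  (forall x y : R, x ^+ 2 + y ^+ 2 <= r ^+ 2 -> is_derive y 1 (U x) (v (Complex x y))) ->
  (forall x y : R, x ^+ 2 + y ^+ 2 <= r ^+ 2 -> {for y, continuous (fun t => v (Complex x t))}) ->
  (forall x y : R, x ^+ 2 + y ^+ 2 = r ^+ 2 -> U x y = 0) -> rI (disk r) v = 0.
Proof.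
move=> r0 vi dU cv U0; have [fi ->] := rI_restrict vi.
rewrite -(integral12_prod_meas1 fi) /fubini_F.
rewrite (eq_integral (fun=> 0%E)) ?integral0// => x _.
rewrite -[RHS](@slice_lemma (fun t => v (Complex x t)) (U x) r x r0).
- apply: eq_integral => y _; rewrite /patch /=.
  congr (if _ then _ else _); by apply/idP/idP; rewrite !inE /disk /= addrC.
- by move=> y; rewrite addrC => /dU.
- by move=> y; rewrite addrC => /cv.
- by move=> y; rewrite addrC => /U0.
Qed.
End Stokes.

Section Conj.
Variable R : realType.
Local Notation C := (complex R).
Implicit Types (a b : C).
Lemma conjM a b : Num.conj (a * b) = Num.conj a * Num.conj b. Proof. exact: rmorphM. Qed.
Lemma conjD a b : Num.conj (a + b) = Num.conj a + Num.conj b. Proof. exact: rmorphD. Qed.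
Lemma conjB a b : Num.conj (a - b) = Num.conj a - Num.conj b. Proof. exact: rmorphB. Qed.
Lemma conjX a n : Num.conj (a ^+ n) = Num.conj a ^+ n. Proof. exact: rmorphXn. Qed.
Lemma conjV a : Num.conj a^-1 = (Num.conj a)^-1. Proof. exact: fmorphV. Qed.
Lemma conj0 : Num.conj (0 : C) = 0. Proof. exact: rmorph0. Qed.
Lemma conj1 : Num.conj (1 : C) = 1. Proof. exact: rmorph1. Qed.
Lemma conjR (x : R) : Num.conj (x%:C%C : C) = x%:C%C. Proof. exact: conjc_real. Qed.
Lemma conjK a : Num.conj (Num.conj a) = a. Proof. exact: Num.Theory.conjCK. Qed.
End Conj.

Section ComplexStokes.
Variable R : realType.
Local Notation C := (complex R).

Let cdiskE (x y r : R) : 0 < r -> (x ^+ 2 + y ^+ 2 <= r ^+ 2) = (cabs (Complex x y) <= r).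
Proof.
move=> /ltW r0; rewrite -[RHS](@ler_pXn2r _ 2) ?nnegrE ?cabs_ge0//.
by rewrite -sqn_cabs.
Qed.
Let circleE (x y r : R) : 0 < r -> x ^+ 2 + y ^+ 2 = r ^+ 2 -> cabs (Complex x y) = r.
Proof.
move=> /ltW r0 h; apply/eqP; rewrite -(@eqrXn2 _ 2) ?cabs_ge0// -sqn_cabs.
by apply/eqP.
Qed.

Let ccont_comp_re (f : C -> C) (g : R -> C) (t : R) : ccont f (g t) ->
  (forall h, cabs (g (t + h) - g t) <= `|h|) ->
  {for t, continuous (fun s => complex.Re (f (g s)))} /\
  {for t, continuous (fun s => complex.Im (f (g s)))}.
Proof.
move=> /ccontP fc hg.
have key : forall e : R, 0 < e -> \forall s \near t, cabs (f (g s) - f (g t)) < e.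
  move=> e /fc[d d0 hd]; exists d => // s; rewrite /= distrC => st; apply: hd.
  by have := hg (s - t); rewrite (addrC t) subrK => /le_lt_trans; apply.
split; apply/cvgrPdist_lt => e /key; apply: filterS => s; rewrite distrC; apply: le_lt_trans.
  by rewrite -ReB cabs_Re.
by rewrite -ImB cabs_Im.
Qed.

Lemma cI_dx0 (W Wx : C -> C) (r : R) : 0 < r ->
  (forall z, cabs z <= r -> ccont Wx z) ->
  (forall x y : R, cabs (Complex x y) <= r -> rder (fun t => W (Complex t y)) x (Wx (Complex x y))) ->
  (forall z, cabs z = r -> W z = 0) -> cI (disk r) Wx = 0.
Proof.
move=> r0 cW dW W0; have [i1 i2] := cint_ccont (ltW r0) cW.
have cc (x y : R) : x ^+ 2 + y ^+ 2 <= r ^+ 2 ->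
  {for x, continuous (fun t => complex.Re (Wx (Complex t y)))} /\
  {for x, continuous (fun t => complex.Im (Wx (Complex t y)))}.
  rewrite cdiskE// => /cW h; apply: (@ccont_comp_re Wx (fun t => Complex t y)) => // t.
  rewrite (_ : _ - _ = t%:C%C) ?cabs_real//.
  by simpc; congr Complex; ring.
rewrite /cI; congr Complex.
- apply: (@rI_dx0 _ _ (fun y x => complex.Re (W (Complex x y))) r r0 i1).
  + by move=> x y; rewrite cdiskE// => /dW[].
  + by move=> x y /cc[].
  + by move=> x y /circleE /W0 ->.
- apply: (@rI_dx0 _ _ (fun y x => complex.Im (W (Complex x y))) r r0 i2).
  + by move=> x y; rewrite cdiskE// => /dW[].
  + by move=> x y /cc[].
  + by move=> x y /circleE /W0 ->.
Qed.

Lemma cI_dy0 (W Wy : C -> C) (r : R) : 0 < r ->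
  (forall z, cabs z <= r -> ccont Wy z) ->
  (forall x y : R, cabs (Complex x y) <= r -> rder (fun t => W (Complex x t)) y (Wy (Complex x y))) ->
  (forall z, cabs z = r -> W z = 0) -> cI (disk r) Wy = 0.
Proof.
move=> r0 cW dW W0; have [i1 i2] := cint_ccont (ltW r0) cW.
have cc (x y : R) : x ^+ 2 + y ^+ 2 <= r ^+ 2 ->
  {for y, continuous (fun t => complex.Re (Wy (Complex x t)))} /\
  {for y, continuous (fun t => complex.Im (Wy (Complex x t)))}.
  rewrite cdiskE// => /cW h; apply: (@ccont_comp_re Wy (fun t => Complex x t)) => // t.
  rewrite (_ : _ - _ = t%:C%C * Complex 0 1).
    by rewrite cabsM cabs_real /cabs /= expr0n expr1n add0r sqrtr1 mulr1.
  by simpc; congr Complex; ring.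
rewrite /cI; congr Complex.
- apply: (@rI_dy0 _ _ (fun x y => complex.Re (W (Complex x y))) r r0 i1).
  + by move=> x y; rewrite cdiskE// => /dW[].
  + by move=> x y /cc[].
  + by move=> x y /circleE /W0 ->.
- apply: (@rI_dy0 _ _ (fun x y => complex.Im (W (Complex x y))) r r0 i2).
  + by move=> x y; rewrite cdiskE// => /dW[].
  + by move=> x y /cc[].
  + by move=> x y /circleE /W0 ->.
Qed.

(* The integrand is the d-bar derivative of (|z|^2 - r^2) Phi(z) conj(h(z)),
   which vanishes on the circle of radius r. *)
Lemma stokes (Phi phi h eta : C -> C) (r : R) : 0 < r ->
  (forall z, cabs z <= r -> cder Phi z (phi z)) ->
  (forall z, cabs z <= r -> cder h z (eta z)) ->
  (forall z, cabs z <= r -> ccont phi z) ->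
  (forall z, cabs z <= r -> ccont eta z) ->
  cI (disk r) (fun z => Phi z * (z * Num.conj (h z) +
    (z * Num.conj z - (r ^+ 2)%:C%C) * Num.conj (eta z))) = 0.
Proof.
move=> r0 dP dh cp ce; set r2 := (_%:C)%C.
have mD := @measurable_disk R r.
pose W z := (z * Num.conj z - r2) * (Phi z * Num.conj (h z)).
(* [dW v] is the derivative of [W] in the real direction [v]; the directions 1 and i are used. *)
pose dW (v z : C) := (v * Num.conj z + z * Num.conj v) * (Phi z * Num.conj (h z))
   + (z * Num.conj z - r2) * ((phi z * v) * Num.conj (h z) + Phi z * Num.conj (eta z * v)).
have W0 z : cabs z = r -> W z = 0.
  by move=> zr; rewrite /W -sqr_cabs zr subrr mul0r.
have cP z : cabs z <= r -> ccont Phi z by move=> /dP /cder_ccont.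
have ch z : cabs z <= r -> ccont h z by move=> /dh /cder_ccont.
have cdW v z : cabs z <= r -> ccont (dW v) z.
  move=> zr; have ci := @ccont_id R z; have cci := ccont_conj ci.
  have c1 := ccontM (cP _ zr) (ccont_conj (ch _ zr)).
  have cst c := @ccont_cst R c z.
  exact: (ccontD
    (ccontM (ccontD (ccontM (cst v) cci) (ccontM ci (cst (Num.conj v)))) c1)
    (ccontM (ccontB (ccontM ci cci) (cst r2))
      (ccontD (ccontM (ccontM (cp _ zr) (cst v)) (ccont_conj (ch _ zr)))
        (ccontM (cP _ zr) (ccont_conj (ccontM (ce _ zr) (cst v))))))).
have dline (z0 v : C) (t : R) : cabs (z0 + t%:C%C * v) <= r ->
    rder (fun s : R => W (z0 + s%:C%C * v)) t (dW v (z0 + t%:C%C * v)).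
  move=> zr; set z := z0 + _ in zr *.
  have di := rder_line (cder_id z); rewrite /= in di.
  have dP' := rder_line (dP _ zr); have dh' := rder_line (dh _ zr).
  have := rderM (rderB (rderM di (rder_conj di)) (rder_cst r2 t)) (rderM dP' (rder_conj dh')).
  move=> d; apply: rder_eq d _; rewrite -/z /dW mul1r; ring.
have Wx : cI (disk r) (dW 1) = 0.
  apply: (@cI_dx0 W (dW 1) r r0 (cdW 1) _ W0) => x y xy.
  have e (t : R) : Complex t y = Complex 0 y + t%:C%C * 1 :> C.
    by rewrite mulr1; simpc.
  rewrite e; rewrite e in xy; have := dline _ _ _ xy.
  by under [in X in _ -> X]eq_fun do rewrite e.
have Wy : cI (disk r) (dW (Complex 0 1)) = 0.
  apply: (@cI_dy0 W (dW (Complex 0 1)) r r0 (cdW _) _ W0) => x y xy.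
  have e (t : R) : Complex x t = Complex x 0 + t%:C%C * Complex 0 1 :> C.
    by simpc.
  rewrite e; rewrite e in xy; have := dline _ _ _ xy.
  by under [in X in _ -> X]eq_fun do rewrite e.
have i1 := cint_ccont (ltW r0) (cdW 1).
have i2 := cint_ccont (ltW r0) (cdW (Complex 0 1)).
have i3 := cintZ (Complex 0 1) mD i2.
(* The d-bar derivative is (d_x + i d_y) / 2: it kills the analytic factor [Phi], turns conj(h) into
   conj(eta) and |z|^2 into z. *)
have : cI (disk r) (fun z => 2^-1 * (dW 1 z + Complex 0 1 * dW (Complex 0 1) z)) = 0.
  rewrite cIZ//; last exact: cintD.
  by rewrite cID// cIZ// Wx Wy !mulr0 addr0 mulr0.
move=> E; rewrite -[RHS]E; apply: cI_ext => p _; rewrite /dW.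
set z := toC p; set zb := Num.conj z.
have ii : Complex 0 1 * Complex 0 1 = -1 :> C by simpc.
have ci : Num.conj (Complex 0 1 : C) = - Complex 0 1 by rewrite /=; congr Complex; rewrite oppr0.
rewrite !conjM ci conj1; move: (Complex 0 1 : C) ii => i ii.
set a := Num.conj (h z); set b := Num.conj (eta z).
have -> : 2^-1 * ((1 * zb + z * 1) * (Phi z * a) + (z * zb - r2) * (phi z * 1 * a + Phi z * (b * 1))
  + i * ((i * zb + z * - i) * (Phi z * a) + (z * zb - r2) * (phi z * i * a + Phi z * (b * - i)))) =
   2^-1 * ((zb + z) * (Phi z * a) + (z * zb - r2) * (phi z * a + Phi z * b)
  + (i * i) * ((zb - z) * (Phi z * a) + (z * zb - r2) * (phi z * a - Phi z * b))) by ring.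
by rewrite ii; field.
Qed.

(** [stokes] with the roles of [Phi] and [h] exchanged, then conjugated: the derivative now falls on
    the analytic function and not on the test function. *)
Lemma stokes_conj (Phi phi h eta : C -> C) (r : R) : 0 < r ->
  (forall z, cabs z <= r -> cder Phi z (phi z)) ->
  (forall z, cabs z <= r -> cder h z (eta z)) ->
  (forall z, cabs z <= r -> ccont phi z) ->
  (forall z, cabs z <= r -> ccont eta z) ->
  cI (disk r) (fun z => (Num.conj z * Phi z +
    (z * Num.conj z - (r ^+ 2)%:C%C) * phi z) * Num.conj (h z)) = 0.
Proof.
move=> r0 dP dh cp ce.
have cP z : cabs z <= r -> ccont Phi z by move=> /dP /cder_ccont.
have ch z : cabs z <= r -> ccont h z by move=> /dh /cder_ccont.
have mD := @measurable_disk R r.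
have := stokes r0 dh dP ce cp => /(congr1 Num.conj); rewrite conj0 -cI_conj//.
  move=> E; rewrite -[RHS]E; apply: cI_ext => p _.
  rewrite conjM conjD !conjM conjB !conjM !conjK conjR mulrC.
  by rewrite (mulrC _ (toC p)).
apply: cint_ccont (ltW r0) _ => z zr.
have ci := @ccont_id R z; have cci := ccont_conj ci.
exact: (ccontM (ch _ zr) (ccontD (ccontM ci (ccont_conj (cP _ zr)))
  (ccontM (ccontB (ccontM ci cci) (@ccont_cst R (r ^+ 2)%:C%C z)) (ccont_conj (cp _ zr))))).
Qed.
End ComplexStokes.

(** * Goursat's theorem and primitives *)

Section Goursat.
Variable R : realType.
Local Notation C := (complex R).
Local Notation leb := (@lebesgue_measure R).
Local Notation ii := (Complex 0 1 : C).

Lemma rder_MVI_abs (W dW : R -> C) (a b M : R) :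
  (forall t, Num.min a b <= t <= Num.max a b -> rder W t (dW t)) ->
  (forall t, Num.min a b <= t <= Num.max a b -> cabs (dW t) <= M) ->
  cabs (W b - W a) <= 2 * M * `|b - a|.
Proof.
have [ab|ba] := leP a b => h1 h2.
  by rewrite ger0_norm ?subr_ge0//; apply: rder_MVI h2.
have ba' := ltW ba.
by rewrite cabsC distrC ger0_norm ?subr_ge0//; apply: rder_MVI h2.
Qed.

Lemma is_derive_integral (u : R -> R) (a x : R) : continuous u -> a < x ->
  is_derive x 1 (fun x => \int[leb]_(t in `[a, x]) u t) (u x).
Proof.
move=> cu ax; have xu : x < x + 1 by rewrite ltrDl.
have iu : leb.-integrable `[a, x + 1] (EFin \o u).
  apply: continuous_compact_integrable; first exact: segment_compact.
  exact: continuous_subspaceT.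
have [d1 d2] := continuous_FTC1_closed xu iu ax (cu x).
by rewrite derive1E in d2; exact: (DeriveDef d1 d2).
Qed.

Let cabs_i : cabs ii = 1.
Proof. by rewrite /cabs /= expr0n expr1n add0r sqrtr1. Qed.

Let mu_telescope (a1 a2 a3 a4 b1 b2 b3 b4 p1 p2 p3 p4 i : C) :
  a1 - a2 + i * (b1 - b2) - (a3 - a4) - i * (b3 - b4) =
  (a1 - p1) - (a2 - p2) - ((a3 - p3) - (a4 - p4))
  + ((i * b1 - p3) - (i * b2 - p1)) - ((i * b3 - p4) - (i * b4 - p2)).
Proof. ring. Qed.

Let cder_quadratic (c d z0 z : C) :
  cder (fun z => c * z + d * (2^-1 * (z - z0) ^+ 2)) z (c + d * (z - z0)).
Proof.
have d1 := cderZ c (cder_id z).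
have d2 := cderZ d (cderZ 2^-1 (cderX 2 (cderB (cder_id z) (cder_cst z0 z)))).
by apply: cder_eq (cderD d1 d2) _; rewrite /= expr1 subr0 !mulr1; field.
Qed.

Section Rectangle.
Variables (g : C -> C) (A B : R -> R -> C).
Hypothesis dA : forall x y : R, - 2 < x -> rder (fun t => A t y) x (g (Complex x y)).
Hypothesis dB : forall x y : R, - 2 < y -> rder (fun t => B x t) y (g (Complex x y)).

(** The contour integral of [g] around the rectangle with a <= x <= b and c <= y <= d, written
    through primitives [A] along horizontal lines and [B] along vertical ones. The bound -2 in the
    hypotheses is the base point of these primitives, to the left of and below the unit disk. *)
Let mu (a b c d : R) : C :=
  A b c - A a c + ii * (B b d - B b c) - (A b d - A a d) - ii * (B a d - B a c).

(** The affine Taylor polynomial of [g] has the primitive [P], whose differences telescope around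
    the rectangle. Only the remainder counts, at most (e / 4) l on each side; with the factor 2 of
    the mean value inequality the four sides add up to e l^2. *)
Let mu_small (x0 y0 : R) (d0 : C) (e : R) : cder g (Complex x0 y0) d0 -> 0 < e ->
  exists2 dl : R, 0 < dl & forall a b c d : R, - 2 < a -> - 2 < c ->
    a <= x0 <= b -> c <= y0 <= d -> (b - a) + (d - c) < dl ->
    cabs (mu a b c d) <= e * ((b - a) + (d - c)) ^+ 2.
Proof.
move=> /cderP hg e0; have /hg[dl dl0 hd] : 0 < e / 4 by rewrite divr_gt0.
exists dl => // a b c d a2 c2 /andP[ax xb] /andP[cy yd] small.
set l := (b - a) + (d - c) in small *.
set z0 := Complex x0 y0 in hd.
pose P (z : C) := g z0 * z + d0 * (2^-1 * (z - z0) ^+ 2).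
have dP z : cder P z (g z0 + d0 * (z - z0)) by exact: cder_quadratic.
have lin z : cabs (z - z0) <= l -> cabs (g z - (g z0 + d0 * (z - z0))) <= e / 4 * l.
  move=> zl; have := hd (z - z0) (le_lt_trans zl small).
  rewrite (addrC z0) subrK opprD addrA => /le_trans; apply.
  by rewrite ler_pM2l// divr_gt0.
have inl (x y : R) : a <= x <= b -> c <= y <= d -> cabs (Complex x y - z0) <= l.
  move=> /andP[? ?] /andP[? ?]; rewrite (le_trans (cabs_le_ReIm _))// ReB ImB /=.
  by apply: lerD; rewrite ler_norml; apply/andP; split; lra.
have hor (y : R) : c <= y <= d ->
    cabs ((A b y - P (Complex b y)) - (A a y - P (Complex a y))) <= 2 * (e / 4 * l) * (b - a).
  move=> ycd; have ab := le_trans ax xb.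
  apply: (@rder_MVI _ (fun t => A t y - P (Complex t y))
    (fun t => g (Complex t y) - (g z0 + d0 * (Complex t y - z0)))) => // t tab.
    apply: rderB; first by apply: dA; lra.
    have E (s : R) : Complex s y = Complex 0 y + s%:C%C * 1 :> C by rewrite mulr1; simpc.
    rewrite E; have := rder_line (dP (Complex 0 y + t%:C%C * 1)); rewrite mulr1.
    by under [in X in _ -> X]eq_fun do rewrite E.
  by apply: lin; exact: inl.
have ver (x : R) : a <= x <= b ->
    cabs ((ii * B x d - P (Complex x d)) - (ii * B x c - P (Complex x c))) <= 2 * (e / 4 * l) * (d - c).
  move=> xab; have cd := le_trans cy yd.
  apply: (@rder_MVI _ (fun t => ii * B x t - P (Complex x t))
    (fun t => ii * (g (Complex x t) - (g z0 + d0 * (Complex x t - z0))))) => // t tcd.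
    rewrite mulrBr; apply: rderB; first by apply: rderZ; apply: dB; lra.
    have E (s : R) : Complex x s = Complex x 0 + s%:C%C * ii :> C by simpc.
    rewrite E; have := rder_line (dP (Complex x 0 + t%:C%C * ii)); rewrite (mulrC _ ii).
    by under [in X in _ -> X]eq_fun do rewrite E.
  rewrite cabsM cabs_i mul1r.
  by apply: lin; exact: inl.
have cd := le_trans cy yd; have ab := le_trans ax xb.
have cc : c <= c <= d by rewrite lexx. have dd : c <= d <= d by rewrite lexx andbT.
have aa : a <= a <= b by rewrite lexx. have bb : a <= b <= b by rewrite lexx andbT.
have h1 := hor _ cc; have h2 := hor _ dd; have v1 := ver _ aa; have v2 := ver _ bb.
have -> : mu a b c d = ((A b c - P (Complex b c)) - (A a c - P (Complex a c)))
  - ((A b d - P (Complex b d)) - (A a d - P (Complex a d)))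
  + ((ii * B b d - P (Complex b d)) - (ii * B b c - P (Complex b c)))
  - ((ii * B a d - P (Complex a d)) - (ii * B a c - P (Complex a c))).
  exact: mu_telescope.
apply: le_trans (cabsB _ _) _.
apply: le_trans (lerD (cabsD _ _) (lexx _)) _.
apply: le_trans (lerD (lerD (cabsB _ _) (lexx _)) (lexx _)) _.
apply: le_trans (lerD (lerD (lerD h1 h2) v2) v1) _.
by rewrite le_eqVlt /l; apply/orP; left; apply/eqP; field.
Qed.

Let mu_split (a b c d m n : R) : mu a b c d = mu a m c n + mu m b c n + mu a m n d + mu m b n d.
Proof. rewrite /mu; ring. Qed.

Let inr (a b c d : R) (x y : R) := (a <= x <= b) && (c <= y <= d).

Let half_interval (u v u' v' : R) :
  (u', v') = (u, (u + v) / 2) \/ (u', v') = ((u + v) / 2, v) -> u <= v ->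
  [/\ u <= u', v' <= v & v' - u' = (v - u) / 2].
Proof. by move=> [] [-> ->] uv; split; lra. Qed.

(* mu is additive under bisection of rectangles, while mu_small bounds it by o(perimeter^2)
   at a point of differentiability. *)
Lemma goursat_rect (a b c d : R) : - 2 < a -> - 2 < c -> a <= b -> c <= d ->
  (forall x y : R, a <= x <= b -> c <= y <= d -> exists d0, cder g (Complex x y) d0) ->
  mu a b c d = 0.
Proof.
move=> a2 c2 ab cd hg; apply/eqP; apply: contraT => m0.
pose good (q : (R * R) * (R * R)) (n : nat) :=
  [/\ (a <= q.1.1) /\ (q.1.2 <= b), (c <= q.2.1) /\ (q.2.2 <= d),
   q.1.2 - q.1.1 = (b - a) / 2 ^+ n, q.2.2 - q.2.1 = (d - c) / 2 ^+ n &
   cabs (mu a b c d) / 4 ^+ n <= cabs (mu q.1.1 q.1.2 q.2.1 q.2.2)].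
pose sub (q q' : (R * R) * (R * R)) := [/\ q.1.1 <= q'.1.1, q'.1.2 <= q.1.2,
   q.2.1 <= q'.2.1 & q'.2.2 <= q.2.2].
(* The quarter is chosen from [q] alone, before [n], so that the choice is a map that can be
   iterated. *)
have step (q : (R * R) * (R * R)) : exists q', forall n, good q n -> good q' n.+1 /\ sub q q'.
  move: q => [[a1 b1] [c1 d1]].
  set m := (a1 + b1) / 2; set n := (c1 + d1) / 2.
  have ok (a' b' c' d' : R) : (a', b') = (a1, m) \/ (a', b') = (m, b1) ->
      (c', d') = (c1, n) \/ (c', d') = (n, d1) ->
      cabs (mu a1 b1 c1 d1) / 4 <= cabs (mu a' b' c' d') ->
      exists q', forall k, good ((a1, b1), (c1, d1)) k -> good q' k.+1 /\ sub ((a1, b1), (c1, d1)) q'.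
    move=> /half_interval hx /half_interval hy h.
    exists ((a', b'), (c', d')) => k [/= [h1 h2] [h3 h4] h5 h6 h7].
    have [|x1 x2 x3] := hx; first by rewrite -subr_ge0 h5 divr_ge0 ?subr_ge0// exprn_ge0.
    have [|y1 y2 y3] := hy; first by rewrite -subr_ge0 h6 divr_ge0 ?subr_ge0// exprn_ge0.
    split=> //; rewrite /good /= x3 y3 h5 h6 !exprSr !invfM !mulrA; split=> //.
    - by split; [exact: le_trans h1 x1|exact: le_trans x2 h2].
    - by split; [exact: le_trans h3 y1|exact: le_trans y2 h4].
    - by apply: le_trans h; rewrite ler_pM2r ?invr_gt0.
  have [/ok|h1] := leP (cabs (mu a1 b1 c1 d1) / 4) (cabs (mu a1 m c1 n)); first by apply; left.
  have [/ok|h2] := leP (cabs (mu a1 b1 c1 d1) / 4) (cabs (mu m b1 c1 n)).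
    by apply; [right|left].
  have [/ok|h3] := leP (cabs (mu a1 b1 c1 d1) / 4) (cabs (mu a1 m n d1)).
    by apply; [left|right].
  apply: (ok m b1 n d1); [by right|by right|].
  have tri : cabs (mu a1 b1 c1 d1) <= cabs (mu a1 m c1 n) + cabs (mu m b1 c1 n)
     + cabs (mu a1 m n d1) + cabs (mu m b1 n d1).
    rewrite (mu_split a1 b1 c1 d1 m n).
    apply: le_trans (cabsD _ _) _; rewrite lerD2r.
    apply: le_trans (cabsD _ _) _; rewrite lerD2r; exact: cabsD.
  by lra.
pose nxt q := projT1 (cid (step q)).
have hnxt q n : good q n -> good (nxt q) n.+1 /\ sub q (nxt q).
  by rewrite /nxt; case: cid => q' /= h /h.
pose Q n := iter n nxt ((a, b), (c, d)).
have gQ n : good (Q n) n.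
  elim: n => [|n IH]; last by have [] := hnxt _ _ IH.
  by rewrite /good /= !expr0 !divr1; split=> //; split.
have sQ n : sub (Q n) (Q n.+1) by have [] := hnxt _ _ (gQ n).
have sQQ n m : sub (Q n) (Q (n + m)%N).
  elim: m => [|m [h1 h2 h3 h4]]; first by rewrite addn0; split; exact: lexx.
  have [k1 k2 k3 k4] := sQ (n + m)%N; rewrite addnS; split.
  - exact: le_trans h1 k1.
  - exact: le_trans k2 h2.
  - exact: le_trans h3 k3.
  - exact: le_trans k4 h4.
have nonneg n : (Q n).1.1 <= (Q n).1.2 /\ (Q n).2.1 <= (Q n).2.2.
  have [_ _ h1 h2 _] := gQ n; split; rewrite -subr_ge0 ?h1 ?h2;
  by rewrite divr_ge0 ?subr_ge0// exprn_ge0.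
have cross n m : (Q n).1.1 <= (Q m).1.2 /\ (Q n).2.1 <= (Q m).2.2.
  have [h1 h2 h3 h4] := sQQ n m; have [k1 k2 k3 k4] := sQQ m n.
  have [p1 p2] := nonneg (n + m)%N; rewrite addnC in k1 k2 k3 k4; lra.
pose x0 := sup (range (fun n => (Q n).1.1)); pose y0 := sup (range (fun n => (Q n).2.1)).
have x0P n : (Q n).1.1 <= x0 <= (Q n).1.2.
  apply/andP; split.
    apply: ub_le_sup; last by exists n.
    by exists b => _ [m _ <-]; have [] := cross m 0%N.
  apply: ge_sup; first by exists (Q 0%N).1.1, 0%N.
  by move=> _ [m _ <-]; have [] := cross m n.
have y0P n : (Q n).2.1 <= y0 <= (Q n).2.2.
  apply/andP; split.
    apply: ub_le_sup; last by exists n.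
    by exists d => _ [m _ <-]; have [] := cross m 0%N.
  apply: ge_sup; first by exists (Q 0%N).2.1, 0%N.
  by move=> _ [m _ <-]; have [] := cross m n.
have [d0 hd0] := hg _ _ (x0P 0%N) (y0P 0%N).
set l := (b - a) + (d - c).
have l0 : 0 <= l by rewrite addr_ge0// subr_ge0.
have M0 : 0 < cabs (mu a b c d) by rewrite cabs_gt0.
(* With this tolerance [mu_small] bounds the n-th contour integral by half of |mu| / 4^n, against
   the invariant [good]; the 1 added to l^2 covers a degenerate rectangle. *)
have e0 : 0 < cabs (mu a b c d) / 2 / (l ^+ 2 + 1).
  by rewrite !divr_gt0// ltr_wpDl// sqr_ge0.
have [dl dl0 hdl] := mu_small hd0 e0.
have [n hn] : exists n, l / 2 ^+ n < dl.
  exists (Num.bound (l / dl)).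
  rewrite ltr_pdivrMr ?exprn_gt0// mulrC -ltr_pdivrMr//.
  have := archi_boundP (divr_ge0 l0 (ltW dl0)); set k := Num.bound _.
  move=> /lt_trans; apply; rewrite -natrX ltr_nat; exact: ltn_expl.
have [[ga _] [gc _] g3 g4 g5] := gQ n.
have el : (Q n).1.2 - (Q n).1.1 + ((Q n).2.2 - (Q n).2.1) = l / 2 ^+ n.
  by rewrite g3 g4 -mulrDl.
have := hdl _ _ _ _ (lt_le_trans a2 ga) (lt_le_trans c2 gc) (x0P n) (y0P n).
rewrite el => /(_ hn) hm; have := le_trans g5 hm.
have -> : (4 : R) ^+ n = 2 ^+ n ^+ 2 by rewrite -exprM mulnC exprM; congr (_ ^+ _); ring.
have t0 : 0 < ((2 : R) ^+ n ^+ 2)^-1 by rewrite invr_gt0 !exprn_gt0.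
rewrite expr_div_n mulrA ler_pM2r//.
have : cabs (mu a b c d) / 2 / (l ^+ 2 + 1) * l ^+ 2 <= cabs (mu a b c d) / 2.
  rewrite -mulrA ler_piMr ?divr_ge0 ?cabs_ge0// mulrC ler_pdivrMr ?mul1r ?lerDl//.
  by rewrite ltr_wpDl// sqr_ge0.
by move: M0; lra.
Qed.
End Rectangle.
End Goursat.

Section Primitive.
Variable R : realType.
Local Notation C := (complex R).
Local Notation leb := (@lebesgue_measure R).
Local Notation ii := (Complex 0 1 : C).
Implicit Types (f F : C -> C).

(** Radial retraction onto the closed disk of radius r. It extends a function on the disk to a
    continuous one on the plane, so that real integrals may start at -2 along any horizontal or
    vertical line. *)
Let clamp (r : R) (z : C) : C := z * (r%:C)%C / ((Num.max r (cabs z))%:C)%C.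

Let clamp_id (r : R) z : 0 < r -> cabs z <= r -> clamp r z = z.
Proof.
move=> r0 zr; rewrite /clamp (max_l zr) mulfK//.
by apply/negP => /eqP[] /eqP; rewrite gt_eqF.
Qed.
Let clamp_le (r : R) z : 0 < r -> cabs (clamp r z) <= r.
Proof.
move=> r0; have m0 : 0 < Num.max r (cabs z) by rewrite lt_max r0.
rewrite /clamp cabsM cabsV cabsM !cabs_real (ger0_norm (ltW r0)) (ger0_norm (ltW m0)).
by rewrite ler_pdivrMr// mulrC ler_pM2l// le_max lexx orbT.
Qed.
Let clamp_ccont (r : R) z : 0 < r -> ccont (clamp r) z.
Proof.
move=> r0; have m0 : 0 < Num.max r (cabs z) by rewrite lt_max r0.
apply: ccontM; first by apply: ccontM; [exact: ccont_id|exact: ccont_cst].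
apply: ccontV; first by apply/negP => /eqP[] /eqP; rewrite gt_eqF.
apply/ccontP => e e0; exists e => // w we; rewrite -rmorphB cabs_real.
apply: le_lt_trans we; apply: le_trans (cabs_dist w z); rewrite ler_norml.
by have := ler_norm (cabs w - cabs z); have := ler_norm (- (cabs w - cabs z));
 rewrite normrN; rewrite /Num.max; case: ifPn; case: ifPn; rewrite -?leNgt; lra.
Qed.

Let ccont_line f (z v : C) : (forall z, ccont f z) -> cabs v = 1 ->
  continuous (fun s : R => complex.Re (f (z + s%:C%C * v))) /\
  continuous (fun s : R => complex.Im (f (z + s%:C%C * v))).
Proof.
move=> fc v1.
have key (t e : R) : 0 < e -> \forall s \near t,
    cabs (f (z + s%:C%C * v) - f (z + t%:C%C * v)) < e.
  move: (fc (z + t%:C%C * v)) => /ccontP h /h[d d0 hd]; exists d => // s; rewrite /= distrC => st.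
  apply: hd; rewrite opprD addrACA subrr add0r -mulrBl -rmorphB cabsM v1 mulr1.
  by rewrite cabs_real.
split=> t; apply/cvgrPdist_lt => e /(key t); apply: filterS => s; rewrite distrC; apply: le_lt_trans.
  by rewrite -ReB cabs_Re.
by rewrite -ImB cabs_Im.
Qed.

Let antiderivative f (z v : C) : (forall z, ccont f z) -> cabs v = 1 ->
  exists A : R -> C, forall x : R, - 2 < x -> rder A x (f (z + x%:C%C * v)).
Proof.
move=> fc v1; have [c1 c2] := ccont_line z fc v1.
exists (fun x => Complex (\int[leb]_(t in `[(-2), x]) complex.Re (f (z + t%:C%C * v)))
                         (\int[leb]_(t in `[(-2), x]) complex.Im (f (z + t%:C%C * v)))).
move=> x x2; split; first exact: (is_derive_integral c1 x2).
exact: (is_derive_integral c2 x2).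
Qed.

Let gt_neg2 (u h s : R) : `|u| < 1 -> `|h| < 1 ->
  Num.min u (u + h) <= s <= Num.max u (u + h) -> - 2 < s.
Proof.
by rewrite !ltr_norml /Num.min /Num.max; case: ifPn; rewrite -?leNgt; lra.
Qed.

Let primitive_disk f (r : R) : 0 < r <= 1 ->
  (forall z, cabs z <= r -> ccont f z) ->
  (forall z, cabs z < r -> exists d, cder f z d) ->
  exists F, forall z, cabs z < r -> cder F z (f z).
Proof.
move=> /andP[r0 r1] fc fd.
pose g z := f (clamp r z).
have gc z : ccont g z.
  apply: ccont_comp; last exact: clamp_ccont.
  by apply: fc; exact: clamp_le.
have gf z : cabs z <= r -> g z = f z by move=> zr; rewrite /g clamp_id.
have gd z : cabs z < r -> exists d, cder g z d.
  move=> zr; have [d hd] := fd _ zr; exists d; apply: cder_ext hd.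
  exists (r - cabs z); first by rewrite subr_gt0.
  move=> w wz; rewrite gf// -(subrK z w) (le_trans (cabsD _ _))//; lra.
have cabs_i : cabs ii = 1 by rewrite /cabs /= expr0n expr1n add0r sqrtr1.
have c1 : cabs (1 : C) = 1 by exact: cabs1.
pose A x y := projT1 (cid (antiderivative (Complex 0 y) gc c1)) x.
pose B x y := projT1 (cid (antiderivative (Complex x 0) gc cabs_i)) y.
have dA (x y : R) : - 2 < x -> rder (fun t => A t y) x (g (Complex x y)).
  move=> x2; rewrite /A; case: cid => a /= /(_ _ x2).
  by rewrite mulr1; simpc.
have dB (x y : R) : - 2 < y -> rder (fun t => B x t) y (g (Complex x y)).
  move=> y2; rewrite /B; case: cid => a /= /(_ _ y2).
  by simpc.
clearbody A B.
have rect (a b c d : R) :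
    (forall x y : R, Num.min a b <= x <= Num.max a b -> Num.min c d <= y <= Num.max c d ->
       cabs (Complex x y) < r) ->
    A b c - A a c + ii * (B b d - B b c) - (A b d - A a d) - ii * (B a d - B a c) = 0.
  have key (a' b' c' d' : R) : a' <= b' -> c' <= d' ->
      (forall x y : R, a' <= x <= b' -> c' <= y <= d' -> cabs (Complex x y) < r) ->
    A b' c' - A a' c' + ii * (B b' d' - B b' c') - (A b' d' - A a' d') - ii * (B a' d' - B a' c') = 0.
    move=> ab cd inr.
    have corner : cabs (Complex a' c') < 1 by apply: lt_le_trans r1; apply: inr; rewrite lexx.
    have := le_lt_trans (cabs_Re _) corner; have := le_lt_trans (cabs_Im _) corner.
    rewrite /= !ltr_norml => /andP[? _] /andP[? _].
    apply: (goursat_rect dA dB) => //; try lra.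
    by move=> x y xab ycd; apply: gd; exact: inr.
  have [ab|/ltW ba] := leP a b; have [cd|/ltW dc] := leP c d => h.
  - exact: key.
  - by have := key a b d c ab dc h; move=> /eqP; rewrite -oppr_eq0 => /eqP <-; ring.
  - by have := key b a c d ba cd h; move=> /eqP; rewrite -oppr_eq0 => /eqP <-; ring.
  - by have := key b a d c ba dc h; move=> /eqP; move=> /eqP <-; ring.
(* The integral of [g] from 0 to Re z along the real axis, then vertically to z. *)
pose F (z : C) := (A (complex.Re z) 0 - A 0 0)
  + ii * (B (complex.Re z) (complex.Im z) - B (complex.Re z) 0).
exists F => -[x1 y1] z1r; rewrite -(gf _ (ltW z1r)).
apply/cderP => e e0.
have e4 : 0 < e / 4 by rewrite divr_gt0.
have /ccontP /(_ _ e4)[d d0 hd] := gc (Complex x1 y1).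
exists (Num.min (d / 2) ((r - cabs (Complex x1 y1)))).
  by rewrite lt_min divr_gt0//= subr_gt0.
move=> [hx hy]; rewrite lt_min => /andP[hd2 hr].
set x := x1 + hx; set y := y1 + hy.
have -> : Complex x1 y1 + Complex hx hy = Complex x y by simpc.
have hxs : `|hx| <= cabs (Complex hx hy) by exact: (cabs_Re (Complex hx hy)).
have hys : `|hy| <= cabs (Complex hx hy) by exact: (cabs_Im (Complex hx hy)).
have btw (u v t : R) : Num.min u v <= t <= Num.max u v -> `|t - u| <= `|v - u|.
  have := ler_norm (v - u); have := ler_norm (- (v - u)); rewrite normrN => ? ?.
  by rewrite ler_norml /Num.min /Num.max; case: ifPn; rewrite -?leNgt; lra.
have btw0 (t v : R) : Num.min 0 v <= t <= Num.max 0 v -> `|t| <= `|v|.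
  by move=> /btw; rewrite !subr0.
have in1 (s : R) : Num.min x1 x <= s <= Num.max x1 x -> cabs (Complex s y1) < r.
  move=> /btw; rewrite /x (addrC x1) addrK => hs.
  rewrite (_ : Complex s y1 = Complex x1 y1 + (s - x1)%:C%C).
    rewrite (le_lt_trans (cabsD _ _))// cabs_real -ltrBrDl.
    by apply: le_lt_trans hr; exact: le_trans hxs.
  by simpc; congr Complex; ring.
have cabs_le (s t t' : R) : `|t| <= `|t'| -> cabs (Complex s t) <= cabs (Complex s t').
  move=> tt; rewrite -(@ler_pXn2r _ 2) ?nnegrE ?cabs_ge0// -!sqn_cabs /sqn /= lerD2l.
  by rewrite -(real_normK (num_real t)) -(real_normK (num_real t')) lerXn2r ?nnegrE.
(* The rectangle over [x1, x] between the real axis and height y1 stays in the disk, since lowering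
   |Im| lowers the modulus. By Goursat the path to the new point can be rerouted through the old
   one. *)
have rec := rect x1 x 0 y1 (fun s t hs ht => le_lt_trans (cabs_le s t y1 (btw0 _ _ ht)) (in1 s hs)).
have -> : F (Complex x y) - F (Complex x1 y1) = (A x y1 - A x1 y1) + ii * (B x y - B x y1).
  by rewrite -[RHS]add0r -rec /F /=; ring.
have near_z1 (s t : R) : `|s - x1| <= `|hx| -> `|t - y1| <= `|hy| ->
   cabs (g (Complex s t) - g (Complex x1 y1)) <= e / 4.
  move=> hs ht; apply/ltW/hd; apply: le_lt_trans (cabs_le_ReIm _) _; rewrite ReB ImB /=.
  rewrite (_ : d = d / 2 + d / 2); last by field.
  apply: ltrD; [apply: le_lt_trans hs _|apply: le_lt_trans ht _].
    exact: le_lt_trans hxs hd2.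
  exact: le_lt_trans hys hd2.
have g1 := cabs_Re (Complex x1 y1); have g2 := cabs_Im (Complex x1 y1).
have x1r : `|x1| < 1 by exact: le_lt_trans g1 (lt_le_trans z1r r1).
have y1r : `|y1| < 1 by exact: le_lt_trans g2 (lt_le_trans z1r r1).
have h1' : cabs (Complex hx hy) < 1.
  by apply: lt_le_trans hr _; have := cabs_ge0 (Complex x1 y1); lra.
have hx1 := le_lt_trans hxs h1'; have hy1 := le_lt_trans hys h1'.
have := @rder_MVI_abs R (fun s => A s y1 - g (Complex x1 y1) * s%:C%C)
  (fun s => g (Complex s y1) - g (Complex x1 y1)) x1 x (e / 4).
have rid (t : R) : rder (fun s : R => s%:C%C) t (1 : C).
  by have := rder_line (cder_id (0 + t%:C%C * 1 : C)); rewrite mulr1;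
   under eq_fun do rewrite add0r mulr1.
move=> H; have {}H : cabs (A x y1 - g (Complex x1 y1) * x%:C%C -
    (A x1 y1 - g (Complex x1 y1) * x1%:C%C)) <= 2 * (e / 4) * `|x - x1|.
  apply: H => s hs.
    apply: rderB; first by apply: dA; exact: gt_neg2 hs.
    by apply: rder_eq (rderZ _ (rid s)) _; rewrite mulr1.
  apply: near_z1; last by rewrite subrr normr0.
  by have := btw _ _ _ hs; rewrite /x (addrC x1) addrK.
have V : cabs (ii * B x y - ii * (g (Complex x1 y1) * y%:C%C) -
    (ii * B x y1 - ii * (g (Complex x1 y1) * y1%:C%C))) <= 2 * (e / 4) * `|y - y1|.
  apply: (@rder_MVI_abs R (fun s => ii * B x s - ii * (g (Complex x1 y1) * s%:C%C))
    (fun s => ii * (g (Complex x s) - g (Complex x1 y1)))) => s hs.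
    rewrite mulrBr; apply: rderB; first by apply: rderZ; apply: dB; exact: gt_neg2 hs.
    by apply: rderZ; apply: rder_eq (rderZ _ (rid s)) _; rewrite mulr1.
  rewrite cabsM cabs_i mul1r; apply: near_z1; first by rewrite /x (addrC x1) addrK.
  by have := btw _ _ _ hs; rewrite /y (addrC y1) addrK.
have xx : x - x1 = hx by rewrite /x (addrC x1) addrK.
have yy : y - y1 = hy by rewrite /y (addrC y1) addrK.
have ch : Complex hx hy = x%:C%C - x1%:C%C + ii * (y%:C%C - y1%:C%C).
  by rewrite -!rmorphB /= xx yy; simpc.
rewrite [X in g _ * X]ch.
have -> : A x y1 - A x1 y1 + ii * (B x y - B x y1) - g (Complex x1 y1) * (x%:C%C - x1%:C%C + ii * (y%:C%C - y1%:C%C))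
  = (A x y1 - g (Complex x1 y1) * x%:C%C - (A x1 y1 - g (Complex x1 y1) * x1%:C%C))
  + (ii * B x y - ii * (g (Complex x1 y1) * y%:C%C) -
    (ii * B x y1 - ii * (g (Complex x1 y1) * y1%:C%C))) by ring.
apply: le_trans (cabsD _ _) _; apply: le_trans (lerD H V) _.
rewrite xx yy -mulrDr.
have -> : e * cabs (Complex hx hy) = 2 * (e / 4) * (cabs (Complex hx hy) + cabs (Complex hx hy)) by field.
by rewrite ler_pM2l ?mulr_gt0//; exact: lerD.
Qed.

Definition holo f := forall z, cabs z < 1 -> exists d, cder f z d.

Let zero_der (F : C -> C) (r : R) z : (forall z, cabs z < r -> cder F z 0) -> cabs z < r -> F z = F 0.
Proof.
move=> dF zr; apply/eqP; rewrite -subr_eq0; apply/eqP/eps_half => e e0.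
have inr (t : R) : 0 <= t <= 1 -> cabs (0 + t%:C%C * (z - 0)) < r.
  move=> /andP[t0 t1]; rewrite add0r subr0 cabsM cabs_real ger0_norm//.
  by apply: le_lt_trans zr; rewrite ler_piMl// cabs_ge0.
have := @cder_MVI R F (fun=> 0) 0 z 0; rewrite mulr0 mul0r => h.
apply: le_trans (ltW e0); apply: h => t /inr; first exact: dF.
by rewrite cabs0.
Qed.

(** [primitive_disk] needs continuity up to the circle, so it is applied on each radius r < 1.
    Primitives normalised at 0 agree on common disks; the glued function uses the radius (1 + |z|) /
    2 at z. *)
Lemma holo_primitive f : holo f -> exists F, F 0 = 0 /\ forall z, cabs z < 1 -> cder F z (f z).
Proof.
move=> hf.
have fc z : cabs z < 1 -> ccont f z by move=> /hf[d /cder_ccont].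
have ex (r : R) : exists F, 0 < r < 1 -> F 0 = 0 /\ forall z, cabs z < r -> cder F z (f z).
  have [r01|] := boolP (0 < r < 1); last by exists f.
  have /andP[r0 r1] := r01.
  have [|||F hF] := @primitive_disk f r.
  - by rewrite r0 ltW.
  - by move=> z zr; apply: fc; exact: le_lt_trans r1.
  - by move=> z zr; apply: hf; exact: lt_trans r1.
  exists (fun z => F z - F 0) => _; split; first by rewrite subrr.
  move=> z /hF h; apply: cder_eq (cderB h (cder_cst (F 0) z)) _; exact: subr0.
pose P r := projT1 (cid (ex r)).
have hP r : 0 < r < 1 -> P r 0 = 0 /\ forall z, cabs z < r -> cder (P r) z (f z).
  by rewrite /P; case: cid.
have agree r s z : 0 < r < 1 -> 0 < s < 1 -> cabs z < r -> cabs z < s -> P r z = P s z.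
  move=> /hP[r0 hr] /hP[s0 hs] zr zs.
  have : P r z - P s z = P r 0 - P s 0.
    apply: (@zero_der (fun z => P r z - P s z) (Num.min r s)); last by rewrite lt_min zr.
    move=> w; rewrite lt_min => /andP[/hr h1 /hs h2].
    by apply: cder_eq (cderB h1 h2) _; exact: subrr.
  by rewrite r0 s0 subrr => /eqP; rewrite subr_eq0 => /eqP.
exists (fun z => P ((1 + cabs z) / 2) z); split.
  have h2 : 0 < (1 + cabs (0 : C)) / 2 < 1 by rewrite cabs0; lra.
  by have [] := hP _ h2.
move=> z z1; have z0 := cabs_ge0 z.
have r01 : 0 < (1 + (1 + cabs z) / 2) / 2 < 1 by lra.
have [_ hr] := hP _ r01.
have zr : cabs z < (1 + (1 + cabs z) / 2) / 2 by lra.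
apply: cder_ext (hr _ zr).
exists ((1 - cabs z) / 2); first by lra.
move=> w wz; have w0 := cabs_ge0 w.
have wz' : cabs w < cabs z + (1 - cabs z) / 2.
  by rewrite -(subrK z w) (le_lt_trans (cabsD _ _))//; lra.
apply: agree; lra.
Qed.
End Primitive.

(** * Bergman's reproducing formula *)

Section Bergman_kernel.
Variable R : realType.
Local Notation C := (complex R).
Implicit Types (f g F : C -> C).

Lemma cabs_convex (z w : C) (r t : R) : cabs z <= r -> cabs w <= r -> 0 <= t <= 1 ->
  cabs (z + t%:C%C * (w - z)) <= r.
Proof.
move=> zr wr /andP[t0 t1].
have -> : z + t%:C%C * (w - z) = (1 - t)%:C%C * z + t%:C%C * w by rewrite rmorphB rmorph1; ring.
apply: le_trans (cabsD _ _) _; rewrite !cabsM !cabs_real !ger0_norm ?subr_ge0//.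
have -> : r = (1 - t) * r + t * r by ring.
by apply: lerD; apply: ler_wpM2l; rewrite ?subr_ge0.
Qed.

(** The mean value inequality is used twice, for [f] and for [F] minus a linear term, each time with
    its factor 2. *)
Lemma cder_taylor1 F f g (r M : R) (z w : C) :
  (forall z, cabs z <= r -> cder F z (f z)) -> (forall z, cabs z <= r -> cder f z (g z)) ->
  (forall z, cabs z <= r -> cabs (g z) <= M) -> cabs z <= r -> cabs w <= r ->
  cabs (F w - F z - f z * (w - z)) <= 4 * M * cabs (w - z) ^+ 2.
Proof.
move=> dF df gM zr wr.
have df' (u : C) : cabs u <= r -> cabs (f u - f z) <= 2 * M * cabs (u - z).
  move=> ur; apply: (cder_MVI (df := g)) => t t01; first by apply: df; exact: cabs_convex.
  by apply: gM; exact: cabs_convex.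
have := @cder_MVI R (fun u => F u - f z * u) (fun u => f u - f z) z w (2 * M * cabs (w - z)).
have -> : F w - f z * w - (F z - f z * z) = F w - F z - f z * (w - z) by ring.
have -> : 2 * (2 * M * cabs (w - z)) * cabs (w - z) = 4 * M * cabs (w - z) ^+ 2 by ring.
apply => t t01.
  apply: cderB; first by apply: dF; exact: cabs_convex.
  by apply: cder_eq (cderZ _ (cder_id _)) _; rewrite mulr1.
apply: le_trans (df' _ (cabs_convex zr wr t01)) _.
have M0 : 0 <= M by apply: le_trans (gM _ zr); exact: cabs_ge0.
rewrite (addrC z) addrK cabsM cabs_real; case/andP: t01 => t0 t1.
by rewrite ger0_norm// ler_wpM2l ?mulr_ge0// ler_piMl// cabs_ge0.
Qed.

(** Cutting [0, 1] into N equal steps gives |m 1 - m 0| <= N c / N^2. *)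
Let quadratic_const (m : R -> C) (c : R) : (forall s t, 0 <= s <= 1 -> 0 <= t <= 1 ->
  cabs (m s - m t) <= c * (s - t) ^+ 2) -> m 1 = m 0.
Proof.
move=> h; apply/eqP; rewrite -subr_eq0; apply/eqP/eps_half => e e0.
have c0 : 0 <= c.
  have := h 1 0; rewrite subr0 expr1n mulr1 !lexx ler01 => /(_ isT isT).
  by apply: le_trans; exact: cabs_ge0.
pose N := (Num.bound (c / e)).+1.
have N0 : 0 < N%:R :> R by rewrite ltr0n.
have cN : c / N%:R <= e.
  rewrite ler_pdivrMr// mulrC -ler_pdivrMr//.
  apply: ltW; apply: lt_trans (archi_boundP (divr_ge0 c0 (ltW e0))) _.
  by rewrite ltr_nat.
apply: le_trans cN.
have key n : (n <= N)%N -> cabs (m (n%:R / N%:R) - m 0) <= n%:R * (c / N%:R ^+ 2).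
  elim: n => [|n IH] nN; first by rewrite !mul0r subrr cabs0.
  have inI k : (k <= N)%N -> 0 <= (k%:R / N%:R : R) <= 1.
    by move=> kN; rewrite divr_ge0 ?ler0n//= ler_pdivrMr// mul1r ler_nat.
  rewrite -(subrK (m (n%:R / N%:R)) (m (n.+1%:R / N%:R))) -addrA.
  apply: le_trans (cabsD _ _) _.
  have E : (n.+1%:R / N%:R - n%:R / N%:R : R) = N%:R^-1 by rewrite -natr1; field; rewrite gt_eqF.
  have := h _ _ (inI _ nN) (inI _ (ltnW nN)); rewrite E => h1.
  apply: le_trans (lerD h1 (IH (ltnW nN))) _.
  by rewrite -natr1 mulrDl mul1r addrC exprVn.
have := key N (leqnn _); rewrite divff ?gt_eqF// => /le_trans; apply.
by rewrite le_eqVlt; apply/orP; left; apply/eqP; field; rewrite gt_eqF.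
Qed.

(** The Bergman kernel at w of the disk of radius r is r^4 / [area r] times the power -2 of this
    expression. *)
Definition bker (r : R) (w z : C) : C := (r ^+ 2)%:C%C - Num.conj w * z.

Lemma bker_neq0 (r : R) (w z : C) : cabs w < r -> cabs z <= r -> bker r w z != 0.
Proof.
move=> wr zr; rewrite /bker subr_eq0; apply/eqP => /(congr1 (@cabs R)).
have r0 : 0 < r by apply: le_lt_trans wr; exact: cabs_ge0.
rewrite cabs_real cabsM cabs_conj ger0_norm ?exprn_ge0 ?ltW// => h.
suff : cabs w * cabs z < r ^+ 2 by rewrite -h ltxx.
rewrite expr2; apply: le_lt_trans (ler_wpM2l (cabs_ge0 _) zr) _.
by rewrite ltr_pM2r.
Qed.
Lemma cder_bker (r : R) (w z : C) : cder (bker r w) z (- Num.conj w).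
Proof.
have := cderB (cder_cst (r ^+ 2)%:C%C z) (cderZ (Num.conj w) (cder_id z)).
by rewrite mulr1 sub0r.
Qed.
Lemma ccont_bker (r : R) (w z : C) : ccont (bker r w) z.
Proof. exact: cder_ccont (cder_bker r w z). Qed.

(* By Stokes' formula the integral m(t) of F(w + t (z - w)) against the kernel satisfies
   |m(t) - m(s)| <= c (t - s)^2, so it is constant; compare t = 1 with t = 0. *)
Let bergman_const F f g (r : R) (w : C) : 0 < r -> cabs w < r ->
  (forall z, cabs z <= r -> cder F z (f z)) -> (forall z, cabs z <= r -> cder f z (g z)) ->
  (forall z, cabs z <= r -> ccont g z) ->
  cI (disk r) (fun z => F z * Num.conj (bker r w z ^- 2)) =
  F w * cI (disk r) (fun z => Num.conj (bker r w z ^- 2)).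
Proof.
move=> r0 wr dF df cg.
have mD := @measurable_disk R r.
have cF z : cabs z <= r -> ccont F z by move=> /dF /cder_ccont.
have cf z : cabs z <= r -> ccont f z by move=> /df /cder_ccont.
have [M M0 hM] := ccont_bounded (ltW r0) cg.
pose K z := Num.conj (bker r w z ^- 2).
have cK z : cabs z <= r -> ccont K z.
  move=> zr; apply: ccont_conj; apply: ccontV; first by rewrite expf_neq0// bker_neq0.
  by apply: ccontX; exact: ccont_bker.
have [L L0 hL] := ccont_bounded (ltW r0) cK.
have iK := cint_ccont (ltW r0) cK.
pose l (t : R) (z : C) : C := w + t%:C%C * (z - w).
have lr t z : 0 <= t <= 1 -> cabs z <= r -> cabs (l t z) <= r.
  by move=> t01 zr; apply: cabs_convex => //; exact: ltW.
have dl (t : R) z : cder (l t) z t%:C%C.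
  have := cderD (cder_cst w z) (cderZ t%:C%C (cderB (cder_id z) (cder_cst w z))).
  by rewrite subr0 mulr1 add0r.
have cl (t : R) z : ccont (l t) z by exact: cder_ccont (dl t z).
pose m t := cI (disk r) (fun z => F (l t z) * K z).
have cFl t z : 0 <= t <= 1 -> cabs z <= r -> ccont (fun z => F (l t z)) z.
  move=> t01 zr; apply: (@ccont_comp _ F (l t)) (cl t z); exact: cF (lr _ _ t01 zr).
have cfl t z : 0 <= t <= 1 -> cabs z <= r -> ccont (fun z => f (l t z)) z.
  move=> t01 zr; apply: (@ccont_comp _ f (l t)) (cl t z); exact: cf (lr _ _ t01 zr).
have cgl t z : 0 <= t <= 1 -> cabs z <= r -> ccont (fun z => g (l t z)) z.
  move=> t01 zr; apply: (@ccont_comp _ g (l t)) (cl t z); exact: cg (lr _ _ t01 zr).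
have iF t : 0 <= t <= 1 -> cint (disk r) (fun z => F (l t z) * K z).
  move=> t01; apply: (cint_ccont (ltW r0)) => z zr; exact: ccontM (cFl _ _ t01 zr) (cK _ zr).
have cG t z : 0 <= t <= 1 -> cabs z <= r -> ccont (fun z => f (l t z) * ((z - w) * K z)) z.
  move=> t01 zr; apply: ccontM (cfl _ _ t01 zr) (ccontM _ (cK _ zr)).
  exact: ccontB (@ccont_id R z) (@ccont_cst R w z).
have iG t : 0 <= t <= 1 -> cint (disk r) (fun z => f (l t z) * ((z - w) * K z)).
  by move=> t01; apply: (cint_ccont (ltW r0)) => z zr; exact: cG.
have zero t : 0 <= t <= 1 -> cI (disk r) (fun z => f (l t z) * ((z - w) * K z)) = 0.
  move=> t01.
  (* With this [h], the integrand of [stokes] is r^2 times the wanted one: z (r^2 - w conj(z)) +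
     (|z|^2 - r^2) w = r^2 (z - w). *)
  pose h z := (bker r w z)^-1; pose eta z := Num.conj w * bker r w z ^- 2.
  have dh z : cabs z <= r -> cder h z (eta z).
    move=> zr; apply: cder_eq (cderV (bker_neq0 wr zr) (cder_bker r w z)) _.
    by rewrite opprK.
  have ce z : cabs z <= r -> ccont eta z.
    move=> zr; apply: ccontM; first exact: ccont_cst.
    apply: ccontV; first by rewrite expf_neq0// bker_neq0.
    by apply: ccontX; exact: ccont_bker.
  have dP z : cabs z <= r -> cder (fun z => f (l t z)) z (g (l t z) * t%:C%C).
    by move=> zr; exact: cder_comp (df _ (lr _ _ t01 zr)) (dl t z).
  have cp z : cabs z <= r -> ccont (fun z => g (l t z) * t%:C%C) z.
    by move=> zr; exact: ccontM (cgl _ _ t01 zr) (@ccont_cst R _ z).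
  have := stokes r0 dP dh cp ce.
  have r2 : (r ^+ 2)%:C%C != 0 :> C.
    by apply/negP => /eqP[] /eqP; rewrite expf_eq0/= gt_eqF.
  move=> S; apply: (mulfI r2); rewrite mulr0 -[RHS]S -cIZ//; last exact: iG.
  apply: cI_ext => p /(diskE _ (ltW r0)) /ltW pr.
  have b0 := bker_neq0 wr pr.
  rewrite /h /eta /K; set z := toC p in pr b0 *.
  have bE : Num.conj (bker r w z) = (r ^+ 2)%:C%C - w * Num.conj z.
    by rewrite /bker conjB conjM conjK conjR.
  have bE0 : (r ^+ 2)%:C%C - w * Num.conj z != 0 by rewrite -bE conjC_eq0.
  rewrite conjM !conjV !conjX conjK bE.
  move: (Num.conj z) ((r ^+ 2)%:C%C) bE0 (f (l t z)) => zb r' b' y.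
  by field.
suff : m 1 = m 0.
  rewrite /m => E; transitivity (m 1).
    by apply: cI_ext => p _; rewrite /l mul1r (addrC w) subrK.
  rewrite /m E -cIZ//; apply: cI_ext => p _; rewrite /l.
  by rewrite mul0r addr0.
pose c := 4 * M * (2 * r) ^+ 2 * L.
apply: (@quadratic_const m (2 * c * area r)) => s t s01 t01.
(* The first order term of F(l s z) around l t z integrates to zero by [zero], so it can be
   subtracted and only a second order remainder is left. *)
pose E z := (F (l s z) - F (l t z) - f (l t z) * (l s z - l t z)) * K z.
have cE z : cabs z <= r -> ccont E z.
  move=> zr; exact: (ccontM (ccontB (ccontB (cFl _ _ s01 zr) (cFl _ _ t01 zr))
    (ccontM (cfl _ _ t01 zr) (ccontB (cl s z) (cl t z)))) (cK _ zr)).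
have -> : m s - m t = cI (disk r) E.
  have -> : m s - m t = m s - m t - (s - t)%:C%C * cI (disk r) (fun z => f (l t z) * ((z - w) * K z)).
    by rewrite zero// mulr0 subr0.
  have iG' := cintZ (s - t)%:C%C mD (iG _ t01).
  rewrite /m -cIZ//; last exact: iG.
  rewrite -cIB//; [|exact: iF|exact: iF].
  rewrite -cIB//; last by apply: cintB => //; exact: iF.
  apply: cI_ext => p _; rewrite /E.
  have -> : l s (toC p) - l t (toC p) = (s - t)%:C%C * (toC p - w).
    by rewrite /l rmorphB; ring.
  ring.
have := @cI_bounded R r (c * (s - t) ^+ 2) E (ltW r0).
rewrite (_ : 2 * c * area r * (s - t) ^+ 2 = 2 * (c * (s - t) ^+ 2) * area r); last by ring.
apply; first by move=> z /ltW; exact: cE.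
move=> z /ltW zr; rewrite /E cabsM.
have -> : c * (s - t) ^+ 2 = 4 * M * ((s - t) ^+ 2 * (2 * r) ^+ 2) * L by rewrite /c; ring.
apply: ler_pM; rewrite ?cabs_ge0//; last exact: hL.
apply: le_trans (cder_taylor1 dF df hM (lr _ _ t01 zr) (lr _ _ s01 zr)) _.
rewrite ler_wpM2l ?mulr_ge0//.
have -> : l s z - l t z = (s - t)%:C%C * (z - w) by rewrite /l rmorphB; ring.
rewrite cabsM cabs_real exprMn real_normK ?num_real// ler_wpM2l ?sqr_ge0//.
have r2 : 0 <= 2 * r by rewrite mulr_ge0// ltW.
rewrite ler_sqr ?nnegrE ?cabs_ge0//.
apply: le_trans (cabsB _ _) _; have := ltW wr; lra.
Qed.

(** The case w = 0 of [bergman_const], where the kernel is a constant that cancels. *)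
Lemma mean_value F f g (r : R) : 0 < r ->
  (forall z, cabs z <= r -> cder F z (f z)) -> (forall z, cabs z <= r -> cder f z (g z)) ->
  (forall z, cabs z <= r -> ccont g z) ->
  cI (disk r) F = F 0 * (area r)%:C%C.
Proof.
move=> r0 dF df cg.
have w0 : cabs (0 : C) < r by rewrite cabs0.
have mD := @measurable_disk R r.
have := bergman_const r0 w0 dF df cg.
pose k : C := Num.conj ((r ^+ 2)%:C%C ^- 2).
have k0 : k != 0.
  rewrite conjC_eq0 invr_eq0 expf_eq0 /=; apply/negP => /eqP[] /eqP.
  by rewrite expf_eq0/= gt_eqF.
rewrite (@cI_ext _ _ _ (fun z => k * F z)); last first.
  by move=> p _; rewrite /bker conj0 mul0r subr0 mulrC.
rewrite (@cI_ext _ _ (fun z => Num.conj _) (fun z => k)); last first.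
  by move=> p _; rewrite /bker conj0 mul0r subr0.
rewrite cI_cst cIZ//; last first.
  by apply: (cint_ccont (ltW r0)) => z /dF /cder_ccont.
by rewrite mulrCA => /(mulfI k0).
Qed.

(** [bergman_const] leaves the integral of conj(K) for K the power -2 of [bker]. K is itself
    analytic in z, so the mean value property evaluates this integral to r^-4 [area r]. *)
Lemma bergman_formula F f g (r : R) (w : C) : 0 < r -> cabs w < r ->
  (forall z, cabs z <= r -> cder F z (f z)) -> (forall z, cabs z <= r -> cder f z (g z)) ->
  (forall z, cabs z <= r -> ccont g z) ->
  F w = (r ^+ 4 / area r)%:C%C * cI (disk r) (fun z => F z * Num.conj ((bker r w z)^-1 ^+ 2)).
Proof.
move=> r0 wr dF df cg.
have mD := @measurable_disk R r.
have a0 := area_gt0 r0.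
rewrite (@cI_ext _ _ _ (fun z => F z * Num.conj (bker r w z ^- 2))); last first.
  by move=> p _; rewrite exprVn.
rewrite (bergman_const r0 wr dF df cg).
have d1 z : cabs z <= r -> cder (fun z => bker r w z ^- 2) z
   (2 * Num.conj w * (bker r w z ^- 3)).
  move=> zr; have b0 := bker_neq0 wr zr; have b2 : bker r w z ^+ 2 != 0 by rewrite expf_neq0.
  apply: cder_eq (@cderV _ (fun z => bker r w z ^+ 2) _ _ b2 (cderX 2 (cder_bker r w z))) _ => /=; by field.
have d2 z : cabs z <= r -> cder (fun z => 2 * Num.conj w * (bker r w z ^- 3)) z
   (6 * Num.conj w ^+ 2 * (bker r w z ^- 4)).
  move=> zr; have b0 := bker_neq0 wr zr; have b2 : bker r w z ^+ 3 != 0 by rewrite expf_neq0.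
  apply: cder_eq (cderZ _ (@cderV _ (fun z => bker r w z ^+ 3) _ _ b2 (cderX 3 (cder_bker r w z)))) _ => /=; by field.
have c2 z : cabs z <= r -> ccont (fun z => 6 * Num.conj w ^+ 2 * (bker r w z ^- 4)) z.
  move=> zr; apply: ccontM; first exact: ccont_cst.
  apply: ccontV; first by rewrite expf_neq0// bker_neq0.
  by apply: ccontX; exact: ccont_bker.
rewrite cI_conj//; last first.
  by apply: (cint_ccont (ltW r0)) => z /d1 /cder_ccont.
rewrite (mean_value r0 d1 d2 c2) {1}/bker mulr0 subr0.
rewrite conjM conjV conjX !conjR -rmorphXn -fmorphV -rmorphM mulrCA -rmorphM.
rewrite (_ : r ^+ 4 / area r * _ = 1) ?rmorph1 ?mulr1//.
by field; rewrite !gt_eqF.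
Qed.
End Bergman_kernel.

(** * Derivatives of analytic functions *)

Section Holomorphic.
Variable R : realType.
Local Notation C := (complex R).
Implicit Types (f g F u : C -> C).

Lemma cder_quad f z d (c s : R) : 0 < s ->
  (forall h, cabs h < s -> cabs (f (z + h) - f z - d * h) <= c * cabs h ^+ 2) -> cder f z d.
Proof.
move=> s0 H; apply/cderP => e e0.
have c1 : 0 < `|c| + 1 by rewrite ltr_wpDl.
exists (Num.min s (e / (`|c| + 1))); first by rewrite lt_min s0 divr_gt0.
move=> h; rewrite lt_min => /andP[hs he]; apply: le_trans (H _ hs) _.
rewrite expr2 mulrA ler_wpM2r ?cabs_ge0//.
apply: (@le_trans _ _ ((`|c| + 1) * cabs h)).
  by rewrite ler_wpM2r ?cabs_ge0//; have := ler_norm c; lra.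
by rewrite mulrC -ler_pdivlMr// ltW.
Qed.

(** Differentiation under the integral sign: the conjugated kernel is analytic in w, and its first
    order Taylor remainder is quadratic in h uniformly in z. *)
Lemma cder_cauchy_integral u (r : R) j w : 0 < r -> cabs w < r ->
  (forall z, cabs z <= r -> ccont u z) ->
  cder (fun w => cI (disk r) (fun z => u z * Num.conj ((bker r w z)^-1 ^+ j))) w
    (j%:R * cI (disk r) (fun z => (u z * Num.conj z) * Num.conj ((bker r w z)^-1 ^+ j.+1))).
Proof.
move=> r0 wr cu; have mD := @measurable_disk R r; have r0' := ltW r0.
have cB v n z : cabs v < r -> cabs z <= r -> ccont (fun z => Num.conj ((bker r v z)^-1 ^+ n)) z.
  move=> vr zr; apply: ccont_conj; apply: ccontX.
  by apply: ccontV; [exact: bker_neq0|exact: ccont_bker].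
have i1 v n : cabs v < r -> cint (disk r) (fun z => u z * Num.conj ((bker r v z)^-1 ^+ n)).
  move=> vr; apply: (cint_ccont (ltW r0)) => z zr; exact: ccontM (cu _ zr) (cB _ _ _ vr zr).
have cu' z : cabs z <= r -> ccont (fun z => u z * Num.conj z) z.
  by move=> zr; exact: ccontM (cu _ zr) (ccont_conj (@ccont_id R z)).
have i2 v n : cabs v < r -> cint (disk r) (fun z => (u z * Num.conj z) * Num.conj ((bker r v z)^-1 ^+ n)).
  move=> vr; apply: (cint_ccont (ltW r0)) => z zr; exact: ccontM (cu' _ zr) (cB _ _ _ vr zr).
set rho := (cabs w + r) / 2.
have w0 := cabs_ge0 w.
have wrho : cabs w < rho by rewrite /rho; lra.
have rhor : rho < r by rewrite /rho; lra.
(* For |z| <= r and |v| <= rho one has |r^2 - conj(z) v| >= r^2 - r rho, so [kap] bounds the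
   kernel. *)
pose kap := (r * (r - rho))^-1.
have kap0 : 0 < kap by rewrite invr_gt0 mulr_gt0// subr_gt0.
pose x z v : C := (Num.conj (bker r v z))^-1.
have bE z v : Num.conj (bker r v z) = (r ^+ 2)%:C%C - Num.conj z * v.
  by rewrite /bker conjB conjM conjK conjR mulrC.
have nz z v : cabs z <= r -> cabs v <= rho -> Num.conj (bker r v z) != 0.
  move=> zr vr; rewrite conjC_eq0; apply: bker_neq0 => //; exact: le_lt_trans rhor.
have xb z v : cabs z <= r -> cabs v <= rho -> cabs (x z v) <= kap.
  move=> zr vr; rewrite /x cabsV lef_pV2 ?posrE ?cabs_gt0 ?nz ?mulr_gt0 ?subr_gt0//.
  rewrite bE; have := cabsB ((r ^+ 2)%:C%C - Num.conj z * v) (- (Num.conj z * v)).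
  rewrite opprK subrK cabs_real cabsN cabsM cabs_conj ger0_norm ?exprn_ge0// => h.
  have : cabs z * cabs v <= r * rho by apply: ler_pM; rewrite ?cabs_ge0.
  by move: h; rewrite expr2; lra.
have dx z v : cabs z <= r -> cabs v <= rho -> cder (x z) v (Num.conj z * x z v ^+ 2).
  move=> zr vr; have h := nz _ _ zr vr.
  have E : (fun v => Num.conj (bker r v z)) = (fun v => (r ^+ 2)%:C%C - Num.conj z * v).
    by apply/funext => v'; exact: bE.
  have d1 : cder (fun v => Num.conj (bker r v z)) v (- Num.conj z).
    rewrite E; apply: cder_eq (cderB (cder_cst _ v) (cderZ (Num.conj z) (cder_id v))) _.
    by rewrite mulr1 sub0r.
  apply: cder_eq (@cderV _ (fun v => Num.conj (bker r v z)) _ _ h d1) _.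
  by rewrite opprK /x exprVn.
have dxn z n v : cabs z <= r -> cabs v <= rho ->
    cder (fun v => x z v ^+ n) v (n%:R * Num.conj z * x z v ^+ n.+1).
  move=> zr vr; apply: cder_eq (cderX n (dx _ _ zr vr)) _.
  case: n => [|n]; first by rewrite !mul0r.
  by rewrite /= !exprS; ring.
have [U U0 hU] := ccont_bounded (ltW r0) cu.
(* A bound for the second derivative in v of the j-th power of the kernel. *)
pose M := (j * j.+1)%:R * r ^+ 2 * kap ^+ j.+2.
have tay z h : cabs z <= r -> cabs (w + h) <= rho ->
    cabs (x z (w + h) ^+ j - x z w ^+ j - (j%:R * Num.conj z * x z w ^+ j.+1) * h) <= 4 * M * cabs h ^+ 2.
  move=> zr whr.
  have := @cder_taylor1 R (fun v => x z v ^+ j) (fun v => j%:R * Num.conj z * x z v ^+ j.+1)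
    (fun v => j%:R * Num.conj z * (j.+1%:R * Num.conj z * x z v ^+ j.+2)) rho M w (w + h).
  rewrite (addrC w) addrK addrC; apply => //; last exact: ltW.
  - by move=> v vr; exact: dxn.
  - by move=> v vr; exact: cderZ (dxn _ _ _ zr vr).
  move=> v vr; have yE := cabsX (x z v) j.+2; move: (x z v ^+ j.+2) yE => y yE.
  rewrite !cabsM !cabs_conj yE !cabs_nat /M natrM {y yE}.
  have -> : j%:R * cabs z * (j.+1%:R * cabs z * cabs (x z v) ^+ j.+2) =
     (j%:R * j.+1%:R) * cabs z ^+ 2 * cabs (x z v) ^+ j.+2 by ring.
  have xk : cabs (x z v) ^+ j.+2 <= kap ^+ j.+2.
    by rewrite lerXn2r ?nnegrE ?cabs_ge0 ?xb// ltW.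
  have zk : cabs z ^+ 2 <= r ^+ 2 by rewrite lerXn2r ?nnegrE ?cabs_ge0// ltW.
  have A0 : 0 <= j%:R * j.+1%:R :> R by rewrite mulr_ge0.
  apply: ler_pM _ _ _ xk; [|exact: exprn_ge0 (cabs_ge0 _)|exact: ler_wpM2l].
  exact: mulr_ge0 A0 (exprn_ge0 _ (cabs_ge0 _)).
apply: (@cder_quad _ _ _ (2 * (U * (4 * M)) * area r) (rho - cabs w)); first by rewrite subr_gt0.
move=> h hh.
have whr : cabs (w + h) <= rho.
  by apply: le_trans (cabsD _ _) _; lra.
have whr' := le_lt_trans whr rhor.
have xE v n z : Num.conj ((bker r v z)^-1 ^+ n) = x z v ^+ n by rewrite conjX conjV.
set G := (fun z => u z * (Num.conj ((bker r (w + h) z)^-1 ^+ j) - Num.conj ((bker r w z)^-1 ^+ j)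
   - (j%:R * h) * (Num.conj z * Num.conj ((bker r w z)^-1 ^+ j.+1)))).
have cG z : cabs z <= r -> ccont G z.
  move=> zr; exact: (ccontM (cu _ zr) (ccontB (ccontB (cB _ j _ whr' zr) (cB _ j _ wr zr))
    (ccontM (@ccont_cst R (j%:R * h) z) (ccontM (ccont_conj (@ccont_id R z)) (cB _ j.+1 _ wr zr))))).
have -> : cI (disk r) (fun z => u z * Num.conj ((bker r (w + h) z)^-1 ^+ j)) -
   cI (disk r) (fun z => u z * Num.conj ((bker r w z)^-1 ^+ j)) -
   j%:R * cI (disk r) (fun z => u z * Num.conj z * Num.conj ((bker r w z)^-1 ^+ j.+1)) * h = cI (disk r) G.
  have i1' := i1 _ j whr'; have i1'' := i1 _ j wr; have i2' := i2 _ j.+1 wr.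
  rewrite mulrAC -cIZ// -cIB// -cIB//; [|exact: cintB|exact: cintZ].
  by apply: cI_ext => p _; rewrite /G; ring.
have := @cI_bounded R r (U * (4 * M) * cabs h ^+ 2) G (ltW r0).
have -> : 2 * (U * (4 * M) * cabs h ^+ 2) * area r = 2 * (U * (4 * M)) * area r * cabs h ^+ 2 by ring.
apply; first by move=> z /ltW; exact: cG.
move=> z /ltW zr; rewrite /G cabsM.
have -> : U * (4 * M) * cabs h ^+ 2 = U * (4 * M * cabs h ^+ 2) by ring.
apply: (ler_pM (cabs_ge0 _) (cabs_ge0 _) (hU _ zr)).
rewrite !xE (_ : j%:R * h * _ = (j%:R * Num.conj z * x z w ^+ j.+1) * h); last by ring.
exact: tay.
Qed.

Definition cd f z : C := 'D_(1 : C^o) (f : C^o -> C^o) z.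

Lemma cd_eq f z d : cder f z d -> cd f z = d.
Proof. by case. Qed.
Lemma holo_cd f z : holo f -> cabs z < 1 -> cder f z (cd f z).
Proof. by move=> hf /hf[d hd]; rewrite (cd_eq hd). Qed.
Lemma holo_ccont f z : holo f -> cabs z < 1 -> ccont f z.
Proof. by move=> hf /(holo_cd hf)/cder_ccont. Qed.
Lemma holoDE f : holoD f <-> holo f.
Proof.
split=> [h z z1|h z /inD_cabs /h[d []//]].
by exists (cd f z); apply: derivableP; apply: h; apply/inD_cabs.
Qed.

Lemma near_disk z (r : R) : cabs z < r -> exists2 s : R, 0 < s & forall w, cabs (w - z) < s -> cabs w < r.
Proof.
move=> zr; exists (r - cabs z); first by rewrite subr_gt0.
by move=> w ws; rewrite -(subrK z w) (le_lt_trans (cabsD _ _))//; lra.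
Qed.

Lemma holo_ext f g : (forall z, cabs z < 1 -> f z = g z) -> holo f -> holo g.
Proof.
move=> fg hf z z1; have [d hd] := hf _ z1; exists d; apply: cder_ext hd.
by have [s s0 hs] := near_disk z1; exists s => // w /hs /fg.
Qed.
Lemma holo_cst c : holo (fun=> c : C).
Proof. by move=> z _; exists 0; exact: cder_cst. Qed.
Lemma holo_id : holo (@id C).
Proof. by move=> z _; exists 1; exact: cder_id. Qed.
Lemma holo_add f g : holo f -> holo g -> holo (fun z => f z + g z).
Proof. by move=> hf hg z z1; have [a ?] := hf _ z1; have [b ?] := hg _ z1; exists (a + b); exact: cderD. Qed.
Lemma holo_opp f : holo f -> holo (fun z => - f z).
Proof. by move=> hf z z1; have [a ?] := hf _ z1; exists (- a); exact: cderN. Qed.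
Lemma holo_sub f g : holo f -> holo g -> holo (fun z => f z - g z).
Proof. by move=> hf hg; apply: holo_add => //; exact: holo_opp. Qed.
Lemma holo_mul f g : holo f -> holo g -> holo (fun z => f z * g z).
Proof.
move=> hf hg z z1; have [a ha] := hf _ z1; have [b hb] := hg _ z1.
by eexists; exact: cderM ha hb.
Qed.
Lemma holo_inv f : (forall z, cabs z < 1 -> f z != 0) -> holo f -> holo (fun z => (f z)^-1).
Proof. by move=> f0 hf z z1; have [a ha] := hf _ z1; eexists; exact: cderV (f0 _ z1) ha. Qed.
Lemma holo_exp f n : holo f -> holo (fun z => f z ^+ n).
Proof. by move=> hf z z1; have [a ha] := hf _ z1; eexists; exact: cderX ha. Qed.
Lemma holo_prod (I : Type) (s : seq I) (F : I -> C -> C) : (forall i, holo (F i)) ->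
  holo (fun z => \prod_(i <- s) F i z).
Proof.
move=> h; elim: s => [|i s IH].
  by apply: holo_ext (holo_cst 1) => z _; rewrite big_nil.
by apply: holo_ext (holo_mul (h i) IH) => z _; rewrite big_cons.
Qed.

(** Bergman's formula asks for two derivatives, the second continuous, so it is applied to a second
    primitive [F2] of f. Three differentiations under the integral sign lead to f', which is again
    such an integral and hence differentiable. *)
Lemma holo_derive f : holo f -> holo (cd f).
Proof.
move=> hf; have [F1 [_ dF1]] := holo_primitive hf.
have hF1 : holo F1 by move=> z /dF1 h; exists (f z).
have [F2 [_ dF2]] := holo_primitive hF1.
move=> w w1; set r := (1 + cabs w) / 2.
have w0 := cabs_ge0 w; have r0 : 0 < r by rewrite /r; lra.
have r1 : r < 1 by rewrite /r; lra. have wr : cabs w < r by rewrite /r; lra.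
set a : C := (r ^+ 4 / area r)%:C%C.
have c2 z : cabs z <= r -> ccont F2 z by move=> zr; apply: cder_ccont (dF2 _ (le_lt_trans zr r1)).
pose un n z := F2 z * Num.conj z ^+ n.
have cun n z : cabs z <= r -> ccont (un n) z.
  move=> zr; have h : ccont (fun z => Num.conj z ^+ n) z.
    by apply: ccontX; exact: (ccont_conj (@ccont_id R z)).
  exact: (ccontM (c2 _ zr) h).
(* Each derivative in v raises the power of the kernel by one and brings down a factor conj(z),
   which [un] absorbs. *)
pose I n v := cI (disk r) (fun z => un n z * Num.conj ((bker r v z)^-1 ^+ n.+2)).
have dI n v : cabs v < r -> cder (I n) v (n.+2%:R * I n.+1 v).
  move=> vr; have := cder_cauchy_integral n.+2 r0 vr (cun n).
  have -> : (fun z => un n z * Num.conj z * Num.conj ((bker r v z)^-1 ^+ n.+3)) =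
     (fun z => un n.+1 z * Num.conj ((bker r v z)^-1 ^+ n.+3)) => //.
  by apply/funext => z; rewrite /un (exprSr (Num.conj z)) !mulrA.
have E2 v : cabs v < r -> F2 v = a * I 0%N v.
  move=> vr; rewrite (bergman_formula r0 vr
    (fun z zr => dF2 _ (le_lt_trans zr r1)) (fun z zr => dF1 _ (le_lt_trans zr r1))
    (fun z zr => holo_ccont hf (le_lt_trans zr r1))).
  by congr (_ * _); apply: cI_ext => p _; rewrite /un expr0 mulr1.
have step n (g g' : C -> C) (b : C) : (forall v, cabs v < r -> cder g v (g' v)) ->
    (forall v, cabs v < r -> g v = b * I n v) -> forall v, cabs v < r -> g' v = (b * n.+2%:R) * I n.+1 v.
  move=> dg gE v vr; apply: (cder_unique (dg _ vr)); rewrite -mulrA.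
  apply: (cder_ext (f := fun v => b * I n v)); last exact: cderZ (dI n v vr).
  by have [s s0 hs] := near_disk vr; exists s => // v' /hs /gE ->.
have lt1 v : cabs v < r -> cabs v < 1 by move=> h; exact: lt_trans r1.
have E1 := step _ _ _ _ (fun v vr => dF2 v (lt1 _ vr)) E2.
have E0 := step _ _ _ _ (fun v vr => dF1 v (lt1 _ vr)) E1.
have E := step _ _ _ _ (fun v vr => holo_cd hf (lt1 v vr)) E0.
eexists; apply: cder_ext (cderZ _ (dI 3%N w wr)).
by have [s s0 hs] := near_disk wr; exists s => // v' /hs /E ->.
Qed.
End Holomorphic.

(** * Zeros of analytic functions *)

Section Division.
Variable R : realType.
Local Notation C := (complex R).
Implicit Types (f g F G : C -> C).

(** Away from a the quotient is plainly analytic. At a, where it is given the value f'(a), the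
    second order Taylor expansion of f shows that it has the derivative f''(a) / 2. *)
Lemma holo_div f a : holo f -> cabs a < 1 -> f a = 0 ->
  exists2 g, holo g & forall z, cabs z < 1 -> f z = (z - a) * g z.
Proof.
move=> hf a1 fa0.
pose g z := if z == a then cd f a else f z / (z - a).
exists g; last first.
  move=> z z1; rewrite /g; case: eqVneq => [->|za]; first by rewrite subrr mul0r.
  by rewrite mulrC divfK// subr_eq0.
move=> z z1; have [->|za] := eqVneq z a; last first.
  have d1 : cder (fun w => w - a) z 1.
    by apply: cder_eq (cderB (cder_id z) (cder_cst a z)) _; exact: subr0.
  have za' : z - a != 0 by rewrite subr_eq0.
  eexists; apply: cder_ext (cderM (holo_cd hf z1) (@cderV R (fun w => w - a) z 1 za' d1)).
  exists (cabs (z - a)); first by rewrite cabs_gt0.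
  move=> w wz; rewrite /g; case: eqVneq => [wa|//].
  by move: wz; rewrite wa cabsC ltxx.
have hf1 := holo_derive hf; have hf2 := holo_derive hf1; have hf3 := holo_derive hf2.
set rho := (1 + cabs a) / 2.
have ar : cabs a < rho by rewrite /rho; lra.
have r1 : rho < 1 by rewrite /rho; lra.
have lt1 z' : cabs z' <= rho -> cabs z' < 1 by move=> h; exact: le_lt_trans r1.
have rho0 : 0 <= rho by apply: ltW; apply: le_lt_trans ar; exact: cabs_ge0.
have [M M0 hM] := ccont_bounded rho0 (fun z' h => holo_ccont hf3 (lt1 _ h)).
have [b bE] : exists b, cd (cd f) a = b by exists (cd (cd f) a).
have [c cE] : exists c, cd f a = c by exists (cd f a).
(* Up to a constant, f minus its Taylor polynomial of degree 2. Its derivative is the first order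
   remainder of f', at most 4 M |h|^2 on the segment. *)
pose phi u := f u - (c * u + b * (2^-1 * (u - a) ^+ 2)).
have dphi u : cabs u < 1 -> cder phi u (cd f u - c - b * (u - a)).
  move=> u1; have d2 : cder (fun u => (u - a) ^+ 2) u (2 * (u - a)).
    apply: cder_eq (cderX 2 (cderB (cder_id u) (cder_cst a u))) _.
    by rewrite /= expr1 subr0 mulr1.
  apply: cder_eq (cderB (holo_cd hf u1) (cderD (cderZ (c) (cder_id u))
    (cderZ b (cderZ 2^-1 d2)))) _.
  by move: (cd f u) => y; field.
exists (b / 2); apply: (@cder_quad _ _ _ _ (8 * M) (rho - cabs a)); first by rewrite subr_gt0.
move=> h hh; have [->|h0] := eqVneq h 0; first by rewrite addr0 subrr mulr0 subrr cabs0 expr0n mulr0.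
have ahr : cabs (a + h) <= rho by apply: le_trans (cabsD _ _) _; lra.
rewrite /g eqxx cE; case: eqVneq => [|_]; first by move/eqP; rewrite -subr_eq0 addrC addKr (negbTE h0).
have := @cder_MVI R phi (fun u => cd f u - c - b * (u - a)) a (a + h) (4 * M * cabs h ^+ 2).
rewrite (addrC a) addrK (addrC h) => H.
have {}H : cabs (phi (a + h) - phi a) <= 2 * (4 * M * cabs h ^+ 2) * cabs h.
  apply: H => t t01.
    apply: dphi; apply: lt1; have := cabs_convex (ltW ar) ahr t01.
    by rewrite (addrC a h) addrK.
  have inr : cabs (a + t%:C%C * h) <= rho.
    by have := cabs_convex (ltW ar) ahr t01; rewrite (addrC a h) addrK.
  have := cder_taylor1 (fun z' h => holo_cd hf1 (lt1 z' h)) (fun z' h => holo_cd hf2 (lt1 z' h))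
    hM (ltW ar) inr; rewrite bE cE.
  rewrite (addrC a) addrK => /le_trans; apply; rewrite ler_wpM2l ?mulr_ge0//.
  rewrite cabsM cabs_real exprMn; case/andP: t01 => t0 t1.
  by rewrite ger0_norm// ler_piMl ?sqr_ge0// expr_le1.
have hp : 0 < cabs h by rewrite cabs_gt0.

have -> : f (a + h) / h - c - b / 2 * h = (phi (a + h) - phi a) / h.
  rewrite /phi fa0; have -> : a + h - a = h by rewrite addrC addKr.
  by field.
rewrite cabsM cabsV ler_pdivrMr//; apply: le_trans H _.
by rewrite le_eqVlt; apply/orP; left; apply/eqP; ring.
Qed.

Lemma ccont_eq0 f a (r : R) : 0 < r -> ccont f a ->
  (forall z, cabs (z - a) < r -> z != a -> f z = 0) -> f a = 0.
Proof.
move=> r0 /ccontP h f0; apply: eps_half => e /h[s s0 hs].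
pose z : C := a + (Num.min (r / 2) (s / 2))%:C%C.
have m0 : 0 < Num.min (r / 2) (s / 2) by rewrite lt_min !divr_gt0.
have za : cabs (z - a) = Num.min (r / 2) (s / 2).
  by rewrite /z addrC addKr cabs_real ger0_norm// ltW.
have zs : cabs (z - a) < s by rewrite za gt_min; apply/orP; right; lra.
have := hs _ zs; rewrite f0 ?sub0r ?cabsN => [/ltW //||].
  by rewrite za gt_min; apply/orP; left; lra.
by rewrite -subr_eq0 -cabs_gt0 za.
Qed.

Lemma holo_mulI f g a : holo f -> holo g ->
  (forall z, cabs z < 1 -> (z - a) * f z = (z - a) * g z) ->
  forall z, cabs z < 1 -> f z = g z.
Proof.
move=> hf hg fg z z1.
have off w : cabs w < 1 -> w != a -> f w = g w.
  by move=> w1 wa; apply: (mulfI (_ : w - a != 0)); rewrite ?subr_eq0// fg.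
have [za|za] := eqVneq z a; last exact: off.
apply/eqP; rewrite -subr_eq0; apply/eqP.
have [s s0 hs] := near_disk z1.
apply: (@ccont_eq0 (fun w => f w - g w) z s s0).
  by apply: ccontB; exact: holo_ccont.
by move=> w /hs w1 wz; rewrite off ?subrr// -za.
Qed.

Definition bounded_holo f (M : R) := holo f /\ forall z, cabs z < 1 -> cabs (f z) <= M.

(** The quotient is bounded by compactness for |z| <= rho, and by M / (rho - |a|) beyond, where |z -
    a| >= rho - |a|. *)
Lemma bounded_holo_div f (M : R) a : bounded_holo f M -> cabs a < 1 -> f a = 0 ->
  exists g N, bounded_holo g N /\ forall z, cabs z < 1 -> f z = (z - a) * g z.
Proof.
move=> [hf fM] a1 fa; have [g hg fg] := holo_div hf a1 fa.
set rho := (1 + cabs a) / 2; have a0 := cabs_ge0 a.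
have r1 : rho < 1 by rewrite /rho; lra.
have r0 : 0 <= rho by rewrite /rho; lra.
have [N N0 hN] := ccont_bounded r0 (fun z h => holo_ccont hg (le_lt_trans h r1)).
have k0 : 0 < rho - cabs a by rewrite /rho; lra.
exists g, (Num.max N (M / (rho - cabs a))); split => //; split => // z z1.
rewrite le_max; have [/hN ->//|rz] := leP (cabs z) rho.
apply/orP; right; rewrite ler_pdivlMr//.
apply: le_trans (fM _ z1); rewrite fg// cabsM mulrC ler_wpM2r ?cabs_ge0//.
by have := cabs_dist z a; have := ler_norm (cabs z - cabs a); lra.
Qed.

Lemma bounded_holo_div_seq f (M : R) (s : seq C) : bounded_holo f M -> uniq s ->
  (forall a, a \in s -> cabs a < 1 /\ f a = 0) ->
  exists g N, bounded_holo g N /\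
    forall z, cabs z < 1 -> f z = \prod_(a <- s) (z - a) * g z.
Proof.
elim: s f M => [|a s IH] f M hf.
  by move=> _ _; exists f, M; split => // z _; rewrite big_nil mul1r.
move=> /= /andP[as_ us] h; have [a1 fa] := h a (mem_head _ _).
have [g [N [hg fg]]] := bounded_holo_div hf a1 fa.
have [|k [K [hk gk]]] := IH g N hg us.
  move=> b bs; have [b1 fb] := h b (ltac:(by rewrite in_cons bs orbT)); split => //.
  move: fb; rewrite fg// => /eqP; rewrite mulf_eq0 subr_eq0 => /orP[/eqP ba|/eqP//].
  by move: as_; rewrite -ba bs.
by exists k, K; split => // z z1; rewrite big_cons fg// gk// mulrA.
Qed.

Lemma exp_small (q e : R) : 0 <= q < 1 -> 0 < e -> exists N, forall n, (N <= n)%N -> q ^+ n <= e.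
Proof.
move=> /andP[q0 q1] e0.
have : (fun n => q ^+ n) @ \oo --> (0 : R) by apply: cvg_expr; rewrite ger0_norm.
move=> /cvgrPdist_le /(_ _ e0)[N _ hN]; exists N => n /hN /=.
by rewrite sub0r normrN ger0_norm// exprn_ge0.
Qed.

Lemma holo_mean f (r : R) : 0 < r < 1 -> holo f -> cI (disk r) f = f 0 * (area r)%:C%C.
Proof.
move=> /andP[r0 r1] hf; have hf1 := holo_derive hf; have hf2 := holo_derive hf1.
have lt1 z : cabs z <= r -> cabs z < 1 by move=> h; exact: le_lt_trans r1.
exact: (mean_value r0 (fun z h => holo_cd hf (lt1 z h)) (fun z h => holo_cd hf1 (lt1 z h))
  (fun z h => holo_ccont hf2 (lt1 z h))).
Qed.

Definition moment (r : R) f n := cI (disk r) (fun z => f z * Num.conj (z ^+ n)).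

(** Stokes' formula with h = z^n: the integrand is (n + 1) z f conj(z^n) - n r^2 f conj(z^(n-1)).
    For n = 0 the factor n annihilates the moment of index [0.-1] = 0. *)
Lemma moment_mulX (r : R) f n : 0 < r < 1 -> holo f ->
  moment r (fun z => z * f z) n = n%:R / n.+1%:R * (r ^+ 2)%:C%C * moment r f n.-1.
Proof.
move=> /andP[r0 r1] hf; have hf1 := holo_derive hf.
have mD := @measurable_disk R r.
have lt1 z : cabs z <= r -> cabs z < 1 by move=> h; exact: le_lt_trans r1.
have dn z : cabs z <= r -> cder (fun z => z ^+ n) z (n%:R * z ^+ n.-1).
  by move=> _; apply: cder_eq (cderX n (cder_id z)) _; rewrite mulr1.
have cXn m z : ccont (fun z => z ^+ m : C) z by exact: ccontX (@ccont_id R z).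
have cn z : cabs z <= r -> ccont (fun z => n%:R * z ^+ n.-1 : C) z.
  by move=> _; apply: ccontM; [exact: ccont_cst|exact: cXn].
have S := stokes r0 (fun z h => holo_cd hf (lt1 z h)) dn (fun z h => holo_ccont hf1 (lt1 z h)) cn.
have i1 : cint (disk r) (fun z => (z * f z) * Num.conj (z ^+ n)).
  apply: (cint_ccont (ltW r0)) => z zr.
  exact: (ccontM (ccontM (@ccont_id R z) (holo_ccont hf (lt1 _ zr))) (ccont_conj (cXn n z))).
have i2 : cint (disk r) (fun z => f z * Num.conj (z ^+ n.-1)).
  apply: (cint_ccont (ltW r0)) => z zr.
  exact: (ccontM (holo_ccont hf (lt1 _ zr)) (ccont_conj (cXn n.-1 z))).
have n0 : n.+1%:R != 0 :> C by rewrite pnatr_eq0.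
apply: (mulfI n0); rewrite /moment -mulrA mulrCA !mulrA mulfVK// -!mulrA.
rewrite -cIZ// -!cIZ//; last exact: cintZ.
apply/eqP; rewrite -subr_eq0 -cIB; [|exact: mD|exact: cintZ|by apply: cintZ => //; exact: cintZ].
apply/eqP; rewrite -[RHS]S; apply: cI_ext => p _; set z := toC p.
rewrite conjM (_ : Num.conj n%:R = n%:R :> C) ?rmorph_nat//.
case: (n) => [|m]; first by rewrite !mul0r; ring.
by rewrite /= -(natr1 m.+1) (exprS z m) conjM; ring.
Qed.

(* The geometric expansion of the kernel in powers of conj z, and differentiation in w,
   turn the vanishing moments into the vanishing of Bergman's integral. *)
Lemma moment_eq0 (r : R) f : 0 < r < 1 -> holo f -> (forall n, moment r f n = 0) ->
  forall w, cabs w < r -> f w = 0.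
Proof.
move=> r01 hf m0 w wr; have /andP[r0 r1] := r01.
have mD := @measurable_disk R r.
have hf1 := holo_derive hf; have hf2 := holo_derive hf1.
have lt1 z : cabs z <= r -> cabs z < 1 by move=> h; exact: le_lt_trans r1.
have cf z : cabs z <= r -> ccont f z by move=> /lt1 /(holo_ccont hf).
have cB v j z : cabs v < r -> cabs z <= r -> ccont (fun z => Num.conj ((bker r v z)^-1 ^+ j)) z.
  move=> vr zr; apply: ccont_conj; apply: ccontX.
  by apply: ccontV; [exact: bker_neq0|exact: ccont_bker].
have cfz z : cabs z <= r -> ccont (fun z => f z * Num.conj z) z.
  by move=> zr; exact: ccontM (cf _ zr) (ccont_conj (@ccont_id R z)).
have iB v j : cabs v < r -> cint (disk r) (fun z => f z * Num.conj ((bker r v z)^-1 ^+ j)).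
  by move=> vr; apply: (cint_ccont (ltW r0)) => z zr; exact: ccontM (cf _ zr) (cB _ _ _ vr zr).
have iBz v j : cabs v < r -> cint (disk r) (fun z => (f z * Num.conj z) * Num.conj ((bker r v z)^-1 ^+ j)).
  by move=> vr; apply: (cint_ccont (ltW r0)) => z zr; exact: ccontM (cfz _ zr) (cB _ _ _ vr zr).
have cXn m z : ccont (fun z => Num.conj (z ^+ m) : C) z by exact: ccont_conj (ccontX (@ccont_id R z)).
have r20 : (r ^+ 2)%:C%C != 0 :> C by apply/negP => /eqP[] /eqP; rewrite expf_eq0/= gt_eqF.
have I1 v : cabs v < r -> cI (disk r) (fun z => f z * Num.conj ((bker r v z)^-1 ^+ 1)) = 0.
  move=> vr.
  pose x z : C := Num.conj v * z / (r ^+ 2)%:C%C.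
  have [U U0 hU] := ccont_bounded (ltW r0) (fun z zr => ccontM (cf _ zr) (cB v 1%N _ vr zr)).
  (* Remainders of the geometric expansion of the kernel: since conj(x) = 1 - conj(bker) / r^2, the
     integrals of two consecutive ones differ by a multiple of a moment of f. They tend to 0 because
     |x| <= |v| / r < 1. *)
  pose T N z : C := f z * Num.conj ((bker r v z)^-1 ^+ 1) * Num.conj (x z ^+ N).
  have mono N z : f z * Num.conj ((x z) ^+ N) =
      (v / (r ^+ 2)%:C%C) ^+ N * (f z * Num.conj (z ^+ N)).
    rewrite /x !exprMn exprVn !conjM !conjX !conjV !conjX conjK conjR; ring.
  have cx N z : ccont (fun z => Num.conj (x z ^+ N)) z.
    apply: ccont_conj; apply: ccontX; apply: ccontM; last exact: ccont_cst.
    exact: (ccontM (@ccont_cst R _ z) (@ccont_id R z)).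
  have iT N : cint (disk r) (T N).
    apply: (cint_ccont (ltW r0)) => z zr.
    exact: ccontM (ccontM (cf _ zr) (cB v 1%N _ vr zr)) (cx N z).
  have iM N : cint (disk r) (fun z => f z * Num.conj (x z ^+ N)).
    by apply: (cint_ccont (ltW r0)) => z zr; exact: ccontM (cf _ zr) (cx N z).
  have zM N : cI (disk r) (fun z => f z * Num.conj (x z ^+ N)) = 0.
    rewrite (@cI_ext _ _ _ (fun z => (v / (r ^+ 2)%:C%C) ^+ N * (f z * Num.conj (z ^+ N)))); last by move=> p _; exact: mono.
    rewrite cIZ//; last by apply: (cint_ccont (ltW r0)) => z zr; exact: ccontM (cf _ zr) (cXn N z).
    by have := m0 N; rewrite /moment => ->; rewrite mulr0.
  have TE N : cI (disk r) (T N) = cI (disk r) (T 0%N).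
    elim: N => // N <-; apply/eqP; rewrite -subr_eq0 -cIB//.
    rewrite (@cI_ext _ _ _ (fun z => - (r ^+ 2)%:C%C^-1 * (f z * Num.conj (x z ^+ N)))).
      by rewrite cIZ// zM mulr0.
    move=> p /(diskE _ (ltW r0)) /ltW pr; rewrite /T; set z := toC p in pr *.
    have b0 := bker_neq0 vr pr; rewrite expr1 !conjX.
    have -> : Num.conj (x z) = 1 - Num.conj (bker r v z) / (r ^+ 2)%:C%C.
      rewrite /x /bker conjM conjB !conjM conjV conjK conjR.
      by rewrite mulrBl divff// opprB addrC subrK.
    rewrite conjV exprS; have {}b0 : Num.conj (bker r v z) != 0 by rewrite conjC_eq0.
    move: (Num.conj (bker r v z)) b0 ((r ^+ 2)%:C%C) r20 => b b0 r' r'0.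
    move: (_ ^+ N) => y; field.
    by rewrite ?b0 ?r'0.
  have q01 : 0 <= cabs v / r < 1 by rewrite divr_ge0 ?cabs_ge0 ?ltW//= ltr_pdivrMr// mul1r.
  have -> : cI (disk r) (fun z => f z * Num.conj ((bker r v z)^-1 ^+ 1)) = cI (disk r) (T 0%N).
    by apply: cI_ext => p _; rewrite /T expr0 conj1 mulr1.
  apply: eps_half => e e0.
  have a0 : 0 < 2 * (U + 1) * area r by rewrite !mulr_gt0// ?area_gt0// ltr_wpDl.
  have [N hN] := exp_small q01 (divr_gt0 e0 a0); have {hN} := hN N (leqnn N) => hN.
  rewrite -(TE N).
  apply: le_trans (@cI_bounded R r ((U + 1) * (e / (2 * (U + 1) * area r))) (T N) (ltW r0) _ _) _.
  - move=> z /ltW zr; exact: ccontM (ccontM (cf _ zr) (cB v 1%N _ vr zr)) (cx N z).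
  - move=> z /ltW zr; rewrite /T cabsM; apply: ler_pM; rewrite ?cabs_ge0//.
      by apply: le_trans (hU _ zr) _; rewrite lerDl.
    apply: le_trans hN; rewrite cabs_conj cabsX lerXn2r ?nnegrE ?cabs_ge0//.
      by case/andP: q01.
    rewrite /x !cabsM cabsV cabs_conj cabs_real ger0_norm ?sqr_ge0//.
    rewrite expr2 invfM mulrA ler_pM2r ?invr_gt0// -mulrA ler_piMr ?cabs_ge0//.
    by rewrite ler_pdivrMr// mul1r.
  - rewrite le_eqVlt; apply/orP; left; apply/eqP; field.
    by rewrite !gt_eqF ?area_gt0// ltr_wpDl.
(* The derivative in v of the vanishing integral [I1]. *)
have I2 v : cabs v < r -> cI (disk r) (fun z => (f z * Num.conj z) * Num.conj ((bker r v z)^-1 ^+ 2)) = 0.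
  move=> vr; have d1 := cder_cauchy_integral 1 r0 vr cf.
  rewrite mul1r in d1; apply: (cder_unique d1); apply: cder_ext (cder_cst 0 v).
  by have [s s0 hs] := near_disk vr; exists s => // u /hs /I1.
rewrite (bergman_formula r0 wr (fun z h => holo_cd hf (lt1 z h)) (fun z h => holo_cd hf1 (lt1 z h))
  (fun z h => holo_ccont hf2 (lt1 z h))).
suff -> : cI (disk r) (fun z => f z * Num.conj ((bker r w z)^-1 ^+ 2)) = 0 by rewrite mulr0.
(* The identity r^2 = conj(bker) + w conj(z) splits r^2 times Bergman's integral into [I1] and w
   times [I2]. *)
apply: (mulfI r20); rewrite mulr0 -cIZ//; last exact: iB.
rewrite -(I1 w wr) -[RHS]addr0 -(mulr0 w) -(I2 w wr) -cIZ//; last exact: iBz.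
rewrite -cID//; [|exact: iB|by apply: cintZ => //; exact: iBz].
apply: cI_ext => p /(diskE _ (ltW r0)) /ltW pr; set z := toC p in pr *.
have b0 : Num.conj (bker r w z) != 0 by rewrite conjC_eq0 bker_neq0.
have rE : (r ^+ 2)%:C%C = Num.conj (bker r w z) + w * Num.conj z.
  by rewrite /bker conjB conjM conjK conjR subrK.
rewrite rE !conjX conjV; move: (Num.conj (bker r w z)) b0 => b b0.
by field.
Qed.

(** Each factor z lowers the index of a moment by one until the factor n = 0 is met. Hence the n-th
    moment of z^(n+1) g vanishes, and all moments of f do. *)
Lemma holo_mulXn_eq0 f : holo f ->
  (forall k, exists2 g, holo g & forall z, cabs z < 1 -> f z = z ^+ k * g z) ->
  forall z, cabs z < 1 -> f z = 0.
Proof.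
move=> hf h w w1; have w0 := cabs_ge0 w.
set r := (1 + cabs w) / 2.
have r01 : 0 < r < 1 by rewrite /r; lra.
apply: (moment_eq0 r01 hf) => [n|]; last by rewrite /r; lra.
have key k g : holo g -> (n < k)%N -> moment r (fun z => z ^+ k * g z) n = 0.
  elim: n k g => [|n IH] [|k] g hg //= nk.
    have -> : (fun z => z ^+ k.+1 * g z) = (fun z => z * (z ^+ k * g z)).
      by apply/funext => z; rewrite exprS mulrA.
    rewrite moment_mulX ?mul0r//; exact: holo_mul (holo_exp k (@holo_id R)) hg.
  have -> : (fun z => z ^+ k.+1 * g z) = (fun z => z * (z ^+ k * g z)).
    by apply/funext => z; rewrite exprS mulrA.
  rewrite moment_mulX//=; last exact: holo_mul (holo_exp k (@holo_id R)) hg.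
  by rewrite IH// mulr0.
have [g hg fg] := h n.+1; rewrite -(key n.+1 g hg (ltnSn n)).
apply: cI_ext => p /(diskE _ (ltW (andP r01).1)) pr; rewrite fg//.
exact: lt_trans (andP r01).2.
Qed.
End Division.

(** * A Jensen inequality and its consequences for zeros *)

Section Blaschke.
Variable R : realType.
Local Notation C := (complex R).
Local Notation TR := (measurableTypeR R).
Local Notation mu := (@lebesgue_measure R \x @lebesgue_measure R)%E.
Implicit Types (f g F G Q : C -> C).

Let annulus (r1 r : R) : set (TR * TR) := disk r `\` disk r1.

Let measurable_annulus (r1 r : R) : measurable (annulus r1 r).
Proof. by apply: measurableD; exact: measurable_disk. Qed.

Let rI_annulus (r1 r : R) (u : C -> R) : 0 <= r1 <= r -> rint (disk r) u ->
  rint (annulus r1 r) u /\ rI (disk r) u = rI (disk r1) u + rI (annulus r1 r) u.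
Proof.
move=> r1r ui; have mD := @measurable_disk R; have mA := measurable_annulus r1 r.
have E : disk r1 `|` annulus r1 r = disk r by rewrite /annulus setDUK//; exact: subset_disk.
split; first by apply: integrableS ui => //; exact: subDsetl.
rewrite /rI -{1}E Rintegral_setU ?E//.
by apply/disj_setPS => p [h1 [_ h2]].
Qed.

Let cI_annulus (r1 r : R) F : 0 <= r1 <= r -> cint (disk r) F ->
  cint (annulus r1 r) F /\ cI (disk r) F = cI (disk r1) F + cI (annulus r1 r) F.
Proof.
move=> r1r [i1 i2]; have [a1 b1] := rI_annulus r1r i1; have [a2 b2] := rI_annulus r1r i2.
by split=> //; rewrite /cI b1 b2; simpc.
Qed.

Let area_annulus (r1 r : R) : 0 <= r1 < r -> area r1 < area r.
Proof.
move=> /andP[r10 r1r]; have r0 : 0 < r by exact: le_lt_trans r1r.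
have r1r' : 0 <= r1 <= r by rewrite r10 ltW.
have [i1 e1] := rI_annulus r1r' (rint_cst r 1).
rewrite !rI_cst !mul1r in e1; rewrite e1 ltrDl.
rewrite /rI Rintegral_cst ?mul1r; last exact: measurable_annulus.
(* Up to null parts of its boundary, the box [r1, m] x [0, n] lies in the annulus because m^2 + n^2
   = (r1^2 + r^2) / 2 < r^2; in fact all of it does, since [annulus] contains its inner circle. *)
set m := (r1 + r) / 2; set n := (r - r1) / 2.
have m0 : 0 < m - r1 by rewrite /m; lra.
have n0 : 0 < n by rewrite /n; lra.
have : (mu (`[r1, m]%classic `*` `[0%R, n]%classic) <= mu (annulus r1 r))%E.
  apply: le_measure; rewrite ?inE; [exact: measurableX|exact: measurable_annulus|].
  move=> [a b]; rewrite /annulus /disk /= !in_itv /= => -[/andP[a0 ar] /andP[b0 br]].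
  have h1 : a ^+ 2 <= m ^+ 2 by rewrite ler_sqr ?nnegrE//; [exact: le_trans a0|rewrite /m; lra].
  have h2 : b ^+ 2 <= n ^+ 2 by rewrite ler_sqr ?nnegrE//; exact: ltW.
  have h3 : r1 ^+ 2 <= a ^+ 2 by rewrite ler_sqr ?nnegrE//; exact: le_trans a0.
  have h4 : 0 <= b ^+ 2 by exact: sqr_ge0.
  have h5 : r1 ^+ 2 < r ^+ 2 by rewrite ltr_sqr ?nnegrE// ltW.
  split; last by apply/negP; rewrite -leNgt; lra.
  apply: le_lt_trans (lerD h1 h2) _; rewrite /m /n.
  have -> : ((r1 + r) / 2) ^+ 2 + ((r - r1) / 2) ^+ 2 = (r1 ^+ 2 + r ^+ 2) / 2 by field.
  lra.
rewrite product_measure1E//= !lebesgue_measure_itv /= !lte_fin.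
rewrite n0 (_ : r1 < m); last by move: m0; rewrite subr_gt0.
rewrite -!EFinD -EFinM subr0 => h; apply: fine_gt0; apply/andP; split.
  by apply: lt_le_trans h; rewrite lte_fin mulr_gt0.
apply: le_lt_trans (@mu_disk_lty R r).
by apply: le_measure; rewrite ?inE; [exact: measurable_annulus|exact: measurable_disk|exact: subDsetl].
Qed.

(** This takes the place of the maximum principle: the difference of the mean value formulas on the
    two disks writes G(0) as a mean over the annulus. *)
Lemma holo_annulus_max G (r1 r M : R) : holo G -> 0 < r1 < r -> r < 1 ->
  (forall z, r1 <= cabs z < r -> cabs (G z) <= M) -> cabs (G 0) <= 2 * M.
Proof.
move=> hG /andP[r10 r1r] r1' GM.
have r0 : 0 < r by exact: lt_trans r1r.
have r1r' : 0 <= r1 <= r by rewrite !ltW.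
have lt1 z : cabs z <= r -> cabs z < 1 by move=> h; exact: le_lt_trans r1'.
have iG : cint (disk r) G by apply: (cint_ccont (ltW r0)) => z /lt1; exact: holo_ccont.
have [i1 e1] := cI_annulus r1r' iG.
have [i2 e2] := rI_annulus r1r' (rint_cst r M).
move: e1; rewrite !holo_mean ?r0 ?r10 ?(lt_trans r1r)// => e1.
move: e2; rewrite !rI_cst => e2.
have aa : 0 < area r - area r1 by rewrite subr_gt0 area_annulus// ltW.
have E : G 0 * (area r - area r1)%:C%C = cI (annulus r1 r) G.
  by rewrite rmorphB mulrBr e1 addrC addKr.
rewrite -(ler_pM2r aa).
have -> : cabs (G 0) * (area r - area r1) = cabs (G 0 * (area r - area r1)%:C%C).
  by rewrite cabsM cabs_real ger0_norm// ltW.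
have -> : 2 * M * (area r - area r1) = 2 * rI (annulus r1 r) (fun=> M).
  by rewrite -mulrA mulrBr e2 addrC addKr.
rewrite E; apply: (@cI_le R (annulus r1 r) G (fun=> M) (measurable_annulus r1 r) i1 i2).
move=> p [/(diskE _ (ltW r0)) h1 h2]; apply: GM; rewrite h1 andbT leNgt.
by apply/negP => h; apply: h2; apply/(diskE _ (ltW r10)).
Qed.

Let pow_1eps (n : nat) : exists2 e : R, 0 < e & (1 + e) ^+ n <= 2.
Proof.
have key (e : R) k : 0 <= e <= 1 -> (1 + e) ^+ k <= 1 + (2 ^+ k - 1) * e.
  move=> /andP[e0 e1]; elim: k => [|k IH]; first by rewrite !expr0 subrr mul0r addr0.
  rewrite exprSr; apply: le_trans (ler_wpM2r _ IH) _; first by rewrite addr_ge0.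
  have k1 : 1 <= (2 : R) ^+ k by rewrite exprn_ege1// ler1n.
  have : 0 <= (2 ^+ k - 1) * (e * (1 - e)) by rewrite !mulr_ge0 ?subr_ge0.
  by rewrite exprS; lra.
have p0 : 0 < (2 : R) ^+ n by rewrite exprn_gt0.
have p1 : 1 <= (2 : R) ^+ n by rewrite exprn_ege1// ler1n.
exists (2 ^+ n)^-1; first by rewrite invr_gt0.
apply: le_trans (key _ n _) _; first by rewrite invr_ge0 ltW//= invf_le1.
have : 0 <= (2 ^+ n)^-1 :> R by rewrite invr_ge0 ltW.
rewrite mulrBl divff ?gt_eqF//; lra.
Qed.

(** On |z| = r both moduli agree without the factor 1 + e, by |r^2 - conj(a) z|^2 = r^2 |z - a|^2 +
    (r^2 - |z|^2)(r^2 - |a|^2); on a thin annulus the last product is small. *)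
Let blaschke_ratio (rho r e : R) : 0 <= rho < r -> r < 1 -> 0 < e ->
  exists2 r1, 0 < r1 < r & forall a z : C, cabs a <= rho -> r1 <= cabs z < r ->
    cabs (((r ^+ 2)%:C%C - Num.conj a * z) / r%:C%C) <= (1 + e) * cabs (z - a).
Proof.
move=> /andP[rho0 rr] r1' e0.
have r0 : 0 < r by exact: le_lt_trans rr.
(* [k] is a lower bound for |z - a| on the annulus, and [r1] below is close enough to r for r^2 -
   |z|^2 <= e k^2. *)
set k := (r - rho) / 2; have k0 : 0 < k by rewrite /k; lra.
have ek0 : 0 < e * k ^+ 2 / 2 by rewrite divr_gt0// mulr_gt0// exprn_gt0.
set r1 := Num.max ((r + rho) / 2) (r - e * k ^+ 2 / 2).
have r1a : (r + rho) / 2 <= r1 by rewrite le_max lexx.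
have r1b : r - e * k ^+ 2 / 2 <= r1 by rewrite le_max lexx orbT.
have r1r : r1 < r by rewrite gt_max; apply/andP; split; lra.
have r10 : 0 < r1 by lra.
exists r1; first by rewrite r10.
move=> a z ar /andP[z1 z2].
have az : k <= cabs (z - a).
  have := cabs_dist z a; have := ler_norm (cabs z - cabs a); rewrite /k; lra.
have iden : cabs ((r ^+ 2)%:C%C - Num.conj a * z) ^+ 2 =
    r ^+ 2 * cabs (z - a) ^+ 2 + (r ^+ 2 - cabs z ^+ 2) * (r ^+ 2 - cabs a ^+ 2).
  case: a z {ar z1 z2 az} => [a1 a2] [b1 b2]; rewrite -!sqn_cabs /sqn /=; ring.
have e1 : 0 <= 1 + e by lra.
rewrite -(@ler_pXn2r _ 2) ?nnegrE ?mulr_ge0 ?cabs_ge0//.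
rewrite cabsM cabsV cabs_real (ger0_norm (ltW r0)) exprMn iden exprMn.
rewrite exprVn ler_pdivrMr ?exprn_gt0//.
set A := cabs (z - a) ^+ 2.
have kA : k ^+ 2 <= A by rewrite ler_sqr ?nnegrE ?cabs_ge0// ltW.
have k2 : 0 < k ^+ 2 by rewrite exprn_gt0.
have h1 : r ^+ 2 - cabs z ^+ 2 <= e * A.
  have -> : r ^+ 2 - cabs z ^+ 2 = (r - cabs z) * (r + cabs z) by ring.
  apply: (@le_trans _ _ ((e * k ^+ 2 / 2) * 2)).
    by apply: ler_pM; rewrite ?subr_ge0 ?addr_ge0 ?cabs_ge0//; lra.
  by rewrite divfK// ler_pM2l.
have h2 : r ^+ 2 - cabs a ^+ 2 <= r ^+ 2 by rewrite gerBl sqr_ge0.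
have h20 : 0 <= r ^+ 2 - cabs a ^+ 2.
  by rewrite subr_ge0 ler_sqr ?nnegrE ?cabs_ge0// ?(ltW r0)//; lra.
have h10 : 0 <= r ^+ 2 - cabs z ^+ 2.
  by rewrite subr_ge0 ler_sqr ?nnegrE ?cabs_ge0// ?(ltW r0)//; lra.
have h3 : (r ^+ 2 - cabs z ^+ 2) * (r ^+ 2 - cabs a ^+ 2) <= e * A * r ^+ 2 by exact: ler_pM.
have A0 : 0 <= A by exact: sqr_ge0.
have r20 : 0 <= r ^+ 2 by exact: sqr_ge0.
have h0 : 0 <= e + e ^+ 2 by rewrite addr_ge0 ?sqr_ge0// ltW.
have h4 := mulr_ge0 (mulr_ge0 h0 A0) r20.
apply: le_trans (lerD (lexx _) h3) _; rewrite -subr_ge0.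
by rewrite (_ : _ - _ = (e + e ^+ 2) * A * r ^+ 2) //; ring.
Qed.

(* Jensen-type inequality: each factor z - a is compared with a Blaschke factor
   of the disk of radius r, which has modulus one on the boundary. *)
Lemma jensen F Q (s : seq C) (rho r M : R) : holo Q -> 0 <= rho < r -> r < 1 -> 0 <= M ->
  (forall a, a \in s -> cabs a <= rho) ->
  (forall z, cabs z < 1 -> F z = \prod_(a <- s) (z - a) * Q z) ->
  (forall z, cabs z < r -> cabs (F z) <= M) -> cabs (F 0) <= 4 * M * (rho / r) ^+ size s.
Proof.
move=> hQ rr r1' M0 sr FQ FM; have /andP[rho0 rhor] := rr.
have r0 : 0 < r by exact: le_lt_trans rhor.
(* The factors 1 + e lose at most 2 over the whole product; the other 2 in the constant 4 comes from
   [holo_annulus_max]. *)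
have [e e0 he] := pow_1eps (size s).
have [r1 r1r hr1] := blaschke_ratio rr r1' e0.
(* F divided by its Blaschke product on the disk of radius r: |G(0)| is |Q(0)| times the power
   [size s] of r, while |F(0)| is at most |Q(0)| times the same power of rho. *)
pose G z := Q z * \prod_(a <- s) (((r ^+ 2)%:C%C - Num.conj a * z) / r%:C%C).
have hG : holo G.
  apply: holo_mul => //; apply: holo_prod => a; apply: holo_mul; last exact: holo_cst.
  by apply: holo_sub; [exact: holo_cst|apply: holo_mul; [exact: holo_cst|exact: holo_id]].
have GM z : r1 <= cabs z < r -> cabs (G z) <= 2 * M.
  move=> zr; have /andP[_ zr'] := zr.
  apply: (@le_trans _ _ ((1 + e) ^+ size s * cabs (F z))); last first.
    by apply: ler_pM; rewrite ?exprn_ge0 ?cabs_ge0 ?FM// addr_ge0// ltW.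
  rewrite FQ; last exact: lt_trans r1'.
  have key : \prod_(a <- s) cabs (((r ^+ 2)%:C%C - Num.conj a * z) / r%:C%C) <=
      \prod_(a <- s) cabs (z - a) * (1 + e) ^+ size s.
    elim: s sr {he FQ G hG} => [|a s IH] sr; first by rewrite !big_nil expr0 mulr1.
    rewrite !big_cons /= (exprS (1 + e)).
    have -> : (cabs (z - a) * \prod_(j <- s) cabs (z - j)) * ((1 + e) * (1 + e) ^+ size s) =
      ((1 + e) * cabs (z - a)) * ((\prod_(j <- s) cabs (z - j)) * (1 + e) ^+ size s) by ring.
    apply: ler_pM; rewrite ?cabs_ge0//.
    - by rewrite -cabs_prod cabs_ge0.
    - by apply: hr1 => //; apply: sr; rewrite mem_head.
    - by apply: IH => b bs; apply: sr; rewrite in_cons bs orbT.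
  rewrite /G !cabsM !cabs_prod.
  have -> : (1 + e) ^+ size s * (\prod_(a <- s) cabs (z - a) * cabs (Q z)) =
    cabs (Q z) * (\prod_(a <- s) cabs (z - a) * (1 + e) ^+ size s) by ring.
  by rewrite ler_wpM2l ?cabs_ge0.
have := holo_annulus_max hG r1r r1' GM.
have -> : cabs (G 0) = cabs (Q 0) * r ^+ size s.
  rewrite /G cabsM cabs_prod; congr (_ * _).
  elim: (s) => [|a s' IH]; first by rewrite big_nil expr0.
  rewrite big_cons IH [size _]/= (exprS r (size s')) mulr0 subr0; congr (_ * _).
  rewrite cabsM cabsV !cabs_real ger0_norm ?sqr_ge0// ger0_norm ?(ltW r0)//.
  by rewrite expr2 mulfK// gt_eqF.
rewrite FQ ?cabs0// cabsM cabs_prod => h.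
apply: (@le_trans _ _ (rho ^+ size s * cabs (Q 0))).
  rewrite ler_wpM2r ?cabs_ge0//.
  elim: s sr {he FQ G hG GM h} => [|a s IH] sr; first by rewrite big_nil expr0.
  rewrite big_cons exprS; apply: ler_pM; rewrite ?cabs_ge0//.
  - by rewrite -cabs_prod cabs_ge0.
  - by rewrite sub0r cabsN; apply: sr; rewrite mem_head.
  - by apply: IH => b bs; apply: sr; rewrite in_cons bs orbT.
rewrite expr_div_n mulrA ler_pdivlMr ?exprn_gt0//.
have -> : 4 * M * rho ^+ size s = rho ^+ size s * (2 * (2 * M)) by ring.
rewrite -mulrA; by rewrite ler_wpM2l ?exprn_ge0.
Qed.

(** Jensen's inequality with a repeated N times bounds |F(0)| by a constant times (|a| / r)^N for
    all N, so F(0) = 0. The quotient F / z again vanishes to infinite order at a, as a is not 0;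
    iterating, F vanishes to infinite order at 0. *)
Lemma holo_infinite_order F a : holo F -> cabs a < 1 -> a != 0 ->
  (forall k, exists2 E, holo E & forall z, cabs z < 1 -> F z = (z - a) ^+ k * E z) ->
  forall z, cabs z < 1 -> F z = 0.
Proof.
move=> hF a1 a0 hE.
have ca0 := cabs_ge0 a; set r := (1 + cabs a) / 2.
have r1 : r < 1 by rewrite /r; lra.
have ar : 0 <= cabs a < r by rewrite ca0 /=; rewrite /r; lra.
have r0 : 0 < r by case/andP: ar => ? ?; exact: le_lt_trans ca0 _.
have step G : holo G ->
    (forall k, exists2 E, holo E & forall z, cabs z < 1 -> G z = (z - a) ^+ k * E z) ->
    exists2 G1, holo G1 /\ (forall z, cabs z < 1 -> G z = z * G1 z) &
    (forall k, exists2 E, holo E & forall z, cabs z < 1 -> G1 z = (z - a) ^+ k * E z).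
  move=> hG hGE.
  have [M M0 hM] := ccont_bounded (ltW r0) (fun z h => holo_ccont hG (le_lt_trans h r1)).
  have G0 : G 0 = 0.
    apply: eps_half => e e0.
    have q01 : 0 <= cabs a / r < 1.
      rewrite divr_ge0 ?(ltW r0)//= ltr_pdivrMr// mul1r; by case/andP: ar.
    have M1 : 0 < 4 * (M + 1) by rewrite mulr_gt0// ltr_wpDl.
    have [N hN] := exp_small q01 (divr_gt0 e0 M1).
    have [E hE' GE] := hGE N.
    have prodE (z : C) : \prod_(b <- nseq N a) (z - b) = (z - a) ^+ N.
      by rewrite big_nseq; elim: (N) => //= n ->; rewrite exprS.
    have := @jensen G E (nseq N a) (cabs a) r (M + 1) hE' ar r1.
    rewrite size_nseq => /(_ _ _ _ _) h.
    apply: le_trans (h _ _ _ _) _.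
    - by rewrite ltW// ltr_wpDl.
    - by move=> b /nseqP[->].
    - by move=> z z1; rewrite prodE GE.
    - by move=> z /ltW /hM h'; apply: le_trans h' _; rewrite lerDl.
    - by rewrite mulrC -ler_pdivlMr//; exact: hN.
  have z1 : cabs (0 : C) < 1 by rewrite cabs0.
  have [G1 hG1 GG1] := holo_div hG z1 G0.
  exists G1; first by split=> // z /GG1; rewrite subr0.
  move=> k; have [E hE' GE] := hGE k.
  have E0 : E 0 = 0.
    have := GE _ z1; rewrite G0 sub0r => /esym/eqP; rewrite mulf_eq0 expf_eq0 oppr_eq0.
    by rewrite (negbTE a0) andbF /= => /eqP.
  have [E1 hE1 EE1] := holo_div hE' z1 E0.
  exists E1 => //; have hp : holo (fun z => (z - a) ^+ k * E1 z).
    apply: holo_mul => //; apply: holo_exp; apply: holo_sub; [exact: holo_id|exact: holo_cst].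
  move=> z zz; apply: (holo_mulI hG1 hp (a := 0)) => // w w1.
  by rewrite -GG1// GE// EE1//; ring.
apply: holo_mulXn_eq0 => // k.
suff [G [hG FG] _] : exists2 G, holo G /\ (forall z, cabs z < 1 -> F z = z ^+ k * G z) &
   (forall k, exists2 E, holo E & forall z, cabs z < 1 -> G z = (z - a) ^+ k * E z).
  by exists G.
elim: k => [|k [G [hG FG] hGE]].
  by exists F => //; split=> // z _; rewrite expr0 mul1r.
have [G1 [hG1 GG1] h1] := step G hG hGE.
by exists G1 => //; split=> // z z1; rewrite FG// GG1// exprSr mulrA.
Qed.

(** For n distinct zeros Jensen's inequality bounds 1 = |f(0)| by 4 (M + 1) (rho / r)^n. *)
Lemma holo_zeros_bounded f (M rho : R) : bounded_holo f M -> f 0 = 1 -> 0 <= rho < 1 ->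
  exists N, forall s : seq C, uniq s -> (forall a, a \in s -> cabs a <= rho /\ f a = 0) ->
    (size s <= N)%N.
Proof.
move=> fM f0 /andP[rho0 rho1].
set r := (1 + rho) / 2; have r1 : r < 1 by rewrite /r; lra.
have rr : 0 <= rho < r by rewrite rho0 /r; lra.
have r0 : 0 < r by rewrite /r; lra.
have [hf hM] := fM.
have M0 : 0 <= M by apply: le_trans (hM 0 _); rewrite ?cabs_ge0 ?cabs0.
have q01 : 0 <= rho / r < 1.
  by rewrite divr_ge0 ?(ltW r0)//= ltr_pdivrMr// mul1r; case/andP: rr.
have M1 : 0 < 4 * (M + 1) by rewrite mulr_gt0// ltr_wpDl.
(* Chosen so that Jensen's bound becomes 1/2. *)
have e0 : 0 < (2 * (4 * (M + 1)))^-1 by rewrite invr_gt0 mulr_gt0.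
have [N hN] := exp_small q01 e0.
exists N => s us hs; rewrite leqNgt; apply/negP => /ltnW /hN h.
have [|Q [K [[hQ _] fQ]]] := bounded_holo_div_seq fM us.
  by move=> a /hs[ar ->]; split => //; exact: le_lt_trans rho1.
have := @jensen f Q s rho r (M + 1) hQ rr r1 _ (fun a as_ => (hs a as_).1) fQ _.
rewrite f0 cabs1 => /(_ _ _) H.
suff : (1 : R) <= 1 / 2 by lra.
apply: le_trans (H _ _) _.
- by rewrite ltW// ltr_wpDl.
- by move=> z zr; apply: le_trans (hM _ (lt_trans zr r1)) _; rewrite lerDl.
- rewrite mulrC -ler_pdivlMr//; apply: le_trans h _.
  by rewrite invfM div1r.
Qed.
End Blaschke.

(** * Limits of integrals and the Bergman space *)

Section Limits.
Variable R : realType.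
Local Notation C := (complex R).
Local Notation TR := (measurableTypeR R).
Local Notation mu := (@lebesgue_measure R \x @lebesgue_measure R)%E.
Implicit Types (f g F G : C -> C) (A : set (TR * TR)).

Definition tends (u : nat -> C) (l : C) := (u : nat -> C^o) @ \oo --> (l : C^o).

Lemma tendsP u l : tends u l <->
  forall e : R, 0 < e -> exists N, forall n, (N <= n)%N -> cabs (u n - l) <= e.
Proof.
split=> [/cvgrPdist_le h e e0|h].
  have /h[N _ hN] : 0 < (e%:C)%C by rewrite ltcR.
  by exists N => n /hN; rewrite /= normr_cabs lecR cabsC.
apply/cvgrPdist_le => e; rewrite ltcE /= => /andP[/eqP e2 e1].
have [N hN] := h _ e1; exists N => // n /hN h'.
by rewrite /= normr_cabs cabsC lecE /= -e2 eqxx.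
Qed.
Lemma tendsB u v a b : tends u a -> tends v b -> tends (fun n => u n - v n) (a - b).
Proof. exact: cvgB. Qed.
Lemma tendsM u v a b : tends u a -> tends v b -> tends (fun n => u n * v n) (a * b).
Proof. exact: cvgM. Qed.
Lemma tends_cst a : tends (fun=> a) a.
Proof. exact: cvg_cst. Qed.
Lemma tends_unique u a b : tends u a -> tends u b -> a = b.
Proof. by move=> ha hb; apply: (@cvg_unique _ (@norm_hausdorff _ (C^o)) _ _ _ _ ha hb). Qed.
Lemma tends_ext u v a : (forall n, u n = v n) -> tends u a -> tends v a.
Proof. by move=> /funext ->. Qed.

Lemma rI_dct A (u_ : nat -> C -> R) (u g : C -> R) : measurable A ->
  (forall n, measurable_fun A (u_ n \o @toC R)) -> measurable_fun A (u \o @toC R) ->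
  (forall p, A p -> (fun n => u_ n (toC p)) @ \oo --> u (toC p)) ->
  rint A g -> (forall n p, A p -> `|u_ n (toC p)| <= g (toC p)) ->
  rint A u /\ (fun n => rI A (u_ n)) @ \oo --> rI A u.
Proof.
move=> mA mu_ mu0 uu gi ug.
have mf n : measurable_fun A (EFin \o (u_ n \o @toC R)) by exact/measurable_EFinP.
have mfu : measurable_fun A (EFin \o (u \o @toC R)) by exact/measurable_EFinP.
have cf : {ae mu, forall p, A p -> (EFin \o (u_ n \o @toC R)) p @[n --> \oo] --> (EFin \o (u \o @toC R)) p}.
  by apply: aeW => p /uu h; apply: cvg_EFin; [exact: nearW|exact: h].
have cg : {ae mu, forall p n, A p -> (`|(EFin \o (u_ n \o @toC R)) p| <= (EFin \o (g \o @toC R)) p)%E}.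
  by apply: aeW => p n Ap; rewrite /= lee_fin; exact: ug.
have [i1 _ i3] := dominated_convergence mA mf mfu cf gi cg.
split; first exact: i1.
have E : (rI A u)%:E = (\int[mu]_(p in A) (EFin \o (u \o @toC R)) p)%E.
  by rewrite /rI /Rintegral fineK//; exact: integrable_fin_num.
by apply: fine_cvg; rewrite E; exact: i3.
Qed.

Lemma tends_ReIm (u : nat -> C) (l : C) :
  (fun n => complex.Re (u n)) @ \oo --> complex.Re l ->
  (fun n => complex.Im (u n)) @ \oo --> complex.Im l -> tends u l.
Proof.
move=> /cvgrPdist_le h1 /cvgrPdist_le h2; apply/tendsP => e e0.
have e2 : 0 < e / 2 by rewrite divr_gt0.
have [N1 _ H1] := h1 _ e2; have [N2 _ H2] := h2 _ e2.
exists (maxn N1 N2) => n; rewrite geq_max => /andP[/H1 n1 /H2 n2].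
apply: le_trans (cabs_le_ReIm _) _; rewrite ReB ImB.
by rewrite (_ : e = e / 2 + e / 2) ?lerD// 1?distrC//; field.
Qed.
Lemma tends_Re (u : nat -> C) (l : C) : tends u l ->
  (fun n => complex.Re (u n)) @ \oo --> complex.Re l /\
  (fun n => complex.Im (u n)) @ \oo --> complex.Im l.
Proof.
move=> /tendsP h; split; apply/cvgrPdist_le => e /h[N hN]; exists N => // n /hN h'.
  by rewrite distrC -ReB; apply: le_trans h'; exact: cabs_Re.
by rewrite distrC -ImB; apply: le_trans h'; exact: cabs_Im.
Qed.

Lemma cI_dct (F_ : nat -> C -> C) F (g : C -> R) :
  (forall n z, cabs z < 1 -> ccont (F_ n) z) -> (forall z, cabs z < 1 -> ccont F z) ->
  (forall z, cabs z < 1 -> tends (F_ ^~ z) (F z)) -> rint (disk 1) g ->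
  (forall n z, cabs z < 1 -> cabs (F_ n z) <= g z) ->
  cint (disk 1) F /\ tends (fun n => cI (disk 1) (F_ n)) (cI (disk 1) F).
Proof.
move=> cF_ cF FF gi Fg.
have mD := @measurable_disk R 1.
have inD p : disk 1 p -> cabs (toC p) < 1 by move=> /(diskE _ ler01).
have m_ n := ccont_measurable ler01 (cF_ n).
have [m1 m2] := ccont_measurable ler01 cF.
have [||i1 c1] := @rI_dct (disk 1) (fun n z => complex.Re (F_ n z)) (fun z => complex.Re (F z)) g
  mD (fun n => (m_ n).1) m1 _ gi.
- by move=> p /inD /FF /tends_Re[].
- by move=> n p /inD /(Fg n); apply: le_trans; exact: cabs_Re.
have [||i2 c2] := @rI_dct (disk 1) (fun n z => complex.Im (F_ n z)) (fun z => complex.Im (F z)) g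
  mD (fun n => (m_ n).2) m2 _ gi.
- by move=> p /inD /FF /tends_Re[].
- by move=> n p /inD /(Fg n); apply: le_trans; exact: cabs_Im.
by split; [split|apply: tends_ReIm].
Qed.

Lemma cint_dom F (u : C -> R) : (forall z, cabs z < 1 -> ccont F z) -> rint (disk 1) u ->
  (forall z, cabs z < 1 -> cabs (F z) <= u z) -> cint (disk 1) F.
Proof.
move=> cF ui Fu; have [m1 m2] := ccont_measurable ler01 cF.
have mD := @measurable_disk R 1.
have inD p : disk 1 p -> cabs (toC p) < 1 by move=> /(diskE _ ler01).
split; apply: rint_le ui _ => // p /inD /Fu; apply: le_trans; [exact: cabs_Re|exact: cabs_Im].
Qed.

(** Radii tending to 1; the shift by 2 keeps them at least 1/2, hence their squares at least 1/4. *)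
Definition rr (n : nat) : R := 1 - n.+2%:R^-1.

Lemma rr_bound n : 2^-1 <= rr n < 1.
Proof.
rewrite /rr ltrBlDr ltrDl invr_gt0 ltr0n andbT.
have : (n.+2%:R : R)^-1 <= 2^-1 by rewrite lef_pV2 ?posrE ?ltr0n// ler_nat.
by move: (n.+2%:R^-1) => x; lra.
Qed.
Lemma rr01 n : 0 < rr n < 1.
Proof. by have /andP[h ->] := rr_bound n; rewrite andbT; apply: lt_le_trans h; lra. Qed.
Lemma rr_lt (x : R) : x < 1 -> exists N, forall n, (N <= n)%N -> x < rr n.
Proof.
move=> x1; have x0 : 0 < 1 - x by rewrite subr_gt0.
exists (Num.bound (1 - x)^-1) => n nN.
have : n.+2%:R^-1 < 1 - x.
  rewrite -[ltRHS]invrK ltf_pV2 ?posrE ?invr_gt0 ?ltr0n//.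
  apply: lt_le_trans (archi_boundP _) _; first by rewrite invr_ge0 ltW.
  by rewrite ler_nat; apply: leq_trans nN _; rewrite -addn2 leq_addr.
by rewrite /rr; move: (n.+2%:R^-1) => y; lra.
Qed.
Lemma tends_rr2 : tends (fun n => (rr n ^+ 2)%:C%C) 1.
Proof.
apply/tendsP => e e0.
have [N hN] : exists N, forall n, (N <= n)%N -> 1 - e / 2 < rr n.
  by apply: rr_lt; rewrite ltrBlDr ltrDl divr_gt0.
exists N => n /hN h; have /andP[h0 h1] := rr01 n.
rewrite -(rmorph1 (real_complex R)) -rmorphB cabs_real distrC.
have -> : 1 - rr n ^+ 2 = (1 - rr n) * (1 + rr n) by ring.
have p0 : 0 <= 1 - rr n by rewrite subr_ge0 ltW.
rewrite ger0_norm; last by rewrite mulr_ge0// addr_ge0// ltW.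
apply: (@le_trans _ _ ((1 - rr n) * 2)); last by lra.
by rewrite ler_wpM2l//; lra.
Qed.

Let rI_cutoff (u : C -> R) : rint (disk 1) u -> (fun n => rI (disk (rr n)) u) @ \oo --> rI (disk 1) u.
Proof.
move=> ui; have mD := @measurable_disk R.
have h01 n : 0 <= rr n by have /andP[/ltW] := rr01 n.
pose u_ n z := if cabs z < rr n then u z else 0.
have E n : rI (disk (rr n)) u = rI (disk 1) (u_ n).
  have -> : disk (rr n) = disk 1 `&` disk (rr n) :> set (R * R).
    rewrite setIidr//; apply: subset_disk; rewrite h01/= ltW//.
    by have /andP[] := rr01 n.
  rewrite /rI Rintegral_mkcondr; apply: eq_Rintegral => p _.
  rewrite /patch /u_ /=; case: ifPn => h.
    by move: h; rewrite inE => /(diskE _ (h01 n)) ->.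
  case: ifPn => // h'; move: h; rewrite notin_setE => h; exfalso; apply: h.
  by apply/(diskE _ (h01 n)).
under eq_fun do rewrite E.
have mu0 : measurable_fun (disk 1) (u \o @toC R).
  by apply/measurable_EFinP; exact: measurable_int ui.
have ma : rint (disk 1) (fun z => `|u z|) by apply: eq_integrable (integrable_norm ui).
have [|||_ h] := @rI_dct (disk 1) u_ u (fun z => `|u z|) (mD 1) _ mu0 _ ma _; last exact: h.
- move=> n; have -> : u_ n \o @toC R = (u \o @toC R) \_ (disk (rr n)).
    apply/funext => p; rewrite /patch /u_ /=; case: ifPn => h.
      by rewrite mem_set//; apply/(diskE _ (h01 n)).
    by rewrite memNset// => /(diskE _ (h01 n)) h'; rewrite h' in h.
  apply/(measurable_restrict _ (mD (rr n)) (mD 1)).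
  by apply: measurable_funS mu0; [exact: mD|exact: subIsetl].
- move=> p /(diskE _ ler01) p1; apply/cvgrPdist_le => e e0.
  have [N hN] := rr_lt p1; exists N => // n /hN h.
  by rewrite /u_ h subrr normr0 ltW.
- by move=> n p _; rewrite /u_; case: ifP => // _; rewrite normr0.
Qed.

Lemma cI_cutoff F : cint (disk 1) F -> tends (fun n => cI (disk (rr n)) F) (cI (disk 1) F).
Proof. by move=> [i1 i2]; apply: tends_ReIm; exact: rI_cutoff. Qed.

Lemma BergmanE f : Bergman f <-> holo f /\ rint (disk 1) (fun z => cabs (f z) ^+ 2).
Proof.
rewrite /Bergman holoDE /L2D /rint.
have -> : (fun p : R * R => (sqn (f (toC p)))%:E) = EFin \o ((fun z => cabs (f z) ^+ 2) \o @toC R).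
  by apply/funext => p; rewrite /= sqn_cabs.
rewrite -disk1; split=> [[hf [_ _ h]]|[hf h]]; first by split.
have [m1 m2] := ccont_measurable ler01 (fun z z1 => holo_ccont hf z1).
by split => //; split.
Qed.
End Limits.

(** * Products and pairings in the Bergman space *)

Section Eigen.
Variable R : realType.
Local Notation C := (complex R).
Implicit Types (f g F G h t p : C -> C).

Lemma measurable_disk1 : measurable (disk (1 : R) : set (measurableTypeR R * measurableTypeR R)).
Proof. exact: measurable_disk. Qed.

Lemma Bergman_holo f : Bergman f -> holo f. Proof. by move=> /BergmanE[]. Qed.

Lemma Bergman_dom g (u : C -> R) : holo g -> rint (disk 1) u ->
  (forall z, cabs z < 1 -> cabs (g z) ^+ 2 <= u z) -> Bergman g.
Proof.
move=> hg ui gu; apply/BergmanE; split => //.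
apply: rint_le ui _; first exact: measurable_disk1.
  apply: measurable_disk_eps => // z z1 e e0.
  have /ccontP /(_ _ e0) := ccontM (holo_ccont hg z1) (holo_ccont hg z1).
  move=> [d d0 hd]; exists d => // w /hd; apply: le_lt_trans.
  by rewrite -!cabsX; apply: le_trans (cabs_dist _ _) _; rewrite !expr2.
by move=> p /(diskE _ ler01) /gu; rewrite ger0_norm ?sqr_ge0.
Qed.

Lemma Bergman_bounded g (M : R) : holo g -> (forall z, cabs z < 1 -> cabs (g z) <= M) -> Bergman g.
Proof.
move=> hg gM; apply: (Bergman_dom hg (rint_cst 1 (M ^+ 2))) => z /gM h.
by rewrite lerXn2r ?nnegrE ?cabs_ge0// (le_trans _ h)// cabs_ge0.
Qed.

Lemma Bergman_mul p f (M : R) : Bergman f -> holo p ->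
  (forall z, cabs z < 1 -> cabs (p z) <= M) -> Bergman (fun z => p z * f z).
Proof.
move=> /BergmanE[hf fi] hp pM; apply: (Bergman_dom (holo_mul hp hf)
  (rintZ (M ^+ 2) measurable_disk1 fi)) => z z1.
rewrite cabsM exprMn ler_wpM2r ?sqr_ge0// lerXn2r ?nnegrE ?cabs_ge0 ?pM//.
by apply: le_trans (pM _ z1); exact: cabs_ge0.
Qed.

Lemma Bergman_add f g : Bergman f -> Bergman g -> Bergman (fun z => f z + g z).
Proof.
move=> /BergmanE[hf fi] /BergmanE[hg gi].
have ui := rintZ 2 measurable_disk1 (rintD measurable_disk1 fi gi).
apply: (Bergman_dom (holo_add hf hg) ui) => z z1.
apply: (@le_trans _ _ ((cabs (f z) + cabs (g z)) ^+ 2)).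
  by rewrite lerXn2r ?nnegrE ?addr_ge0 ?cabs_ge0// cabsD.
have := sqr_ge0 (cabs (f z) - cabs (g z)).
by rewrite sqrrB sqrrD; lra.
Qed.

Lemma Bergman_scale c f : Bergman f -> Bergman (fun z => c * f z).
Proof. by move=> hf; apply: (Bergman_mul hf (holo_cst c) (M := cabs c)) => z _. Qed.

Lemma Bergman_sum (I : Type) (s : seq I) (F : I -> C -> C) : (forall i, Bergman (F i)) ->
  Bergman (fun z => \sum_(i <- s) F i z).
Proof.
move=> h; elim: s => [|i s IH].
  rewrite (_ : (fun z => _) = fun=> 0); last by apply/funext => z; rewrite big_nil.
  by apply: (@Bergman_bounded _ 0 (holo_cst 0)) => z _; rewrite cabs0.
rewrite (_ : (fun z => _) = fun z => F i z + \sum_(j <- s) F j z).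
  exact: Bergman_add.
by apply/funext => z; rewrite big_cons.
Qed.

(* |m f conj(h)| <= (M / 2) (|f|^2 + |h|^2) *)
Lemma cint_Bergman (m : C -> C) f h (M : R) : Bergman f -> Bergman h ->
  (forall z, cabs z < 1 -> ccont m z) -> (forall z, cabs z < 1 -> cabs (m z) <= M) ->
  cint (disk 1) (fun z => m z * f z * Num.conj (h z)).
Proof.
move=> /BergmanE[hf fi] /BergmanE[hh hi] cm mM.
have ui := rintZ (M / 2) measurable_disk1 (rintD measurable_disk1 fi hi).
apply: cint_dom ui _ => z z1.
  exact: (ccontM (ccontM (cm _ z1) (holo_ccont hf z1)) (ccont_conj (holo_ccont hh z1))).
rewrite !cabsM cabs_conj -mulrA mulrAC -mulrA; apply: ler_pM; rewrite ?mulr_ge0 ?cabs_ge0 ?mM//.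
rewrite ler_pdivlMr//.
have := sqr_ge0 (cabs (f z) - cabs (h z)); rewrite sqrrB; lra.
Qed.

Lemma innerD_eq0 (u h : C -> C) :
  innerD u h = 0 <-> cI (disk 1) (fun z => u z * Num.conj (h z)) = 0.
Proof.
rewrite /innerD integD_cI; have p0 : (pi%:C)%C != 0 :> C.
  by apply/negP => /eqP[] /eqP; rewrite gt_eqF// pi_gt0.
split=> [/eqP|->]; last by rewrite mul0r.
by rewrite mulf_eq0 invr_eq0 (negbTE p0) orbF => /eqP.
Qed.

(* With F = z G, this is <conj(z) F' - r^2 G', h> = 0 on the disk of radius r. *)
Lemma stokes_shift (G h : C -> C) (r : R) : 0 < r < 1 -> holo G -> holo h ->
  cI (disk r) (fun z => Num.conj z * (G z + z * cd G z) * Num.conj (h z)) =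
  (r ^+ 2)%:C%C * cI (disk r) (fun z => cd G z * Num.conj (h z)).
Proof.
move=> /andP[r0 r1] hG hh; have mD := @measurable_disk R r.
have hG1 := holo_derive hG; have hh1 := holo_derive hh.
have lt1 z : cabs z <= r -> cabs z < 1 by move=> h'; exact: le_lt_trans r1.
have S := stokes_conj r0 (fun z zr => holo_cd hG (lt1 z zr)) (fun z zr => holo_cd hh (lt1 z zr))
  (fun z zr => holo_ccont hG1 (lt1 z zr)) (fun z zr => holo_ccont hh1 (lt1 z zr)).
have i1 : cint (disk r) (fun z => cd G z * Num.conj (h z)).
  apply: (cint_ccont (ltW r0)) => z /lt1 z1.
  exact: ccontM (holo_ccont hG1 z1) (ccont_conj (holo_ccont hh z1)).
have i2 : cint (disk r) (fun z => Num.conj z * (G z + z * cd G z) * Num.conj (h z)).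
  apply: (cint_ccont (ltW r0)) => z /lt1 z1.
  exact: (ccontM (ccontM (ccont_conj (@ccont_id R z)) (ccontD (holo_ccont hG z1)
    (ccontM (@ccont_id R z) (holo_ccont hG1 z1)))) (ccont_conj (holo_ccont hh z1))).
rewrite -cIZ//; apply/eqP; rewrite -subr_eq0 -cIB//; last exact: cintZ.
apply/eqP; rewrite -[RHS]S; apply: cI_ext => p _.
move: (toC p) => z; move: (cd G z) (G z) (Num.conj (h z)) => a b c.
ring.
Qed.

(* The m = 0 moment gives f 0 = 0; dividing by z shifts the moments, so f is divisible by
   every power of z. *)
Lemma moments_tend0 f : holo f -> (forall m, tends (fun n => moment (rr R n) f m) 0) ->
  forall z, cabs z < 1 -> f z = 0.
Proof.
move=> hf V; have z1 : cabs (0 : C) < 1 by rewrite cabs0.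
have step g : holo g -> (forall m, tends (fun n => moment (rr R n) g m) 0) ->
    exists2 g1, holo g1 /\ (forall z, cabs z < 1 -> g z = z * g1 z) &
      forall m, tends (fun n => moment (rr R n) g1 m) 0.
  move=> hg Vg.
  have g0 : g 0 = 0.
    apply: eps_half => e e0.
    have a0 : 0 < area (rr R 0) by apply: area_gt0; have /andP[] := rr01 R 0.
    have /tendsP /(_ _ (mulr_gt0 e0 a0))[N hN] := Vg 0%N.
    have := hN (maxn N 0) (leq_maxl _ _); set n := maxn N 0; rewrite subr0.
    have -> : moment (rr R n) g 0 = g 0 * (area (rr R n))%:C%C.
      rewrite -holo_mean ?rr01//; apply: cI_ext => p _.
      by rewrite expr0 conj1 mulr1.
    have an : area (rr R 0) <= area (rr R n).
      apply: le_area; rewrite (ltW (andP (rr01 R 0)).1)/= /rr lerD2l lerN2.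
      by rewrite lef_pV2 ?posrE ?ltr0n// ler_nat.
    rewrite cabsM cabs_real ger0_norm ?(le_trans (ltW a0) an)// => h.
    rewrite -(ler_pM2r a0); apply: le_trans h; rewrite ler_wpM2l ?cabs_ge0//.
  have [g1 hg1 gg1] := holo_div hg z1 g0.
  have gE z : cabs z < 1 -> g z = z * g1 z by move=> /gg1; rewrite subr0.
  exists g1 => // m; apply/tendsP => e e0.
  have /tendsP /(_ _ (divr_gt0 e0 (ltr0n R 8)))[N hN] := Vg m.+1.
  exists N => n /hN; rewrite !subr0.
  have r01 := rr01 R n; have /andP[rb _] := rr_bound R n.
  have -> : moment (rr R n) g m.+1 = moment (rr R n) (fun z => z * g1 z) m.+1.
    apply: cI_ext => p /(diskE _ (ltW (andP r01).1)) pr; rewrite gE//.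
    exact: lt_trans (andP r01).2.
  rewrite moment_mulX//= !cabsM cabsV !cabs_nat cabs_real => h.
  (* Here 1/8 is the product of 1/2 and 1/4, from (m + 1) / (m + 2) >= 1/2 and r_n^2 >= 1/4: the
     moments of [g1] are controlled by those of [g]. *)
  have c1 : 8^-1 <= m.+1%:R / m.+2%:R * `|rr R n ^+ 2|.
    rewrite ger0_norm ?sqr_ge0//.
    have a1 : 2^-1 <= m.+1%:R / m.+2%:R :> R.
      rewrite ler_pdivlMr ?ltr0n// -(natr1 m.+1) mulrDr.
      have : (1 : R) <= m.+1%:R by rewrite ler1n. by lra.
    have a2 : 4^-1 <= rr R n ^+ 2.
      have -> : (4^-1 : R) = 2^-1 ^+ 2 by field.
      by rewrite lerXn2r ?nnegrE ?invr_ge0// (le_trans _ rb).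
    have -> : (8^-1 : R) = 2^-1 * 4^-1 by field.
    by apply: ler_pM.
  have := ler_wpM2r (cabs_ge0 (moment (rr R n) g1 m)) c1 => h2.
  by have := le_trans h2 h; rewrite mulrC ler_pdivlMr//; lra.
apply: holo_mulXn_eq0 => // k.
suff [g [hg fg] _] : exists2 g, holo g /\ (forall z, cabs z < 1 -> f z = z ^+ k * g z) &
   forall m, tends (fun n => moment (rr R n) g m) 0 by exists g.
elim: k => [|k [g [hg fg] hV]].
  by exists f => //; split=> // z _; rewrite expr0 mul1r.
have [g1 [hg1 gg1] V1] := step g hg hV.
by exists g1 => //; split=> // z zz; rewrite fg// gg1// exprSr mulrA.
Qed.
End Eigen.

(** * The eigenvalue equation as a differential equation *)

Section EigenODE.
Variable R : realType.
Local Notation C := (complex R).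
Local Notation mD1 := (@measurable_disk1 R).

Let lt1 (r : R) (z : C) : r < 1 -> cabs z <= r -> cabs z < 1.
Proof. by move=> r1 h; exact: le_lt_trans r1. Qed.

Let conj_bound (z : C) : cabs z < 1 -> cabs (Num.conj z) <= 1.
Proof. by rewrite cabs_conj => /ltW. Qed.

Let ccont_conj_id (z : C) : ccont (fun z : C => Num.conj z) z.
Proof. exact: ccont_conj (@ccont_id R z). Qed.

Let primitive_shift (F f : C -> C) : F 0 = 0 -> (forall z, cabs z < 1 -> cder F z (f z)) ->
  exists2 G, holo G & forall z, cabs z < 1 -> F z = z * G z /\ f z = G z + z * cd G z.
Proof.
move=> F0 dF; have hF : holo F by move=> z /dF h; exists (f z).
have z1 : cabs (0 : C) < 1 by rewrite cabs0.
have [G hG FG] := holo_div hF z1 F0; exists G => // z zz.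
have FG' w : cabs w < 1 -> F w = w * G w by move=> /FG; rewrite subr0.
split; first exact: FG'.
have d : cder (fun w => w * G w) z (G z + z * cd G z).
  by apply: cder_eq (cderM (cder_id z) (holo_cd hG zz)) _; rewrite mul1r.
apply: (cder_unique (dF z zz)); apply: cder_ext d.
by have [s s0 hs] := near_disk zz; exists s => // w /hs w1; rewrite FG'.
Qed.

(** With F = z G and f = G + z G', [stokes_shift] makes conj(z) f act on test functions like r^2 G'.
    The eigenvalue equation thus says G' = (lam - p) f, and z (f - z G') = z G = F is the
    differential equation. *)
Lemma eigen_ode (p : C -> C) (lam : C) (M : R) (f : C -> C) :
  holo p -> (forall z, cabs z < 1 -> cabs (p z) <= M) -> Bergman f ->
  TmL (fun z => Num.conj z + p z) lam f (fun=> 0) ->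
  exists F, [/\ F 0 = 0, forall z, cabs z < 1 -> cder F z (f z) &
    forall z, cabs z < 1 -> z * (1 + z * (p z - lam)) * f z = F z].
Proof.
move=> hp pM bf [t [[bt orth] t0]].
have hf := Bergman_holo bf.
have tE z : cabs z < 1 -> t z = lam * f z.
  by move=> /inD_cabs /t0 /esym/eqP; rewrite subr_eq0 => /eqP.
have [F [F0 dF]] := holo_primitive hf.
exists F; split => //.
have [G hG FG] := primitive_shift F0 dF.
have hG1 := holo_derive hG.
pose psi z := (lam - p z) * f z.
have hq : holo (fun z => lam - p z) by apply: holo_sub => //; exact: holo_cst.
have hpsi : holo psi by exact: holo_mul hq hf.
have qM z : cabs z < 1 -> cabs (lam - p z) <= cabs lam + M.
  by move=> z1; apply: le_trans (cabsB _ _) _; rewrite lerD2l pM.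
have bpsi : Bergman psi by exact: Bergman_mul bf hq qM.
suff E : forall z, cabs z < 1 -> cd G z = psi z.
  move=> z z1; have [-> ->] := FG _ z1.
  have := E _ z1; rewrite /psi => e; have := FG _ z1; case=> _ fE.
  rewrite -fE; have -> : z * (1 + z * (p z - lam)) * f z = z * (f z - z * ((lam - p z) * f z)) by ring.
  by rewrite -e fE addrK.
suff V : forall z, cabs z < 1 -> cd G z - psi z = 0.
  by move=> z /V/eqP; rewrite subr_eq0 => /eqP.
have hd : holo (fun z => cd G z - psi z) by exact: holo_sub.
apply: (moments_tend0 hd) => m.
pose h (z : C) := z ^+ m.
have hh : holo h by exact: holo_exp (@holo_id R).
have bh : Bergman h.
  apply: (@Bergman_bounded _ _ 1 hh) => z /ltW z1; rewrite /h cabsX.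
  by rewrite exprn_ile1// cabs_ge0.
have i1 : cint (disk 1) (fun z => Num.conj z * f z * Num.conj (h z)).
  by apply: (cint_Bergman bf bh (M := 1)) => z z1; [exact: ccont_conj_id|exact: conj_bound].
have i2 : cint (disk 1) (fun z => psi z * Num.conj (h z)).
  apply: cint_ext (cint_Bergman bf bh (fun z z1 => holo_ccont hq z1) qM); first exact: mD1.
  by [].
(* Orthogonality to z^m, with the Toeplitz image of f replaced by lam f. *)
have E0 : cI (disk 1) (fun z => Num.conj z * f z * Num.conj (h z)) =
    cI (disk 1) (fun z => psi z * Num.conj (h z)).
  apply/eqP; rewrite -subr_eq0 -(cIB mD1 i1 i2).
  have /innerD_eq0 <- := orth h bh; apply/eqP; apply: cI_ext => p' /(diskE _ ler01) z1.
  by rewrite tE// /psi; ring.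
have r01 n := rr01 R n.
have mD n := @measurable_disk R (rr R n).
have key n : moment (rr R n) (fun z => cd G z - psi z) m =
   cI (disk (rr R n)) (fun z => Num.conj z * f z * Num.conj (h z)) / (rr R n ^+ 2)%:C%C -
   cI (disk (rr R n)) (fun z => psi z * Num.conj (h z)).
  have /andP[r0 r1] := r01 n.
  have ii g : holo g -> cint (disk (rr R n)) (fun z => g z * Num.conj (h z)).
    move=> hg; apply: (cint_ccont (ltW r0)) => z /(lt1 r1) z1.
    exact: ccontM (holo_ccont hg z1) (ccont_conj (holo_ccont hh z1)).
  have r20 : (rr R n ^+ 2)%:C%C != 0 :> C.
    by apply/negP => /eqP[] /eqP; rewrite expf_eq0/= gt_eqF.
  have -> : cI (disk (rr R n)) (fun z => Num.conj z * f z * Num.conj (h z)) =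
     (rr R n ^+ 2)%:C%C * cI (disk (rr R n)) (fun z => cd G z * Num.conj (h z)).
    rewrite -stokes_shift//; apply: cI_ext => p' /(diskE _ (ltW r0)) /ltW /(lt1 r1) z1.
    by have [_ <-] := FG _ z1.
  rewrite mulrC mulKf// /moment -cIB//; [|exact: ii|exact: ii].
  by apply: cI_ext => p' _; rewrite mulrBl.
apply: (tends_ext (fun n => esym (key n))).
have a1 := cI_cutoff i1; have a2 := cI_cutoff i2.
have inv : tends (fun n => ((rr R n ^+ 2)%:C%C)^-1) 1^-1.
  by apply: cvgV; [exact: oner_neq0|exact: tends_rr2].
have := tendsB (tendsM a1 inv) a2.
by rewrite invr1 mulr1 E0 subrr.
Qed.

(** The computation of [eigen_ode] read backwards, against every Bergman function h: lam f is the
    projection of the symbol times f because conj(z) f and (lam - p) f have the same pairings in the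
    limit r -> 1. *)
Lemma ode_eigen (p : C -> C) (lam : C) (M : R) (f F : C -> C) :
  holo p -> (forall z, cabs z < 1 -> cabs (p z) <= M) -> Bergman f ->
  F 0 = 0 -> (forall z, cabs z < 1 -> cder F z (f z)) ->
  (forall z, cabs z < 1 -> z * (1 + z * (p z - lam)) * f z = F z) ->
  TmL (fun z => Num.conj z + p z) lam f (fun=> 0).
Proof.
move=> hp pM bf F0 dF ode; have hf := Bergman_holo bf.
exists (fun z => lam * f z); split; last by move=> z _; rewrite subrr.
split; first exact: Bergman_scale.
have [G hG FG] := primitive_shift F0 dF.
have hG1 := holo_derive hG.
have hq : holo (fun z => lam - p z) by apply: holo_sub => //; exact: holo_cst.
have qM z : cabs z < 1 -> cabs (lam - p z) <= cabs lam + M.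
  by move=> z1; apply: le_trans (cabsB _ _) _; rewrite lerD2l pM.
have hpsi : holo (fun z => (lam - p z) * f z) by exact: holo_mul.
have hl : holo (fun z => (1 + z * (p z - lam)) * f z).
  apply: holo_mul => //; apply: holo_add; first exact: holo_cst.
  apply: holo_mul; first exact: holo_id.
  by apply: holo_sub => //; exact: holo_cst.
have GE z : cabs z < 1 -> (1 + z * (p z - lam)) * f z = G z.
  apply: (holo_mulI hl hG (a := 0)) => w w1; rewrite subr0 mulrA ode//.
  by have [-> _] := FG _ w1.
have dG z : cabs z < 1 -> cd G z = (lam - p z) * f z.
  apply: (holo_mulI hG1 hpsi (a := 0)) => w w1; rewrite subr0.
  have [_ fE] := FG _ w1; have := GE _ w1.
  have -> : w * cd G w = f w - G w by rewrite fE addrC addKr.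
  by move=> <-; ring.
move=> h bh; apply/innerD_eq0; have hh := Bergman_holo bh.
have i1 : cint (disk 1) (fun z => Num.conj z * f z * Num.conj (h z)).
  by apply: (cint_Bergman bf bh (M := 1)) => z z1; [exact: ccont_conj_id|exact: conj_bound].
have i2 := cint_Bergman bf bh (fun z z1 => holo_ccont hq z1) qM.
rewrite (@cI_ext _ _ _ (fun z => Num.conj z * f z * Num.conj (h z) - (lam - p z) * f z * Num.conj (h z))); last first.
  by move=> p' _; ring.
rewrite (cIB mD1 i1 i2).
apply/eqP; rewrite subr_eq0; apply/eqP.
apply: (tends_unique (cI_cutoff i1)).
have := tendsM (@tends_rr2 R) (cI_cutoff i2); rewrite mul1r; apply: tends_ext => n.
have /andP[r0 r1] := rr01 R n.
rewrite (@cI_ext _ _ (fun z => (lam - p z) * f z * Num.conj (h z)) (fun z => cd G z * Num.conj (h z))); last first.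
  by move=> p' /(diskE _ (ltW r0)) /ltW /(lt1 r1) /dG ->.
rewrite -stokes_shift ?r0//.
apply: cI_ext => p' /(diskE _ (ltW r0)) /ltW /(lt1 r1) z1.
by have [_ <-] := FG _ z1.
Qed.
End EigenODE.

(** * Vanishing order of solutions and finiteness of zeros *)

Section Zeros.
Variable R : realType.
Local Notation C := (complex R).
Implicit Types (f g F q Q E : C -> C).

Lemma holo_mulXI f g a k : holo f -> holo g ->
  (forall z, cabs z < 1 -> (z - a) ^+ k * f z = (z - a) ^+ k * g z) ->
  forall z, cabs z < 1 -> f z = g z.
Proof.
elim: k f g => [|k IH] f g hf hg fg.
  by move=> z /fg; rewrite expr0 !mul1r.
have hza : holo (fun z => z - a) by apply: holo_sub; [exact: holo_id|exact: holo_cst].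
apply: (holo_mulI hf hg (a := a)); apply: IH.
- exact: holo_mul.
- exact: holo_mul.
- by move=> z /fg; rewrite exprSr !mulrA.
Qed.

Lemma cder_subX (a z : C) k : cder (fun w => (w - a) ^+ k) z (k%:R * (z - a) ^+ k.-1).
Proof.
by apply: cder_eq (cderX k (cderB (cder_id z) (cder_cst a z))) _; rewrite subr0 mulr1.
Qed.

(* Comparing vanishing orders at a on both sides of z q F' = F: if F vanishes to
   order exactly k at a, then k a q'(a) = 1. *)
Lemma ode_order q F f a : holo q -> cabs a < 1 -> a != 0 -> q a = 0 ->
  (forall z, cabs z < 1 -> cder F z (f z)) ->
  (forall z, cabs z < 1 -> z * q z * f z = F z) ->
  (exists2 z, cabs z < 1 & F z != 0) ->
  exists k : nat, k%:R * (a * cd q a) = 1.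
Proof.
move=> hq a1 a0 qa dF ode [z0 z01 Fz0].
apply: contrapT => nex.
have hF : holo F by move=> z /dF h; exists (f z).
have [Q hQ qQ] := holo_div hq a1 qa.
have dq : cd q a = Q a.
  apply: cd_eq; apply: (cder_ext (f := fun z => (z - a) * Q z)).
    by have [s s0 hs] := near_disk a1; exists s => // w /hs /qQ.
  apply: cder_eq (cderM (cderB (cder_id a) (cder_cst a a)) (holo_cd hQ a1)) _.
  by rewrite subrr mul0r subr0 mul1r addr0.
suff h k : exists2 E, holo E & forall z, cabs z < 1 -> F z = (z - a) ^+ k * E z.
  by have := holo_infinite_order hF a1 a0 h z01; move/eqP; rewrite (negbTE Fz0).
elim: k => [|k [E hE FE]]; first by exists F => // z _; rewrite expr0 mul1r.
have hE1 := holo_derive hE.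
have fE z : cabs z < 1 -> f z = k%:R * (z - a) ^+ k.-1 * E z + (z - a) ^+ k * cd E z.
  move=> z1; apply: (cder_unique (dF z z1)).
  apply: cder_ext (cderM (cder_subX a z k) (holo_cd hE z1)).
  by have [s s0 hs] := near_disk z1; exists s => // w /hs /FE.
have hza : holo (fun z => z - a) by apply: holo_sub; [exact: holo_id|exact: holo_cst].
have hl : holo (fun z => z * Q z * (k%:R * E z + (z - a) * cd E z)).
  apply: holo_mul; first by apply: holo_mul => //; exact: holo_id.
  by apply: holo_add; apply: holo_mul => //; exact: holo_cst.
(* This is z q F' = F divided by (z - a)^k. At z = a it reads k a q'(a) E(a) = E(a), so E(a) = 0
   when no k fits. *)
have key z : cabs z < 1 -> z * Q z * (k%:R * E z + (z - a) * cd E z) = E z.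
  apply: (holo_mulXI (a := a) (k := k) hl hE) => w w1.
  rewrite -FE// -ode// qQ// fE//.
  case: (k) => [|m]; first by rewrite !mul0r !expr0; ring.
  by rewrite /= exprS; ring.
have Ea : E a = 0.
  have := key a a1; rewrite subrr mul0r addr0 -dq.
  have -> : a * cd q a * (k%:R * E a) = k%:R * (a * cd q a) * E a by ring.
  move=> /eqP; rewrite -subr_eq0 -{2}[E a]mul1r -mulrBl mulf_eq0 => /orP[|/eqP//].
  by rewrite subr_eq0 => /eqP h; case: nex; exists k.
have [E1 hE1' EE1] := holo_div hE a1 Ea.
by exists E1 => // z z1; rewrite FE// EE1// exprSr mulrA.
Qed.

Definition bounded_below q (rho d : R) :=
  [/\ 0 < rho < 1, 0 < d & forall z, rho <= cabs z < 1 -> d <= cabs (q z)].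

(** All zeros lie in |z| <= rho, where their number is bounded; if no finite list exhausted them,
    lists of every length could be built. *)
Lemma finite_zeros q (M rho d : R) : bounded_holo q M -> q 0 = 1 -> bounded_below q rho d ->
  exists2 s : seq C, uniq s & forall z, (cabs z < 1 /\ q z = 0) <-> z \in s.
Proof.
move=> qM q0 [/andP[rho0 rho1] d0 hd].
have zr z : cabs z < 1 -> q z = 0 -> cabs z <= rho.
  move=> z1 qz; rewrite leNgt; apply/negP => /ltW h.
  by have := hd z; rewrite h z1 qz cabs0 => /(_ isT); rewrite leNgt d0.
have r01 : 0 <= rho < 1 by rewrite ltW.
have [N hN] := holo_zeros_bounded qM q0 r01.
pose zs (s : seq C) := uniq s /\ forall a, a \in s -> cabs a < 1 /\ q a = 0.
have [[s [us hs] max]|h] := pselect (exists2 s, zs s & forall z, cabs z < 1 -> q z = 0 -> z \in s).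
  by exists s => // z; split=> [[]|/hs//]; exact: max.
have big n : exists2 s, zs s & size s = n.
  elim: n => [|n [s [us hs] sn]]; first by exists [::].
  have [z [z1 qz zs']] : exists z, [/\ cabs z < 1, q z = 0 & z \notin s].
    apply: contrapT => nex; apply: h; exists s => // z z1 qz.
    by apply: contrapT => /negP zs'; apply: nex; exists z.
  exists (z :: s); last by rewrite /= sn.
  split; first by rewrite /= zs'.
  by move=> a; rewrite in_cons => /orP[/eqP ->|/hs].
have [s [us hs] sN] := big N.+1.
have := hN s us (fun a as_ => conj (zr _ (hs a as_).1 (hs a as_).2) (hs a as_).2).
by rewrite sN ltnn.
Qed.
End Zeros.

(** * The complex exponential *)

Section ComplexExponential.
Variable R : realType.
Local Notation C := (complex R).

Definition cexp (z : C) : C :=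
  Complex (expR (complex.Re z) * cos (complex.Im z)) (expR (complex.Re z) * sin (complex.Im z)).

Lemma cexpD (z w : C) : cexp (z + w) = cexp z * cexp w.
Proof.
case: z w => [a b] [c d]; rewrite /cexp /= expRD cosD sinD; simpc.
by congr Complex; ring.
Qed.
Lemma cexp0 : cexp 0 = 1.
Proof. by rewrite /cexp /= expR0 cos0 sin0 mulr1 mulr0. Qed.
Lemma cabs_cexp (z : C) : cabs (cexp z) = expR (complex.Re z).
Proof.
apply/eqP; rewrite -(@eqrXn2 _ 2) ?cabs_ge0 ?expR_ge0//.
by rewrite -sqn_cabs /sqn /= !exprMn -mulrDr cos2Dsin2 mulr1.
Qed.
Lemma cexp_neq0 (z : C) : cexp z != 0.
Proof. by rewrite -cabs_gt0 cabs_cexp expR_gt0. Qed.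

Let rder_cexp (h : C) (t : R) : rder (fun t : R => cexp (t%:C%C * h)) t (h * cexp (t%:C%C * h)).
Proof.
case: h => a b.
have E (s : R) : cexp (s%:C%C * Complex a b) =
  Complex (expR (s * a) * cos (s * b)) (expR (s * a) * sin (s * b)).
  by rewrite /cexp; simpc.
have da : is_derive t 1 (fun s : R => s * a) a.
  by apply: is_derive_eq; rewrite /GRing.scale /= mulr0 add0r mulr1.
have db : is_derive t 1 (fun s : R => s * b) b.
  by apply: is_derive_eq; rewrite /GRing.scale /= mulr0 add0r mulr1.
have de : is_derive t 1 (fun s : R => expR (s * a)) (expR (t * a) * a).
  exact: (@is_derive1_comp R expR (fun s => s * a) t _ _ (is_derive_expR (t * a)) da).
have dc : is_derive t 1 (fun s : R => cos (s * b)) (- sin (t * b) * b).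
  exact: (@is_derive1_comp R cos (fun s => s * b) t _ _ (is_derive_cos (t * b)) db).
have ds : is_derive t 1 (fun s : R => sin (s * b)) (cos (t * b) * b).
  exact: (@is_derive1_comp R sin (fun s => s * b) t _ _ (is_derive_sin (t * b)) db).
have scE (x y : R) : x *: (y : R^o) = x * y by [].
split; rewrite E; (under eq_fun do rewrite E); simpc.
  by apply: is_derive_eq; rewrite ?scE /=; ring.
by apply: is_derive_eq; rewrite ?scE /=; ring.
Qed.

(** The functional equation reduces the claim to a quadratic bound on exp(h) - 1 - h, obtained from
    two mean value estimates along the segment from 0 to h. *)
Lemma cder_cexp (z : C) : cder cexp z (cexp z).
Proof.
apply: (@cder_quad _ _ _ _ (cabs (cexp z) * (4 * expR 1)) 1 ltr01) => h h1.
rewrite cexpD (_ : cexp z * cexp h - cexp z - cexp z * h = cexp z * (cexp h - 1 - h)); last by ring.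
rewrite cabsM -mulrA; apply: ler_wpM2l; first exact: cabs_ge0.
have bnd (t : R) : 0 <= t <= 1 -> cabs (cexp (t%:C%C * h)) <= expR 1.
  move=> /andP[t0 t1]; rewrite cabs_cexp ler_expR.
  apply: le_trans (ler_norm _) _; apply: le_trans (cabs_Re _) _.
  rewrite cabsM cabs_real ger0_norm//; apply: le_trans (ltW h1).
  by rewrite ler_piMl// cabs_ge0.
have e1 : 0 <= expR 1 :> R by exact: expR_ge0.
have first (s : R) : 0 <= s <= 1 -> cabs (cexp (s%:C%C * h) - 1) <= 2 * (expR 1 * cabs h).
  move=> /andP[s0 s1].
  have := @rder_MVI R (fun t : R => cexp (t%:C%C * h)) (fun t : R => h * cexp (t%:C%C * h)) 0 s (expR 1 * cabs h) s0.
  rewrite mul0r cexp0 subr0 => H; apply: (@le_trans _ _ (2 * (expR 1 * cabs h) * s)).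
    apply: H => t /andP[t0 ts]; first exact: rder_cexp.
    rewrite cabsM mulrC ler_wpM2r ?cabs_ge0// bnd// t0 /=; exact: le_trans s1.
  by rewrite ler_piMr// !mulr_ge0// cabs_ge0.
have rid (t : R) : rder (fun s : R => s%:C%C * h) t h.
  by have := rder_line (cder_id (0 + t%:C%C * h)); rewrite mul1r;
    under eq_fun do rewrite add0r.
have := @rder_MVI R (fun t : R => cexp (t%:C%C * h) - t%:C%C * h)
  (fun t : R => h * cexp (t%:C%C * h) - h) 0 1 (2 * (expR 1 * cabs h) * cabs h) ler01.
rewrite !mul0r cexp0 mul1r subr0 subr0 mulr1 => H.
have -> : cexp h - 1 - h = cexp h - h - 1 by ring.
have -> : 4 * expR 1 * cabs h ^+ 2 = 2 * (2 * (expR 1 * cabs h) * cabs h) by ring.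
apply: H => t t01; first by apply: rderB; [exact: rder_cexp|exact: rid].
have -> : h * cexp (t%:C%C * h) - h = (cexp (t%:C%C * h) - 1) * h by ring.
by rewrite cabsM ler_wpM2r ?cabs_ge0// first.
Qed.
End ComplexExponential.

(** * Construction of an eigenfunction *)

Section EigenfunctionConstruction.
Variable R : realType.
Local Notation C := (complex R).
Implicit Types (f g F q : C -> C) (s : seq C) (k : C -> nat).

Definition bholo f := exists M : R, bounded_holo f M.

Lemma bholo_holo f : bholo f -> holo f.
Proof. by case=> M []. Qed.
Lemma bholo_cst c : bholo (fun=> c).
Proof. by exists (cabs c); split=> // ; exact: holo_cst. Qed.
Lemma bholo_id : bholo id.
Proof. by exists 1; split=> [|z /ltW//]; exact: holo_id. Qed.
Lemma bholo_add f g : bholo f -> bholo g -> bholo (fun z => f z + g z).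
Proof.
move=> [M [hf fM]] [N [hg gN]]; exists (M + N); split; first exact: holo_add.
by move=> z z1; apply: le_trans (cabsD _ _) _; apply: lerD; [exact: fM|exact: gN].
Qed.
Lemma bholo_mul f g : bholo f -> bholo g -> bholo (fun z => f z * g z).
Proof.
move=> [M [hf fM]] [N [hg gN]]; exists (M * N); split; first exact: holo_mul.
by move=> z z1; rewrite cabsM ler_pM ?cabs_ge0// ?fM ?gN.
Qed.
Lemma bholo_opp f : bholo f -> bholo (fun z => - f z).
Proof.
move=> /(bholo_mul (bholo_cst (-1)))[M [hf fM]]; exists M; split => [|z z1].
  by apply: holo_ext hf => z _; rewrite mulN1r.
by rewrite -mulN1r fM.
Qed.
Lemma bholo_sub f g : bholo f -> bholo g -> bholo (fun z => f z - g z).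
Proof. by move=> bf bg; apply: bholo_add => //; exact: bholo_opp. Qed.
Lemma bholo_subX a n : bholo (fun z => (z - a) ^+ n).
Proof.
elim: n => [|n IH]; first by under eq_fun do rewrite expr0; exact: bholo_cst.
under eq_fun do rewrite exprS; apply: bholo_mul IH.
by apply: bholo_sub; [exact: bholo_id|exact: bholo_cst].
Qed.
Lemma bholo_prodX s k : bholo (fun z => \prod_(a <- s) (z - a) ^+ k a).
Proof.
elim: s => [|a s IH]; first by under eq_fun do rewrite big_nil; exact: bholo_cst.
by under eq_fun do rewrite big_cons; apply: bholo_mul IH; exact: bholo_subX.
Qed.
Lemma bholo_prod s : bholo (fun z => \prod_(a <- s) (z - a)).
Proof. by have := bholo_prodX s (fun=> 1%N); under eq_fun do under eq_bigr do rewrite expr1. Qed.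

(* The numerator of the logarithmic derivative: with T the product of the (z - a)^(k a),
   T'/T = wsum k s z / \prod_(a <- s) (z - a). *)
Fixpoint wsum k s (z : C) : C :=
  if s is a :: s' then (k a)%:R * \prod_(b <- s') (z - b) + (z - a) * wsum k s' z else 0.

Lemma bholo_wsum k s : bholo (wsum k s).
Proof.
elim: s => [|a s IH] /=; first exact: bholo_cst.
apply: bholo_add; apply: bholo_mul => //; try exact: bholo_cst; first exact: bholo_prod.
by apply: bholo_sub; [exact: bholo_id|exact: bholo_cst].
Qed.

Lemma cder_prodX k s : exists T' : C -> C, [/\ bholo T',
  forall z, cder (fun z => \prod_(a <- s) (z - a) ^+ k a) z (T' z) &
  forall z, T' z * \prod_(a <- s) (z - a) = \prod_(a <- s) (z - a) ^+ k a * wsum k s z].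
Proof.
elim: s => [|a s [T' [bT' dT' T'E]]].
  exists (fun=> 0); split=> [|z|z]; first exact: bholo_cst.
    by under eq_fun do rewrite big_nil; exact: cder_cst.
  by rewrite mul0r mulr0.
exists (fun z => (k a)%:R * (z - a) ^+ (k a).-1 * \prod_(b <- s) (z - b) ^+ k b + (z - a) ^+ k a * T' z).
split=> [|z|z].
- apply: bholo_add; apply: bholo_mul => //; last exact: bholo_subX; last exact: bholo_prodX.
  by apply: bholo_mul; [exact: bholo_cst|exact: bholo_subX].
- by under eq_fun do rewrite big_cons; exact: cderM (cder_subX a z (k a)) (dT' z).
- rewrite !big_cons /= mulrDl.
  rewrite (_ : (z - a) ^+ k a * T' z * _ =
    (z - a) ^+ k a * (z - a) * (T' z * \prod_(j <- s) (z - j))); last by ring.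
  rewrite T'E; case: (k a) => [|n]; first by rewrite !mul0r !expr0; ring.
  by rewrite /= !exprS; ring.
Qed.

(** At a root the factor z - a removes every summand except that of a itself, which is proportional
    to its weight. For k = 1 the value is the derivative of the product. *)
Lemma wsum_root k s a : a \in s -> wsum k s a = (k a)%:R * wsum (fun=> 1%N) s a.
Proof.
elim: s => [//|b s IH]; rewrite in_cons /=; case: (eqVneq a b) => [<- _|_ /= as_].
  by rewrite subrr !mul0r !addr0 mul1r.
by rewrite (big_rem a as_) /= subrr mul0r !mulr0 !add0r IH// mulrCA.
Qed.

Lemma cder_prod s z : cder (fun z => \prod_(a <- s) (z - a)) z (wsum (fun=> 1%N) s z).
Proof.
elim: s => [|a s IH]; first by under eq_fun do rewrite big_nil; exact: cder_cst.
under eq_fun do rewrite big_cons.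
by apply: cder_eq (cderM (cderB (cder_id z) (cder_cst a z)) IH) _; rewrite /= subr0.
Qed.

(** With q = Pi Q, F = z T exp(H) and H' = B / Q, the equation F' / F = 1 / (z q) becomes z Pi B = 1
    - q - z Q S. The right side must vanish at 0, where q = 1, and at each zero a, where the
    hypothesis on [k] gives a Q(a) S(a) = 1. *)
Lemma eigenfunction_exists q k s (M rho d : R) : bounded_holo q M -> q 0 = 1 ->
  bounded_below q rho d -> uniq s ->
  (forall z, (cabs z < 1 /\ q z = 0) <-> z \in s) ->
  (forall a, a \in s -> (k a)%:R * (a * cd q a) = 1) ->
  exists f F, [/\ Bergman f, f 0 != 0, F 0 = 0, forall z, cabs z < 1 -> cder F z (f z) &
    forall z, cabs z < 1 -> z * q z * f z = F z].
Proof.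
move=> qM q0 [/andP[rho0 rho1] d0 qd] us sE kE.
have s1 a : a \in s -> cabs a < 1 /\ q a = 0 by move=> /sE.
have [Q [QM [QB qQ]]] := bounded_holo_div_seq qM us s1.
have bQ : bholo Q by exists QM.
pose Pi z := \prod_(a <- s) (z - a); pose T z := \prod_(a <- s) (z - a) ^+ k a.
pose S := wsum k s.
have [T' [bT' dT T'E]] := cder_prodX k s.
have bPi : bholo Pi := bholo_prod s.
have Pi0 a : a \in s -> Pi a = 0 by move=> h; rewrite /Pi (big_rem a h) /= subrr mul0r.
have rootE a : a \in s -> a * Q a * S a = 1.
  move=> as_; have [a1 _] := s1 a as_; rewrite -(kE a as_) /S wsum_root//.
  suff -> : cd q a = wsum (fun=> 1%N) s a * Q a by ring.
  apply: cd_eq; apply: (cder_ext (f := fun z => Pi z * Q z)).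
    by have [e e0 he] := near_disk a1; exists e => // w /he /qQ.
  apply: cder_eq (cderM (cder_prod s a) (holo_cd (bholo_holo bQ) a1)) _.
  by rewrite -/(Pi a) Pi0// mul0r addr0.
have Q0 z : cabs z < 1 -> Q z != 0.
  move=> z1; apply/eqP => Qz; have /rootE : z \in s by apply/sE; rewrite qQ// Qz mulr0.
  by rewrite Qz mulr0 mul0r => /esym /eqP; rewrite oner_eq0.
have T0 z : cabs z < 1 -> q z != 0 -> T z != 0.
  move=> z1 qz; rewrite prodf_seq_neq0; apply/allP => a as_ /=.
  rewrite expf_neq0// subr_eq0; apply: contra_neq qz => ->; exact: (s1 a as_).2.
have bS : bholo S := bholo_wsum k s.
have [NM bN] : bholo (fun z => 1 - q z - z * Q z * S z).
  apply: bholo_sub; first by apply: bholo_sub; [exact: bholo_cst|exists M].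
  by apply: bholo_mul bS; apply: bholo_mul bQ; exact: bholo_id.
have s0 : 0 \notin s by apply/negP => /s1 [_]; rewrite q0 => /eqP; rewrite oner_eq0.
have [||B [BM [BB NB]]] := bounded_holo_div_seq bN (s := 0 :: s).
- by rewrite /= s0.
- move=> a; rewrite in_cons => /orP[/eqP ->|as_].
    by rewrite cabs0 ltr01 q0; split => //; ring.
  by have [a1 qa] := s1 a as_; split => //; rewrite qa rootE//; ring.
have bB : bholo B by exists BM.
(* By compactness for |z| <= rho, where [Q] has no zero; nearer the circle because |q| >= d while
   [Pi] is bounded. *)
have [m m0 Qm] : exists2 m : R, 0 < m & forall z, cabs z < 1 -> m <= cabs (Q z).
  have [m m0 hm] := ccont_lbounded (ltW rho0)
    (fun z h => holo_ccont (bholo_holo bQ) (le_lt_trans h rho1)) (fun z h => Q0 z (le_lt_trans h rho1)).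
  have [PM [_ hP]] := bPi.
  have P0 : 0 < PM + 1.
    by apply: ltr_wpDl => //; apply: le_trans (hP 0 _); rewrite ?cabs_ge0// cabs0.
  exists (Order.min m (d / (PM + 1))) => [|z z1]; first by rewrite lt_min m0 divr_gt0.
  rewrite ge_min; case: (leP (cabs z) rho) => [/hm -> //|/ltW zr]; apply/orP; right.
  rewrite ler_pdivrMr//; apply: le_trans (qd z _) _; first by rewrite zr.
  rewrite qQ// cabsM mulrC; apply: ler_wpM2l; first exact: cabs_ge0.
  by apply: le_trans (hP z z1) _; rewrite lerDl.
have bQi : bholo (fun z => (Q z)^-1).
  exists m^-1; split=> [|z z1]; first exact: holo_inv Q0 (bholo_holo bQ).
  by rewrite cabsV lef_pV2 ?posrE ?Qm// cabs_gt0 Q0.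
have bW : bholo (fun z => B z / Q z) by exact: bholo_mul.
have [H [H0 dH]] := holo_primitive (bholo_holo bW).
have [WM [_ hW]] := bW.
have W0 : 0 <= WM by apply: le_trans (hW 0 _); rewrite ?cabs_ge0// cabs0.
(* H is bounded because H' is; this keeps the eigenfunction bounded and thus in the Bergman
   space. *)
have beH : bholo (fun z => cexp (H z)).
  exists (expR (2 * WM)); split=> [z z1|z z1].
    by eexists; exact: cder_comp (cder_cexp (H z)) (dH z z1).
  rewrite cabs_cexp ler_expR; apply: le_trans (ler_norm _) _; apply: le_trans (cabs_Re _) _.
  have seg (t : R) : 0 <= t <= 1 -> cabs (0 + t%:C%C * (z - 0)) < 1.
    move=> /andP[t0 t1]; rewrite add0r subr0 cabsM cabs_real ger0_norm//.
    by apply: le_lt_trans z1; rewrite ler_piMl// cabs_ge0.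
  have := @cder_MVI R H (fun z => B z / Q z) 0 z WM (fun t h => dH _ (seg t h)) (fun t h => hW _ (seg t h)).
  rewrite H0 !subr0 => h; apply: le_trans h _.
  by rewrite ler_piMr ?mulr_ge0// ltW.
have bT : bholo T := bholo_prodX s k.
exists (fun z => (T z + z * T' z + z * T z * (B z / Q z)) * cexp (H z)).
exists (fun z => z * T z * cexp (H z)); split.
- have [N [hN fN]] : bholo (fun z => (T z + z * T' z + z * T z * (B z / Q z)) * cexp (H z)).
    apply: bholo_mul beH; apply: bholo_add.
      by apply: bholo_add bT _; apply: bholo_mul bT'; exact: bholo_id.
    by apply: bholo_mul bW; apply: bholo_mul bT; exact: bholo_id.
  exact: Bergman_bounded hN fN.
- by rewrite !mul0r !addr0 mulf_neq0// ?cexp_neq0// T0 ?cabs0// q0 oner_eq0.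
- by rewrite !mul0r.
- move=> z z1.
  apply: cder_eq (cderM (cderM (cder_id z) (dT z)) (cder_comp (cder_cexp (H z)) (dH z z1))) _.
  by rewrite /= -/(T z); move: (T z) (T' z) (B z / Q z) (cexp (H z)) => t t' b e; ring.
- move=> z z1; have Qz := Q0 z z1.
  have N := NB z z1; rewrite big_cons subr0 -/(Pi z) in N.
  have qz := qQ z z1; rewrite -/(Pi z) in qz; rewrite qz in N *.
  have T'z := T'E z; rewrite -/(Pi z) -/(T z) -/(S z) in T'z.
  move: N T'z Qz.
  move: (Pi z) (T z) (T' z) (S z) (Q z) (B z) (cexp (H z)) => P t t' S' Q' B' e N T'z Qz.
  have -> : z * (P * Q') * ((t + z * t' + z * t * (B' / Q')) * e) =
    z * e * (P * Q' * t + z * Q' * (t' * P) + t * (z * P * B') * (Q' / Q')) by ring.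
  by rewrite T'z -N divff//; ring.
Qed.
End EigenfunctionConstruction.

(** * Symbols vanishing at a boundary point *)

Section BergmanSeries.
Variable R : realType.
Local Notation C := (complex R).
Local Notation TR := (measurableTypeR R).
Local Notation mu := (@lebesgue_measure R \x @lebesgue_measure R)%E.
Implicit Types (f g h : C -> C).

Definition nrm2 f : R := rI (disk 1) (fun z => cabs (f z) ^+ 2).

Lemma nrm2_ge0 f : 0 <= nrm2 f.
Proof. by apply: rI_ge0 => p _; exact: sqr_ge0. Qed.

Lemma rI_EFin (A : set (TR * TR)) (u : C -> R) : measurable A -> rint A u ->
  (rI A u)%:E = (\int[mu]_(p in A) (u (toC p))%:E)%E.
Proof. by move=> mA iu; rewrite /rI /Rintegral fineK//; exact: integrable_fin_num iu. Qed.

Lemma rint_subset (A B : set (TR * TR)) (u : C -> R) : measurable A -> measurable B ->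
  A `<=` B -> rint B u -> rint A u.
Proof. by move=> mA mB AB; apply: integrableS. Qed.

Lemma rI_subset (A B : set (TR * TR)) (u : C -> R) : measurable A -> measurable B ->
  A `<=` B -> rint B u -> (forall z, 0 <= u z) -> rI A u <= rI B u.
Proof.
move=> mA mB AB iu u0; rewrite -lee_fin !rI_EFin//; last exact: rint_subset iu.
by apply: ge0_subset_integral => //; [exact: measurable_int iu|move=> p _; rewrite lee_fin].
Qed.

Lemma rint_monotone (A : set (TR * TR)) (u_ : nat -> C -> R) (u : C -> R) (B : R) :
  measurable A -> (forall n, rint A (u_ n)) -> (forall n z, 0 <= u_ n z) ->
  (forall z, {homo u_ ^~ z : n m / (n <= m)%N >-> n <= m}) ->
  (forall p, A p -> (fun n => u_ n (toC p)) @ \oo --> u (toC p)) ->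
  (forall n, rI A (u_ n) <= B) -> rint A u.
Proof.
move=> mA iu_ u0 ndu uu uB.
have mu_ n : measurable_fun A (fun p => (u_ n (toC p))%:E) := measurable_int mu (iu_ n).
have mr n : measurable_fun A (u_ n \o @toC R).
  by apply/measurable_EFinP; exact: mu_.
have u0' p : A p -> 0 <= u (toC p).
  move=> Ap; have h := uu p Ap; rewrite -(cvg_lim _ h)//; apply: limr_ge.
    by apply/cvg_ex; eexists; exact: h.
  by apply: nearW => n; exact: u0.
apply/integrableP; split.
  by apply/measurable_EFinP; apply: (measurable_fun_cvg mr) => p /uu.
have := @cvg_monotone_convergence _ _ _ mu A mA (fun n p => (u_ n (toC p))%:E) mu_
  (fun n p _ => u0 n _) (fun p _ n m nm => ndu _ n m nm).
have -> : (\int[mu]_(p in A) limn (fun n => (u_ n (toC p))%:E) =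
           \int[mu]_(p in A) `|(EFin \o (u \o @toC R)) p|)%E.
  apply: eq_integral => p /set_mem Ap; rewrite /= ger0_norm ?u0'//.
  by apply/cvg_lim => //; apply: cvg_EFin (uu p Ap); apply: nearW.
move=> h; apply: (@le_lt_trans _ _ B%:E); last exact: ltry.
rewrite -(cvg_lim _ h)//; apply: lime_le; first by apply/cvg_ex; eexists; exact: h.
by apply: nearW => n; rewrite -rI_EFin// lee_fin.
Qed.

Lemma bker_ge (rho r : R) (w z : C) : 0 <= r -> cabs w <= rho -> cabs z <= r ->
  r ^+ 2 - rho * r <= cabs (bker r w z).
Proof.
move=> r0 wr zr; have := cabs_dist (r ^+ 2)%:C%C (Num.conj w * z).
rewrite -/(bker r w z) cabs_real cabsM cabs_conj => h; apply: le_trans (le_trans (ler_norm _) h).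
by apply: lerB; [exact: ler_norm|apply: ler_pM; rewrite ?cabs_ge0].
Qed.

(** Bergman's formula bounds |h(w)| by an integral of |h|; the inequality |h| <= t + |h|^2 / t plays
    the part of Cauchy-Schwarz, with t fixed at the end. *)
Lemma Bergman_point_bound (rho : R) : 0 <= rho < 1 -> exists2 K : R, 0 < K &
  forall h w, Bergman h -> cabs w <= rho -> cabs (h w) ^+ 2 <= K * nrm2 h.
Proof.
move=> /andP[rho0 rho1]; set r := (1 + rho) / 2.
have r0 : 0 < r by rewrite /r; lra.
have r1 : r < 1 by rewrite /r; lra.
have rr : rho < r by rewrite /r; lra.
set b := r ^+ 2 - rho * r.
have b0 : 0 < b by rewrite /b expr2 -mulrBl mulr_gt0// subr_gt0.
have a0 := area_gt0 r0.
have A0 : 0 < r ^+ 4 / area r by rewrite divr_gt0// exprn_gt0.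
have mD := @measurable_disk R r.
set K := r ^+ 4 / area r * (2 * ((area r + 1) / b ^+ 2)).
have K0 : 0 < K.
  by apply: mulr_gt0 A0 _; apply: mulr_gt0 => //; apply: divr_gt0; [rewrite ltr_wpDl// ltW|exact: exprn_gt0].
exists (4 * K ^+ 2) => [|h w bh wr]; first by rewrite mulr_gt0// exprn_gt0.
have /BergmanE[hh ih] := bh.
have wr' := le_lt_trans wr rr.
have lt1 z : cabs z <= r -> cabs z < 1 by move=> h'; exact: le_lt_trans r1.
have sub : disk r `<=` disk 1 by apply: subset_disk; rewrite (ltW r0) (ltW r1).
have ihr : rint (disk r) (fun z => cabs (h z) ^+ 2).
  exact: rint_subset mD (@measurable_disk1 R) sub ih.
have X0 := nrm2_ge0 h; set X := nrm2 h in X0 *.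
have key (t : R) : 0 < t -> cabs (h w) <= K * (t + X / t).
  move=> t0.
  have := @bergman_formula R h (cd h) (cd (cd h)) r w r0 wr' (fun z zr => holo_cd hh (lt1 z zr))
    (fun z zr => holo_cd (holo_derive hh) (lt1 z zr))
    (fun z zr => holo_ccont (holo_derive (holo_derive hh)) (lt1 z zr)).
  move: (h w) => x ->.
  rewrite cabsM cabs_real ger0_norm ?(ltW A0)// /K -[X in _ <= X]mulrA; apply: ler_wpM2l; first exact: ltW.
  have iu := rintZ (b ^- 2) mD (rintD mD (rint_cst r t) (rintZ t^-1 mD ihr)).
  apply: le_trans (@cI_le R (disk r) _ _ mD _ iu _) _.
  - apply: (cint_ccont (ltW r0)) => z zr; apply: ccontM (holo_ccont hh (lt1 z zr)) _.
    apply/ccont_conj/ccontX/ccontV; first exact: bker_neq0.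
    exact: (ccontB (@ccont_cst R _ z) (ccontM (@ccont_cst R _ z) (@ccont_id R z))).
  - move=> p /(diskE _ (ltW r0)) /ltW zr; move: (toC p) zr => z zr.
    rewrite cabsM cabs_conj cabsX cabsV mulrC exprVn; apply: ler_pM; rewrite ?invr_ge0 ?exprn_ge0 ?cabs_ge0//.
      rewrite lef_pV2 ?posrE ?exprn_gt0 ?cabs_gt0 ?bker_neq0//.
      by rewrite lerXn2r ?nnegrE ?cabs_ge0 ?(ltW b0)//; apply: bker_ge => //; exact: ltW.
    move: (cabs (h z)) (cabs_ge0 (h z)) => y y0.
    rewrite -subr_ge0 (_ : _ - _ = ((y - t) ^+ 2 + y * t) / t); last by field; rewrite gt_eqF.
    by rewrite divr_ge0 ?addr_ge0 ?sqr_ge0 ?mulr_ge0// ltW.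
  rewrite -mulrA; apply: ler_wpM2l => //.
  rewrite rIZ//; last by apply: rintD => //; [exact: rint_cst|exact: rintZ].
  rewrite rID//; [|exact: rint_cst|exact: rintZ].
  rewrite rIZ// rI_cst [_ / _ * _]mulrAC [X in _ <= X]mulrC; apply: ler_wpM2l.
    by rewrite invr_ge0 exprn_ge0// ltW.
  have XX : rI (disk r) (fun z => cabs (h z) ^+ 2) <= X.
    by apply: rI_subset => // z; exact: sqr_ge0.
  have : t^-1 * rI (disk r) (fun z => cabs (h z) ^+ 2) <= X / t.
    by rewrite mulrC; apply: ler_wpM2r => //; rewrite invr_ge0 ltW.
  have : 0 <= X / t by rewrite divr_ge0// ltW.
  move: (X / t) (t^-1 * _) => Y Z Y0 ZY; have := mulr_ge0 (ltW a0) Y0; nra.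
have := cabs_ge0 (h w); rewrite le_eqVlt => /orP[/eqP <-|]; 
  first by rewrite expr0n; apply: mulr_ge0 => //; apply: mulr_ge0 => //; exact: sqr_ge0.
move: (cabs (h w)) key => a key a1.
(* This choice of t makes the term K t half of |h(w)|, which the left side absorbs. *)
have := key (a / (2 * K)) (divr_gt0 a1 (mulr_gt0 (ltr0n _ 2) K0)).
rewrite (_ : K * (a / (2 * K) + X / (a / (2 * K))) = a / 2 + 2 * K ^+ 2 * X / a); last first.
  by field; rewrite !gt_eqF.
move=> h2; have : a / 2 <= 2 * K ^+ 2 * X / a by lra.
by rewrite ler_pdivlMr// => h3; rewrite expr2; lra.
Qed.
End BergmanSeries.

(** * Series with geometric bounds *)

Section DyadicSeries.
Variable R : realType.
Local Notation C := (complex R).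
Implicit Types (f g h : C -> C).
Local Notation hf := (2^-1 : R).

Let half_ge0 : 0 <= hf. Proof. by rewrite invr_ge0. Qed.

(** The partial sums plus and minus 2 K 2^-n form a decreasing and an increasing sequence that
    enclose the limit. *)
Lemma dyadic_series_real (u : nat -> R) (K : R) : (forall j, `|u j| <= K * hf ^+ j) ->
  exists l, forall n, `|\sum_(j < n) u j - l| <= 2 * K * hf ^+ n.
Proof.
move=> uK; pose s n := \sum_(j < n) u j.
pose a n := s n + 2 * K * hf ^+ n; pose b n := s n - 2 * K * hf ^+ n.
have ndb n : b n <= b n.+1.
  have := uK n; rewrite ler_norml => /andP[h1 _].
  by rewrite /b /s big_ord_recr /= exprS; lra.
have nia n : a n.+1 <= a n.
  have := uK n; rewrite ler_norml => /andP[_ h1].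
  by rewrite /a /s big_ord_recr /= exprS; lra.
have K0 : 0 <= K by have := le_trans (normr_ge0 _) (uK 0%N); rewrite expr0 mulr1.
have ba n : b n <= a n.
  by rewrite /a /b; have := mulr_ge0 K0 (exprn_ge0 n half_ge0); lra.
have ndb' : {homo b : n m / (n <= m)%N >-> n <= m} by apply/nondecreasing_seqP.
have nia' : {homo a : n m / (n <= m)%N >-> m <= n}.
  by move=> n m nm; apply/(nonincreasing_seqP _).1.
have bam n m : b n <= a m.
  apply: le_trans (ndb' _ _ (leq_maxl n m)) _; apply: le_trans (ba _) _.
  exact: nia' _ _ (leq_maxr n m).
exists (sup (range b)) => n.
have h1 : b n <= sup (range b).
  by apply: ub_le_sup; [exists (a 0%N) => _ [m _ <-]|exists n].
have h2 : sup (range b) <= a n.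
  by apply: ge_sup; [exists (b 0%N), 0%N|move=> _ [m _ <-]].
by rewrite ler_norml; move: h1 h2; rewrite /a /b -/(s n); lra.
Qed.

Lemma dyadic_small (K e : R) : 0 <= K -> 0 < e -> exists N, forall n, (N <= n)%N -> K * hf ^+ n <= e.
Proof.
move=> K0 e0; have h01 : 0 <= hf < 1 by lra.
have [N hN] := exp_small h01 (divr_gt0 e0 (ltr_wpDl K0 ltr01)).
exists N => n /hN; rewrite ler_pdivlMr ?ltr_wpDl// => h; apply: le_trans h.
by rewrite mulrC ler_wpM2l ?exprn_ge0//; lra.
Qed.

Lemma dyadic_tends (u : nat -> C) (l : C) (K : R) :
  (forall n, cabs (u n - l) <= K * hf ^+ n) -> tends u l.
Proof.
move=> h; apply/tendsP => e e0.
have K0 : 0 <= K by have := le_trans (cabs_ge0 _) (h 0%N); rewrite expr0 mulr1.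
by have [N hN] := dyadic_small K0 e0; exists N => n /hN; apply: le_trans.
Qed.

Lemma dyadic_series (u : nat -> C) (K : R) : (forall j, cabs (u j) <= K * hf ^+ j) ->
  exists l, forall n, cabs (\sum_(j < n) u j - l) <= 4 * K * hf ^+ n.
Proof.
move=> uK.
have [|a ha] := @dyadic_series_real (fun j => complex.Re (u j)) K.
  by move=> j; apply: le_trans (uK j); exact: cabs_Re.
have [|b hb] := @dyadic_series_real (fun j => complex.Im (u j)) K.
  by move=> j; apply: le_trans (uK j); exact: cabs_Im.
have ReS n : complex.Re (\sum_(j < n) u j) = \sum_(j < n) complex.Re (u j).
  by elim: n => [|n IH]; rewrite ?big_ord0// !big_ord_recr /= ReD IH.
have ImS n : complex.Im (\sum_(j < n) u j) = \sum_(j < n) complex.Im (u j).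
  by elim: n => [|n IH]; rewrite ?big_ord0// !big_ord_recr /= ImD IH.
exists (Complex a b) => n; apply: le_trans (cabs_le_ReIm _) _.
by rewrite ReB ImB ReS ImS /=; have := ha n; have := hb n; lra.
Qed.

Lemma ccont_dyadic_limit (G : nat -> C -> C) g (rho K : R) (z : C) : cabs z < rho ->
  (forall n, ccont (G n) z) ->
  (forall n w, cabs w <= rho -> cabs (G n w - g w) <= K * hf ^+ n) -> ccont g z.
Proof.
move=> zr cG hG; apply/ccontP => e e0.
have K0 : 0 <= K by have := le_trans (cabs_ge0 _) (hG 0%N z (ltW zr)); rewrite expr0 mulr1.
have e4 : 0 < e / 4 by rewrite divr_gt0.
have [N /(_ N (leqnn N)) hN] := dyadic_small K0 e4.
have /ccontP /(_ _ e4) [d d0 hd] := cG N.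
have [d' d'0 hd'] := near_disk zr.
exists (Order.min d d'); first by rewrite lt_min d0.
move=> w; rewrite lt_min => /andP[/hd w1 /hd' w2].
rewrite (_ : g w - g z = (G N w - G N z) - (G N w - g w) + (G N z - g z)); last by ring.
have h1 := hG N w (ltW w2); have h2 := hG N z (ltW zr).
apply: le_lt_trans (cabsD _ _) _; apply: le_lt_trans (lerD (cabsB _ _) (lexx _)) _.
by lra.
Qed.

(** Weierstrass' theorem: Bergman's formula passes to the locally uniform limit, and its right side
    is differentiable in w. *)
Lemma holo_dyadic_limit (G : nat -> C -> C) g : (forall n, holo (G n)) ->
  (forall rho : R, 0 <= rho < 1 -> exists K : R, forall n w, cabs w <= rho ->
    cabs (G n w - g w) <= K * hf ^+ n) -> holo g.
Proof.
move=> hG hK w w1; set r := (1 + cabs w) / 2; have w0 := cabs_ge0 w.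
have r0 : 0 < r by rewrite /r; lra.
have r1 : r < 1 by rewrite /r; lra.
have wr : cabs w < r by rewrite /r; lra.
have mD := @measurable_disk R r.
have lt1 z : cabs z <= r -> cabs z < 1 by move=> h; exact: le_lt_trans r1.
have cg z : cabs z <= r -> ccont g z.
  move=> zr; have [|K hK'] := hK ((1 + r) / 2); first by lra.
  apply: (@ccont_dyadic_limit G g ((1 + r) / 2) K z); [by lra| |exact: hK'].
  by move=> n; exact: holo_ccont (lt1 z zr).
have [|K hKr] := hK r; first by rewrite (ltW r0).
pose c : C := (r ^+ 4 / area r)%:C%C.
pose I (u : C -> C) v := cI (disk r) (fun z => u z * Num.conj ((bker r v z)^-1 ^+ 2)).
have gE v : cabs v < r -> c * I g v = g v.
  move=> vr.
  have ck z : cabs z <= r -> ccont (fun z => Num.conj ((bker r v z)^-1 ^+ 2)) z.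
    move=> zr; apply/ccont_conj/ccontX/ccontV; first exact: bker_neq0.
    exact: (ccontB (@ccont_cst R _ z) (ccontM (@ccont_cst R _ z) (@ccont_id R z))).
  have [L L0 hL] := ccont_bounded (ltW r0) ck.
  apply: (@tends_unique R (fun n => c * I (G n) v)).
    apply: (@tendsM R (fun=> c) (fun n => I (G n) v) c (I g v) (@tends_cst R c)).
    apply: (@dyadic_tends _ _ (2 * (K * L) * area r)) => n.
    have cGk : forall z, cabs z <= r -> ccont (fun z => G n z * Num.conj ((bker r v z)^-1 ^+ 2)) z.
      by move=> z zr; exact: ccontM (holo_ccont (hG n) (lt1 z zr)) (ck z zr).
    have cgk : forall z, cabs z <= r -> ccont (fun z => g z * Num.conj ((bker r v z)^-1 ^+ 2)) z.
      by move=> z zr; exact: ccontM (cg z zr) (ck z zr).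
    rewrite /I -cIB//; [|exact: (cint_ccont (ltW r0))|exact: (cint_ccont (ltW r0))].
    rewrite (_ : 2 * (K * L) * area r * hf ^+ n = 2 * (K * hf ^+ n * L) * area r); last by ring.
    apply: (cI_bounded (ltW r0)) => z /ltW zr.
      exact: (ccontB (cGk z zr) (cgk z zr)).
    by rewrite -mulrBl cabsM; apply: ler_pM; rewrite ?cabs_ge0// ?hKr// hL.
  apply: (tends_ext (u := fun n => G n v)).
    move=> n; exact: (@bergman_formula R (G n) (cd (G n)) (cd (cd (G n))) r v r0 vr
      (fun z zr => holo_cd (hG n) (lt1 z zr))
      (fun z zr => holo_cd (holo_derive (hG n)) (lt1 z zr))
      (fun z zr => holo_ccont (holo_derive (holo_derive (hG n))) (lt1 z zr))).
  by apply: (@dyadic_tends _ _ K) => n; apply: hKr; exact: ltW.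
have := cderM (cder_cst c w) (cder_cauchy_integral 2 r0 wr cg).
move=> h; eexists; apply: cder_ext h.
by have [s s0 hs] := near_disk wr; exists s => // v /hs /gE.
Qed.
End DyadicSeries.

(** * Series of Bergman functions *)

Section OrthogonalSeries.
Variable R : realType.
Local Notation C := (complex R).
Implicit Types (f g h : C -> C).
Local Notation hf := (2^-1 : R).

(* Iterates |a + b|^2 <= 2 |a|^2 + 2 |b|^2. *)
Lemma cabs_sum_sqr (y : nat -> C) n :
  cabs (\sum_(j < n) y j) ^+ 2 <= \sum_(j < n) 2 ^+ j.+1 * cabs (y j) ^+ 2.
Proof.
elim: n y => [|n IH] y; first by rewrite !big_ord0 cabs0 expr0n.
have {IH} := IH (fun j => y j.+1).
have -> : \sum_(j < n.+1) y j = y 0%N + \sum_(j < n) y j.+1 by rewrite big_ord_recl.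
have -> : \sum_(j < n.+1) 2 ^+ j.+1 * cabs (y j) ^+ 2 =
    2 * cabs (y 0%N) ^+ 2 + 2 * \sum_(j < n) 2 ^+ j.+1 * cabs (y j.+1) ^+ 2.
  rewrite big_ord_recl expr1 mulr_sumr; congr (_ + _); apply: eq_bigr => j _.
  by rewrite /= /bump /= add1n exprS mulrA.
move: (\sum_(j < n) 2 ^+ j.+1 * cabs (y j.+1) ^+ 2) (\sum_(j < n) y j.+1) => S s h.
have := cabsD (y 0%N) s; have := cabs_ge0 (y 0%N + s).
move: (cabs (y 0%N + s)) (cabs (y 0%N)) (cabs s) h => p q r h p0 pqr.
have := sqr_ge0 (q - r); have : p ^+ 2 <= (q + r) ^+ 2 by rewrite lerXn2r ?nnegrE// (le_trans p0).
by nra.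
Qed.

(** The function u = sum of 2^-j |e_j|^2 is integrable by monotone convergence. Since |b_j|^2 <=
    4^-j, the weights of [cabs_sum_sqr] give |G_n|^2 <= 2 u for the partial sums, so their pairings
    converge by dominated convergence. *)
Lemma Bergman_series (e : nat -> C -> C) (b : nat -> C) :
  (forall j, Bergman (e j)) -> (forall j, nrm2 (e j) <= 1) ->
  (forall j, cabs (b j) <= hf ^+ j) ->
  exists2 g, Bergman g & forall h, Bergman h ->
    tends (fun n => cI (disk 1) (fun z => (\sum_(j < n) b j * e j z) * Num.conj (h z)))
          (cI (disk 1) (fun z => g z * Num.conj (h z))).
Proof.
move=> be ne bb; have mD := @measurable_disk R 1.
have hf0 n : 0 <= hf ^+ n by rewrite exprn_ge0// invr_ge0.
pose G n z := \sum_(j < n) b j * e j z.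
pose U n z := \sum_(j < n) hf ^+ j * cabs (e j z) ^+ 2.
have pt (rho : R) : 0 <= rho < 1 -> exists2 K : R, 0 < K & forall j z, cabs z <= rho ->
    cabs (e j z) ^+ 2 <= K.
  move=> h; have [K K0 hK] := Bergman_point_bound h; exists K => // j z zr.
  by apply: le_trans (hK _ _ (be j) zr) _; rewrite ler_piMr// ltW.
have ptb (rho : R) : 0 <= rho < 1 -> exists K : R, forall j z, cabs z <= rho ->
    cabs (b j * e j z) <= K * hf ^+ j.
  move=> /pt[K K0 hK]; exists (K + 1) => j z /(hK j) h; rewrite cabsM mulrC.
  apply: ler_pM; rewrite ?cabs_ge0//.
  by move: (cabs (e j z)) (cabs_ge0 (e j z)) h => x x0 h; nra.
have z01 z : cabs z < 1 -> 0 <= cabs z < 1 by move=> ->; rewrite cabs_ge0.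
have [g hg] : {g : C -> C & forall z, cabs z < 1 -> tends (G ^~ z) (g z)}.
  apply: (@choice C C (fun z l => cabs z < 1 -> tends (G ^~ z) l)) => z.
  have [/z01 /ptb [K hK]|] := boolP (cabs z < 1); last by exists 0.
  have [l hl] := dyadic_series (fun j => hK j z (lexx _)).
  by exists l => _; exact: dyadic_tends hl.
have hloc (rho : R) : 0 <= rho < 1 -> exists K : R, forall n w, cabs w <= rho ->
    cabs (G n w - g w) <= K * hf ^+ n.
  move=> r01; have [K hK] := ptb _ r01; exists (4 * K) => n w wr.
  have [l hl] := dyadic_series (fun j => hK j w wr).
  rewrite (@tends_unique _ (G ^~ w) (g w) l) ?hl//; last exact: dyadic_tends hl.
  by apply: hg; case/andP: r01 => _; exact: le_lt_trans.
have bG n : Bergman (G n).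
  by apply: (@Bergman_sum R _ (index_enum _) (fun (j : 'I_n) z => b j * e j z)) => j; exact: Bergman_scale.
have hgh := holo_dyadic_limit (fun n => Bergman_holo (bG n)) hloc.
have [u hu] : {u : C -> R & forall z, cabs z < 1 -> (fun n => U n z) @ \oo --> u z}.
  apply: (@choice C R (fun z l => cabs z < 1 -> (fun n => U n z) @ \oo --> l)) => z.
  have [/z01 /pt [K K0 hK]|] := boolP (cabs z < 1); last by exists 0.
  have [|l hl] := @dyadic_series_real R (fun j => hf ^+ j * cabs (e j z) ^+ 2) K.
    move=> j; have x0 := mulr_ge0 (hf0 j) (sqr_ge0 (cabs (e j z))).
    by rewrite (ger0_norm x0) mulrC; apply: ler_wpM2r (hK j z (lexx _)); exact: hf0.
  exists l => _; apply/cvgrPdist_le => d d0.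
  have [N hN] := dyadic_small (mulr_ge0 (ler0n _ 2) (ltW K0)) d0.
  by exists N => // n /hN h; rewrite distrC; apply: le_trans (hl n) h.
have ndU z : {homo U ^~ z : n m / (n <= m)%N >-> n <= m}.
  apply/nondecreasing_seqP => n; rewrite /U big_ord_recr /= lerDl.
  by rewrite mulr_ge0 ?sqr_ge0.
have iU n : rint (disk 1) (U n) /\ rI (disk 1) (U n) <= 2 - 2 * hf ^+ n.
  elim: n => [|n [i1 i2]].
    have -> : U 0%N = fun=> 0 by apply/funext => z; rewrite /U big_ord0.
    by split; [exact: rint_cst|rewrite rI_cst mul0r expr0; lra].
  have -> : U n.+1 = fun z => U n z + hf ^+ n * cabs (e n z) ^+ 2.
    by apply/funext => z; rewrite /U big_ord_recr.
  have /BergmanE[_ ie] := be n; have ie' := rintZ (hf ^+ n) mD ie.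
  split; first exact: rintD.
  rewrite rID// rIZ//.
  have : hf ^+ n * nrm2 (e n) <= hf ^+ n by rewrite ler_piMr.
  by rewrite exprS /nrm2; lra.
have iu : rint (disk 1) u.
  apply: (@rint_monotone _ _ U u 2) => //.
  - by move=> n; exact: (iU n).1.
  - by move=> n z; apply: sumr_ge0 => j _; rewrite mulr_ge0 ?sqr_ge0.
  - by move=> p /(diskE _ ler01) /hu.
  - by move=> n; apply: le_trans (iU n).2 _; rewrite lerBlDr lerDl mulr_ge0.
have Uu n z : cabs z < 1 -> U n z <= u z.
  move=> /hu h; rewrite -(cvg_lim _ h)//; apply: nondecreasing_cvgn_le => //.
  by apply/cvg_ex; eexists; exact: h.
have Gu n z : cabs z < 1 -> cabs (G n z) ^+ 2 <= 2 * u z.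
  move=> z1; apply: le_trans (cabs_sum_sqr (fun j => b j * e j z) n) _.
  apply: (@le_trans _ _ (2 * U n z)); last by rewrite ler_wpM2l// Uu.
  rewrite /U mulr_sumr; apply: ler_sum => j _.
  rewrite cabsM exprMn [X in X <= _]mulrA [X in _ <= X]mulrA; apply: ler_wpM2r; first exact: sqr_ge0.
  rewrite exprS -mulrA; apply: ler_wpM2l => //.
  have h : cabs (b j) ^+ 2 <= (hf ^+ j) ^+ 2 by rewrite lerXn2r ?nnegrE ?cabs_ge0.
  apply: le_trans (ler_wpM2l (exprn_ge0 j (ler0n R 2)) h) _.
  by rewrite [(hf ^+ j) ^+ 2]expr2 mulrA -exprMn divff// expr1n mul1r.
have gu z : cabs z < 1 -> cabs (g z) ^+ 2 <= 2 * u z.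
  move=> z1; have [h1 h2] := tends_Re (hg z z1).
  have E (x : C) : cabs x ^+ 2 = complex.Re x * complex.Re x + complex.Im x * complex.Im x.
    by rewrite -sqn_cabs /sqn !expr2.
  have {h1 h2}h : (fun n => cabs (G n z) ^+ 2) @ \oo --> cabs (g z) ^+ 2.
    rewrite E; under eq_fun do rewrite E.
    by apply: cvgD; apply: cvgM.
  rewrite -(cvg_lim _ h)//; apply: limr_le; first by apply/cvg_ex; eexists; exact: h.
  by apply: nearW => n; exact: Gu.
have bg : Bergman g := Bergman_dom hgh (rintZ 2 mD iu) gu.
exists g => // h bh; have /BergmanE[hh ih] := bh.
have ch z : cabs z < 1 -> ccont (fun z => Num.conj (h z)) z.
  by move=> z1; apply: ccont_conj; exact: holo_ccont z1.
have [|||||_ hI] := @cI_dct R (fun n z => G n z * Num.conj (h z)) (fun z => g z * Num.conj (h z))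
  (fun z => 2 * u z + cabs (h z) ^+ 2).
- by move=> n z z1; exact: ccontM (holo_ccont (Bergman_holo (bG n)) z1) (ch z z1).
- by move=> z z1; exact: ccontM (holo_ccont hgh z1) (ch z z1).
- by move=> z z1; apply: tendsM (hg z z1) (@tends_cst R _).
- exact: rintD (rintZ 2 mD iu) ih.
- move=> n z z1; rewrite cabsM cabs_conj; have := Gu n z z1.
  move: (cabs (G n z)) (cabs (h z)) => x y xu; have := sqr_ge0 (x - y); nra.
exact: hI.
Qed.
End OrthogonalSeries.

(** * Polynomials concentrating at a boundary point *)

Section TestFunctions.
Variable R : realType.
Local Notation C := (complex R).
Implicit Types (f g h : C -> C) (P Q : {poly C}).

Lemma bholo_poly P : bholo (fun z : C => P.[z]).
Proof.
elim/poly_ind: P => [|P c IH]; first by under eq_fun do rewrite horner0; exact: bholo_cst.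
under eq_fun do rewrite hornerMXaddC.
exact: (bholo_add (bholo_mul IH (@bholo_id R)) (bholo_cst c)).
Qed.

Lemma Bergman_poly P : Bergman (fun z : C => P.[z]).
Proof. by have [M [hP bP]] := bholo_poly P; exact: Bergman_bounded hP bP. Qed.

Lemma moment_mulXn (r : R) h N k : 0 < r < 1 -> holo h -> (k < N)%N ->
  moment r (fun z => z ^+ N * h z) k = 0.
Proof.
move=> r01 hh; elim: N k => [//|N IH] k kN.
have -> : (fun z => z ^+ N.+1 * h z) = fun z => z * (z ^+ N * h z).
  by apply/funext => z; rewrite exprS mulrA.
rewrite moment_mulX//; last by apply: holo_mul => //; apply: holo_exp; exact: holo_id.
case: k kN => [|k] kN; first by rewrite mul0r mul0r mul0r.
by rewrite IH// mulr0.
Qed.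

(** On radii r < 1 the moments of z^N Q of index below N vanish; then r tends to 1. *)
Lemma poly_orthogonal P Q N : (size P <= N)%N ->
  cI (disk 1) (fun z : C => ('X^N * Q).[z] * Num.conj P.[z]) = 0.
Proof.
move=> PN; have hQ : holo (fun z => Q.[z]) := bholo_holo (bholo_poly Q).
have E : (fun z : C => ('X^N * Q).[z] * Num.conj P.[z]) =
    fun z => \sum_(i < size P) Num.conj P`_i * ((z ^+ N * Q.[z]) * Num.conj (z ^+ i)).
  apply/funext => z; rewrite hornerM hornerXn (horner_coef P z) rmorph_sum mulr_sumr.
  by apply: eq_bigr => i _; rewrite rmorphM mulrCA.
have hN : holo (fun z => z ^+ N * Q.[z]).
  by apply: holo_mul => //; apply: holo_exp; exact: holo_id.
have i1 : cint (disk 1) (fun z : C => ('X^N * Q).[z] * Num.conj P.[z]).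
  have := @cint_Bergman R (fun=> 1) _ _ 1 (Bergman_poly ('X^N * Q)) (Bergman_poly P).
  under [X in cint _ X]eq_fun do rewrite mul1r.
  by apply=> z z1; [exact: ccont_cst|rewrite cabs1].
apply: tends_unique (cI_cutoff i1) _.
apply: (tends_ext (u := fun=> 0)); last exact: tends_cst.
move=> n; have /andP[r0 r1] := rr01 R n; have mD := @measurable_disk R (rr R n).
have ci i : cint (disk (rr R n)) (fun z => (z ^+ N * Q.[z]) * Num.conj (z ^+ i)).
  apply: (cint_ccont (ltW r0)) => z zr; apply: ccontM.
    by apply: holo_ccont => //; exact: le_lt_trans r1.
  by apply: ccont_conj; apply: ccontX; exact: ccont_id.
rewrite E cI_sum//; last by move=> i; exact: cintZ.
rewrite big1// => i _; rewrite cIZ//.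
have := @moment_mulXn (rr R n) (fun z => Q.[z]) N i _ hQ (leq_trans (ltn_ord i) PN).
by rewrite /moment => ->; rewrite ?mulr0// r0.
Qed.

Lemma rint_nrm2 f (M : R) : (forall z, cabs z < 1 -> ccont f z) ->
  (forall z, cabs z < 1 -> cabs (f z) <= M) -> rint (disk 1) (fun z => cabs (f z) ^+ 2).
Proof.
move=> cf fM.
have [|z z1|i1 _] := @cint_bounded R 1 (M * M) (fun z => f z * Num.conj (f z)) ler01.
- by move=> z z1; exact: ccontM (cf z z1) (ccont_conj (cf z z1)).
- by rewrite cabsM cabs_conj ler_pM ?cabs_ge0 ?fM.
apply: rint_ext i1; first exact: measurable_disk.
by move=> p _; rewrite -sqr_cabs.
Qed.

Lemma rint_Bergman f : Bergman f -> rint (disk 1) (fun z => cabs (f z) ^+ 2).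
Proof. by move=> /BergmanE[]. Qed.

Lemma nrm2Z f (c : C) : rint (disk 1) (fun z => cabs (f z) ^+ 2) ->
  nrm2 (fun z => c * f z) = cabs c ^+ 2 * nrm2 f.
Proof.
move=> i; have mD := @measurable_disk R 1; rewrite /nrm2 -rIZ//.
by apply: rI_ext => p _; rewrite cabsM exprMn.
Qed.

(** The parallelogram law |z + zeta|^2 = 2 |z|^2 + 2 - |z - zeta|^2, where |z + zeta| = |1 +
    conj(zeta) z|. *)
Lemma half_sum_bound (zeta z : C) : cabs zeta = 1 -> cabs z < 1 ->
  cabs ((2^-1)%:C%C * (1 + Num.conj zeta * z)) ^+ 2 <= 1 - cabs (z - zeta) ^+ 2 / 4.
Proof.
move=> ze z1; rewrite -!sqn_cabs.
have : sqn zeta = 1 by rewrite sqn_cabs ze expr1n.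
have : sqn z <= 1 by rewrite sqn_cabs expr_le1 ?cabs_ge0// ltW.
case: zeta {ze z1} z => [a b] [x y]; rewrite /sqn /= => h1 h2.
simpc; nra.
Qed.

(* The function z^N ((1 + conj(zeta) z) / 2)^n with n large: away from zeta its square is at
   most rho^n, while the point bound at t zeta gives it a squared norm >= c rho1^n with
   rho1 > rho. *)
Lemma concentration (phi : C -> C) (M : R) (zeta : C) :
  (forall z, cabs z < 1 -> ccont phi z) -> (forall z, cabs z < 1 -> cabs (phi z) <= M) ->
  cabs zeta = 1 ->
  (forall e : R, 0 < e -> exists2 d : R, 0 < d &
    forall z, cabs z < 1 -> cabs (z - zeta) < d -> cabs (phi z) <= e) ->
  forall (eps : R) N, 0 < eps -> exists Q, nrm2 (fun z : C => ('X^N * Q).[z]) = 1 /\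
    nrm2 (fun z : C => phi z * ('X^N * Q).[z]) <= eps.
Proof.
move=> cphi phiM ze phi0 eps N eps0.
have M0 : 0 <= M by apply: le_trans (phiM 0 _); rewrite ?cabs_ge0// cabs0.
(* One half of eps is for the points near zeta, where |phi|^2 <= [s], and one half for the
   others. *)
pose s := eps / 2; have s0 : 0 < s by rewrite divr_gt0.
pose e' := Order.min 1 s.
have e'0 : 0 < e' by rewrite lt_min ltr01.
have e's : e' ^+ 2 <= s.
  apply: (@le_trans _ _ (e' * 1)); last by rewrite mulr1 ge_min lexx orbT.
  by rewrite expr2; apply: ler_wpM2l; [exact: ltW|rewrite ge_min lexx].
have [d1 d10 hd1] := phi0 _ e'0.
pose d := Order.min 1 d1.
have d0 : 0 < d by rewrite lt_min ltr01.
have dd1 : d <= 1 by rewrite ge_min lexx.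
have hd z : cabs z < 1 -> cabs (z - zeta) < d -> cabs (phi z) <= e'.
  by move=> z1; rewrite lt_min => /andP[_]; exact: hd1.
have d2 : 0 < d ^+ 2 <= 1 by rewrite exprn_gt0//= expr_le1// ltW.
(* [rho] bounds the squared modulus of (1 + conj(zeta) z) / 2 at distance at least d from zeta. At
   the point t zeta that square is (1 - d^2 / 16)^2 >= [rho1] > [rho]. *)
pose rho := 1 - d ^+ 2 / 4; pose rho1 := 1 - d ^+ 2 / 8; pose t := rho1.
have rho0 : 0 <= rho by rewrite /rho; lra.
have rr1 : rho < rho1 by rewrite /rho /rho1; lra.
have t01 : 0 < t < 1 by rewrite /t /rho1; lra.
have t0 : 0 < t by case/andP: t01.
have [|K K0 hK] := @Bergman_point_bound R t; first by case/andP: t01 => /ltW ->.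
pose A := area (1 : R); have A0 : 0 < A := area_gt0 ltr01.
have MAK : 0 < M ^+ 2 * A * K + 1 by rewrite ltr_wpDl// mulr_ge0 ?(ltW K0)// mulr_ge0 ?sqr_ge0// ltW.
have t2N : 0 < t ^+ N ^+ 2 by rewrite !exprn_gt0.
have q01 : 0 <= rho / rho1 < 1 by rewrite divr_ge0 ?(ltW t0)//= ltr_pdivrMr ?mul1r.
(* This [n] makes the far contribution M^2 rho^n A at most [s] times the squared norm of [e], which
   is at least t^(2N) rho1^n / K. *)
have [n /(_ n (leqnn n)) hn] := exp_small q01 (divr_gt0 (mulr_gt0 s0 t2N) MAK).
pose Q0 : {poly C} := ((2^-1)%:C%C *: (1 + (Num.conj zeta) *: 'X)) ^+ n.
pose e (z : C) := ('X^N * Q0).[z].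
have eE z : e z = z ^+ N * ((2^-1)%:C%C * (1 + Num.conj zeta * z)) ^+ n.
  by rewrite /e hornerM hornerXn /Q0 horner_exp !hornerE.
have be : Bergman e := Bergman_poly _.
have ie := rint_Bergman be.
have [L [he bL]] := bholo_poly ('X^N * Q0).
have ipe : rint (disk 1) (fun z => cabs (phi z * e z) ^+ 2).
  apply: (@rint_nrm2 _ (M * L)) => z z1; first exact: ccontM (cphi z z1) (holo_ccont he z1).
  by rewrite cabsM ler_pM ?cabs_ge0// ?phiM ?bL.
have X1 : t ^+ N ^+ 2 * rho1 ^+ n <= K * nrm2 e.
  apply: le_trans (hK e (t%:C%C * zeta) be _); last first.
    by rewrite cabsM ze mulr1 cabs_real ger0_norm// ltW.
  rewrite eE (_ : (2^-1)%:C%C * (1 + Num.conj zeta * (t%:C%C * zeta)) = ((1 + t) / 2)%:C%C); last first.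
    rewrite mulrCA [Num.conj zeta * zeta]mulrC -sqr_cabs ze expr1n mulr1.
    by rewrite (mulrC (1 + t)); simpc.
  rewrite cabsM !cabsX cabsM ze mulr1 !cabs_real !ger0_norm ?(ltW t0)//; last by rewrite divr_ge0// addr_ge0// ltW.
  rewrite exprMn; apply: ler_wpM2l; first exact: ltW.
  rewrite -exprM mulnC exprM; apply: lerXn2r; rewrite ?nnegrE ?sqr_ge0 ?(ltW t0)//.
  by have := sqr_ge0 (d ^+ 2); rewrite /t /rho1 => h; lra.
have X0 : 0 < nrm2 e.
  rewrite -(pmulr_rgt0 _ K0); apply: lt_le_trans X1.
  by rewrite mulr_gt0// exprn_gt0.
have Y1 : nrm2 (fun z => phi z * e z) <= s * nrm2 e + M ^+ 2 * rho ^+ n * A.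
  have mD := @measurable_disk R 1.
  rewrite -rI_cst -rIZ// -rID//; [|exact: rintZ|exact: rint_cst].
  apply: rI_le => //; first by apply: rintD => //; [exact: rintZ|exact: rint_cst].
  move=> p /(diskE _ ler01); move: (toC p) => z z1; rewrite cabsM exprMn.
  have Mr : 0 <= M ^+ 2 * rho ^+ n by rewrite mulr_ge0 ?sqr_ge0// exprn_ge0.
  have [zd|zd] := ltP (cabs (z - zeta)) d.
    apply: ler_wpDr => //; apply: ler_wpM2r; first exact: sqr_ge0.
    by apply: le_trans e's; rewrite lerXn2r ?nnegrE ?cabs_ge0 ?(ltW e'0)// hd.
  apply: ler_wpDl; first by rewrite mulr_ge0 ?sqr_ge0// ltW.
  apply: ler_pM; rewrite ?sqr_ge0//; first by rewrite lerXn2r ?nnegrE ?cabs_ge0// phiM.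
  rewrite eE cabsM exprMn !cabsX -[_ ^+ n ^+ 2]exprM mulnC exprM.
  have h1 : cabs z ^+ N ^+ 2 <= 1 by rewrite -exprM exprn_ile1 ?cabs_ge0// ltW.
  apply: (@le_trans _ _ (1 * rho ^+ n)); last by rewrite mul1r.
  apply: ler_pM => //; [exact: sqr_ge0|by apply: exprn_ge0; exact: sqr_ge0|].
  apply: lerXn2r; rewrite ?nnegrE ?sqr_ge0//.
  apply: le_trans (half_sum_bound ze z1) _; rewrite /rho lerD2l lerN2 ler_pM2r ?invr_gt0//.
  by rewrite lerXn2r ?nnegrE ?cabs_ge0 ?(ltW d0).
have Y2 : M ^+ 2 * rho ^+ n * A <= s * nrm2 e.
  move: hn; rewrite expr_div_n ler_pdivlMr// mulrAC ler_pdivrMr ?exprn_gt0// => hn.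
  rewrite -(ler_pM2l K0); apply: (@le_trans _ _ (s * (t ^+ N ^+ 2 * rho1 ^+ n))).
    rewrite [X in _ <= X]mulrA; apply: le_trans hn.
    have := exprn_ge0 n rho0; move: (rho ^+ n) => x x0; nra.
  by rewrite [K * _]mulrCA ler_wpM2l// ltW.
pose c := (Num.sqrt (nrm2 e))^-1.
have c2 : c ^+ 2 = (nrm2 e)^-1 by rewrite /c exprVn sqr_sqrtr// ltW.
exists (c%:C%C *: Q0).
have E : (fun z : C => ('X^N * (c%:C%C *: Q0)).[z]) = fun z => c%:C%C * e z.
  by apply/funext => z; rewrite -scalerAr hornerZ.
have cc : cabs c%:C%C ^+ 2 = (nrm2 e)^-1 by rewrite cabs_real real_normK ?num_real.
split; first by rewrite E nrm2Z// cc mulVf// gt_eqF.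
have -> : (fun z : C => phi z * ('X^N * (c%:C%C *: Q0)).[z]) = fun z => c%:C%C * (phi z * e z).
  by apply/funext => z; rewrite (congr1 (@^~ z) E) mulrCA.
rewrite nrm2Z// cc mulrC ler_pdivrMr//; apply: le_trans Y1 _; rewrite /s in Y2 *; lra.
Qed.
End TestFunctions.

(** * Concentration excludes a range of finite codimension *)

Section BoundaryZeros.
Variable R : realType.
Local Notation C := (complex R).
Implicit Types (f g h t : C -> C) (P Q : {poly C}).
Local Notation hf := (2^-1 : R).

Lemma cint_Bergman1 f h : Bergman f -> Bergman h ->
  cint (disk 1) (fun z => f z * Num.conj (h z)).
Proof.
move=> bf bh; have := @cint_Bergman R (fun=> 1) f h 1 bf bh.
under [X in cint _ X]eq_fun do rewrite mul1r.
by apply=> z z1; [exact: ccont_cst|rewrite cabs1].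
Qed.

Lemma cI_nrm2 h : cI (disk 1) (fun z => h z * Num.conj (h z)) = (nrm2 h)%:C%C.
Proof.
rewrite /cI; congr Complex.
  by apply: rI_ext => p _; rewrite -sqr_cabs.
rewrite -[RHS](mul0r (area (1 : R))) -rI_cst.
by apply: rI_ext => p _; rewrite -sqr_cabs.
Qed.

(** The bound is on squared norms: the exponent 4 makes the norms of phi E_j at most 4^-j, which
    must beat the coefficients 2^-j of the series formed later. *)
Lemma orthonormal_sequence (phi : C -> C) :
  (forall (eps : R) N, 0 < eps -> exists Q, nrm2 (fun z : C => ('X^N * Q).[z]) = 1 /\
     nrm2 (fun z : C => phi z * ('X^N * Q).[z]) <= eps) ->
  exists E : nat -> {poly C}, [/\ forall j, nrm2 (fun z => (E j).[z]) = 1,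
    forall j, nrm2 (fun z => phi z * (E j).[z]) <= (hf ^+ j) ^+ 4 &
    forall j l, j != l -> cI (disk 1) (fun z => (E j).[z] * Num.conj (E l).[z]) = 0].
Proof.
move=> step.
have hf0 j : 0 < (hf ^+ j) ^+ 4 by rewrite !exprn_gt0// invr_gt0.
have [Q hQ] := choice (fun jN : nat * nat => step _ jN.2 (hf0 jN.1)).
(* [N j] is at least the size of every earlier polynomial, so the factor z^(N j) makes [E j]
   orthogonal to all of them. *)
pose N := fix N j := if j is j'.+1 then (N j' + size ('X^(N j') * Q (j', N j'))%R)%N else 0%N.
pose E j := 'X^(N j) * Q (j, N j).
have NE l j : (l < j)%N -> (size (E l) <= N j)%N.
  elim: j => [//|j IH]; rewrite ltnS leq_eqVlt => /orP[/eqP ->|/IH h] /=.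
    by rewrite leq_addl.
  by apply: leq_trans h _; rewrite leq_addr.
have orth l j : (l < j)%N -> cI (disk 1) (fun z => (E j).[z] * Num.conj (E l).[z]) = 0.
  by move=> /NE; exact: poly_orthogonal.
exists E; split=> [j|j|j l jl]; first exact: (hQ (j, N j)).1.
  exact: (hQ (j, N j)).2.
move: jl; rewrite neq_ltn => /orP[/orth lj|/orth//].
have i := cint_Bergman1 (Bergman_poly (E l)) (Bergman_poly (E j)).
have mD := @measurable_disk R 1; rewrite -[RHS](@conj0 R) -lj -cI_conj//.
by apply: cI_ext => p _; rewrite conjM conjK mulrC.
Qed.

Lemma TmL_pairing (phi0 : C -> C) lam f t h (M : R) :
  (forall z, cabs z < 1 -> ccont phi0 z) ->
  (forall z, cabs z < 1 -> cabs (phi0 z - lam) <= M) -> Bergman f -> Bergman h ->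
  TmL phi0 lam f t ->
  cint (disk 1) (fun z => ((phi0 z - lam) * f z - t z) * Num.conj (h z)) /\
  cI (disk 1) (fun z => ((phi0 z - lam) * f z - t z) * Num.conj (h z)) = 0.
Proof.
move=> cphi phiM bf bh [T [[bT orth] tT]]; have mD := @measurable_disk R 1.
have bT' := Bergman_add bT (Bergman_scale (- lam) bf).
have i1 : cint (disk 1) (fun z => (phi0 z - lam) * f z * Num.conj (h z)).
  by apply: (cint_Bergman bf bh) phiM => z z1; exact: ccontB (cphi z z1) (@ccont_cst R _ z).
have tE z : cabs z < 1 -> t z = T z + - lam * f z.
  by move=> /inD_cabs /tT ->; rewrite mulNr.
split.
  apply: cint_ext (cintB mD i1 (cint_Bergman1 bT' bh)) => // p /(diskE _ ler01) /tE ->.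
  by rewrite [RHS]mulrBl.
have := orth h bh; rewrite innerD_eq0 => <-.
by apply: cI_ext => p /(diskE _ ler01) /tE ->; congr (_ * _); ring.
Qed.

Lemma kernel_vector m (A : 'M[C]_(m.+1, m)) :
  exists2 a : 'I_m.+1 -> C, (exists i, a i != 0) & forall l, \sum_i a i * A i l = 0.
Proof.
have kn0 : kermx A != 0.
  by rewrite -mxrank_eq0 mxrank_ker -lt0n subn_gt0 ltnS rank_leq_col.
have /sub_kermxP h := nz_row_sub (kermx A).
exists (nz_row (kermx A) 0).
  move: kn0; rewrite -nz_row_eq0 => /rV0Pn[i ai]; by exists i.
by move=> l; have := congr1 (fun B : 'rV_m => B 0 l) h; rewrite !mxE.
Qed.

(* The m + 1 series g_i = sum over j = i mod m + 1 of 2^(-j) E_j have a nontrivial combination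
   G = (T - lam) F in the range; <G, E_j> = a_i 2^(-j), but <phi F, E_j> = O(4^(-j)). *)
Lemma fin_codim_no_concentration (phi0 : C -> C) lam (M : R) :
  (forall z, cabs z < 1 -> ccont phi0 z) ->
  (forall z, cabs z < 1 -> cabs (phi0 z - lam) <= M) -> fin_codim_range phi0 lam ->
  ~ (forall (eps : R) N, 0 < eps -> exists Q, nrm2 (fun z : C => ('X^N * Q).[z]) = 1 /\
     nrm2 (fun z : C => (phi0 z - lam) * ('X^N * Q).[z]) <= eps).
Proof.
move=> cphi phiM [s [bs range]] /orthonormal_sequence[E [E1 Ephi orth]].
pose phi z := phi0 z - lam; have mD := @measurable_disk R 1.
have hf0 n : 0 < hf ^+ n by rewrite exprn_gt0// invr_gt0.
(* The coefficient 2^-l goes to the series of index l mod (m + 1), so each l is met by exactly one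
   of the m + 1 series. *)
pose m := size s; pose b (i : 'I_m.+1) l : C := if (l %% m.+1 == i)%N then (hf ^+ l)%:C%C else 0.
have bE j := Bergman_poly (E j).
have exg (i : 'I_m.+1) : exists2 g, Bergman g & forall j,
    cI (disk 1) (fun z => g z * Num.conj (E j).[z]) = b i j.
  have [|||g bg hg] := @Bergman_series R (fun j z => (E j).[z]) (b i).
  - exact: bE.
  - by move=> j; rewrite E1.
  - by move=> j; rewrite /b; case: ifP => _; rewrite ?cabs_real ?ger0_norm ?cabs0// ltW.
  exists g => // j; apply: (tends_unique (hg _ (bE j))).
  (* From n = j + 1 on, orthonormality makes the pairing of the partial sum with E_j constant. *)
  apply/tendsP => e e0; exists j.+1 => n jn.
  suff -> : cI (disk 1) (fun z => (\sum_(l < n) b i l * (E l).[z]) * Num.conj (E j).[z]) = b i j.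
    by rewrite subrr cabs0 ltW.
  have -> : (fun z => (\sum_(l < n) b i l * (E l).[z]) * Num.conj (E j).[z]) =
      fun z => \sum_(l < n) b i l * ((E l).[z] * Num.conj (E j).[z]).
    by apply/funext => z; rewrite mulr_suml; apply: eq_bigr => l _; rewrite mulrA.
  rewrite cI_sum//; last by move=> l; apply: cintZ => //; exact: cint_Bergman1.
  rewrite (bigD1 (Ordinal jn))//= big1 => [|l lj].
    by rewrite cIZ//; [rewrite cI_nrm2 E1 mulr1 addr0|exact: cint_Bergman1].
  by rewrite cIZ//; [rewrite orth ?mulr0|exact: cint_Bergman1].
have [g hg] := choice (fun i => let: ex_intro2 g bg h := exg i in ex_intro _ g (conj bg h)).
have [f hf'] := choice (fun i => range (g i) (hg i).1).
have [t ht] := choice hf'; have [c hc] := choice ht.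
(* The components of the m + 1 series along the m complementary functions of [s] satisfy a
   nontrivial linear relation; the combination [G] with these coefficients lies in the range. *)
have [a [i0 ai0] ak] := kernel_vector (\matrix_(i < m.+1, l < m) c i l).
pose F z := \sum_i a i * f i z; pose G z := \sum_i a i * g i z.
have bF : Bergman F.
  by apply: Bergman_sum => i; apply: Bergman_scale; case: (hc i).
have GE z : cabs z < 1 -> G z = \sum_i a i * t i z.
  move=> z1; rewrite /G (eq_bigr (fun i => a i * t i z + a i * lincomb s (c i) z)); last first.
    by move=> i _; case: (hc i) => _ _ ->; rewrite ?mulrDr//; exact/inD_cabs.
  rewrite big_split /= [X in _ + X](_ : _ = 0) ?addr0// /lincomb.
  under eq_bigr do rewrite mulr_sumr; rewrite exchange_big big1//= => l _.
  under eq_bigr do rewrite mulrA; rewrite -mulr_suml.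
  by have := ak l; under eq_bigr do rewrite mxE; move=> ->; rewrite mul0r.
have pair j : cI (disk 1) (fun z => phi z * F z * Num.conj (E j).[z]) =
    \sum_i a i * b i j.
  have iG i := cint_Bergman1 (hg i).1 (bE j).
  have E0 : cI (disk 1) (fun z => (phi z * F z - G z) * Num.conj (E j).[z]) = 0.
    rewrite (@cI_ext _ _ _ (fun z => \sum_i a i * ((phi z * f i z - t i z) * Num.conj (E j).[z]))).
      rewrite cI_sum//; last first.
        move=> i; apply: cintZ => //; have [bf tm _] := hc i.
        exact: (TmL_pairing cphi phiM bf (bE j) tm).1.
      rewrite big1// => i _; have [bf tm _] := hc i.
      have [i1 i2] := TmL_pairing cphi phiM bf (bE j) tm.
      by rewrite cIZ// i2 mulr0.
    move=> p /(diskE _ ler01); move: (toC p) => z z1; rewrite GE//.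
    rewrite /F mulr_sumr -sumrB mulr_suml; apply: eq_bigr => i _.
    by move: (phi z) (a i) (f i z) (t i z) (Num.conj _) => x1 x2 x3 x4 x5; ring.
  have iF : cint (disk 1) (fun z => phi z * F z * Num.conj (E j).[z]).
    by apply: (cint_Bergman bF (bE j)) phiM => z z1; exact: ccontB (cphi z z1) (@ccont_cst R _ z).
  have bG : Bergman G by apply: Bergman_sum => i; apply: Bergman_scale; exact: (hg i).1.
  have <- : cI (disk 1) (fun z => G z * Num.conj (E j).[z]) = \sum_i a i * b i j.
    rewrite (@cI_ext _ _ _ (fun z => \sum_i a i * (g i z * Num.conj (E j).[z]))).
      rewrite cI_sum//; last by move=> i; exact: cintZ.
      by apply: eq_bigr => i _; rewrite cIZ// (hg i).2.
    by move=> p _; rewrite /G mulr_suml; apply: eq_bigr => i _; rewrite mulrA.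
  apply/eqP; rewrite -subr_eq0 -cIB//; last exact: cint_Bergman1.
  by apply/eqP; rewrite -[RHS]E0; apply: cI_ext => p _; rewrite [RHS]mulrBl.
have iF := rint_Bergman bF.
have bound j : cabs (\sum_i a i * b i j) <= 2 * (nrm2 F + 1) * (hf ^+ j) ^+ 2.
  (* With e = 4^-j, |phi E_j| |F| <= e |F|^2 + |phi E_j|^2 / e, and both terms integrate to
     O(4^-j). *)
  rewrite -pair; pose e := (hf ^+ j) ^+ 2; have e0 : 0 < e by rewrite exprn_gt0.
  have ip : rint (disk 1) (fun z => cabs (phi z * (E j).[z]) ^+ 2).
    have [L [_ bL]] := bholo_poly (E j).
    apply: (@rint_nrm2 _ _ (M * L)) => z z1.
      apply: ccontM; first exact: ccontB (cphi z z1) (@ccont_cst R _ z).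
      exact: holo_ccont (Bergman_holo (bE j)) z1.
    by rewrite cabsM ler_pM ?cabs_ge0// ?phiM ?bL.
  have iu := rintD mD (rintZ e mD iF) (rintZ e^-1 mD ip).
  apply: le_trans (cI_le mD _ iu _) _.
  - by apply: (cint_Bergman bF (bE j)) phiM => z z1; exact: ccontB (cphi z z1) (@ccont_cst R _ z).
  - move=> p _; move: (toC p) => z; 
    have -> : cabs (phi z * F z * Num.conj (E j).[z]) = cabs (phi z * (E j).[z]) * cabs (F z).
      by rewrite !cabsM cabs_conj mulrAC.
    move: (cabs (phi z * (E j).[z])) (cabs_ge0 (phi z * (E j).[z])) (cabs (F z)) (cabs_ge0 (F z)) => x x0 y y0.
    rewrite -subr_ge0 (_ : _ - _ = ((e * y - x) ^+ 2 + e * x * y) / e); last by field; rewrite gt_eqF.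
    by rewrite divr_ge0 ?(ltW e0)// addr_ge0 ?sqr_ge0// !mulr_ge0// ltW.
  rewrite rID//; [|exact: rintZ|exact: rintZ]; rewrite rIZ// rIZ//.
  have : e^-1 * nrm2 (fun z => phi z * (E j).[z]) <= e.
    rewrite mulrC ler_pdivrMr//; apply: le_trans (Ephi j) _.
    by rewrite /e -expr2 -[X in _ <= X]exprM.
  rewrite -/e /nrm2; lra.
(* Along j = k (m + 1) + i0 only the summand i0 survives; its size is of order 2^-j, too large for
   [bound] once k is large. *)
have bsum k : \sum_i a i * b i (k * m.+1 + i0)%N = a i0 * (hf ^+ (k * m.+1 + i0))%:C%C.
  have ji : ((k * m.+1 + i0) %% m.+1 = i0)%N by rewrite modnMDl modn_small.
  rewrite (bigD1 i0)//= big1 ?addr0 => [|i ii0]; first by rewrite /b ji eqxx.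
  by rewrite /b ji ifN ?mulr0// eq_sym.
have K0 : 0 <= 2 * (nrm2 F + 1) by rewrite mulr_ge0// addr_ge0// nrm2_ge0.
have a0 : 0 < cabs (a i0) by rewrite cabs_gt0.
have a2 : 0 < cabs (a i0) / 2 by rewrite divr_gt0.
have [k /(_ (k * m.+1 + i0)%N) hk] := dyadic_small K0 a2.
have {hk} hk := hk (leq_trans (leq_pmulr k (ltn0Sn m)) (leq_addr i0 _)).
have := bound (k * m.+1 + i0)%N; rewrite bsum cabsM cabs_real ger0_norm ?(ltW (hf0 _))//.
rewrite expr2 mulrA ler_pM2r ?hf0// => h.
by have := le_trans h hk; lra.
Qed.
End BoundaryZeros.

(** * The function q of a disk algebra symbol *)

Section DiskAlgebra.
Variable R : realType.
Local Notation C := (complex R).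
Implicit Types (p q f g : C -> C).

Lemma disk_algebra_continuous p : disk_algebra p -> forall z, cabs z <= 1 ->
  forall e : R, 0 < e -> exists2 d : R, 0 < d &
    forall w, cabs w <= 1 -> cabs (w - z) < d -> cabs (p w - p z) < e.
Proof.
move=> [_ _ /subspace_continuousP pc] z z1 e e0.
have sq w : cabs w <= 1 -> [set z : C^o | sqn z <= 1] w.
  by move=> w1; rewrite /= sqn_cabs expr_le1// cabs_ge0.
have /cvgrPdist_lt h := pc z (sq z z1).
have /h : 0 < (e%:C)%C by rewrite ltcR.
rewrite /prop_near1 /= => -[r /= r0 hr].
exists (complex.Re r); first by move: r0; rewrite ltcE => /andP[].
move=> w w1 wr; have := hr w; rewrite /= !normr_cabs.
have -> : ((cabs (z - w))%:C%C < r).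
  by move: r0; rewrite !ltcE /= cabsC => /andP[-> _].
by rewrite ltcR cabsC => /(_ isT (sq w w1)); rewrite cabsC.
Qed.

Lemma disk_algebra_bounded p : disk_algebra p -> exists M, bounded_holo p M.
Proof.
move=> [/holoDE hp [M pM] _]; exists (M + 1); split=> // z /inD_cabs /pM.
by rewrite sqn_cabs; move: (cabs (p z)) (cabs_ge0 (p z)) => x x0 h; nra.
Qed.

Section Symbol.
Variables (p : C -> C) (lam : C).
Hypothesis dp : disk_algebra p.

Definition qsym z := 1 + z * (p z - lam).

Lemma qsym0 : qsym 0 = 1. Proof. by rewrite /qsym mul0r addr0. Qed.

Lemma qsym_bholo : bholo qsym.
Proof.
have bp : bholo p := disk_algebra_bounded dp.
apply: bholo_add (bholo_cst 1) _; apply: bholo_mul (@bholo_id R) _.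
exact: bholo_sub bp (bholo_cst lam).
Qed.

(** At a zero of q one has a (p(a) - lam) = -1, which replaces the first term of a q'(a) = a (p(a) -
    lam) + a^2 p'(a). *)
Lemma qsym_zero_order (a : C) : cabs a < 1 -> qsym a = 0 ->
  a * cd qsym a = a ^+ 2 * cd p a - 1.
Proof.
move=> a1 qa; have /holoDE hp : holoD p by case: dp.
have -> : cd qsym a = (p a - lam) + a * cd p a.
  apply: cd_eq.
  have h := cderD (cder_cst 1 a) (cderM (cder_id a) (cderB (holo_cd hp a1) (cder_cst lam a))).
  by apply: cder_eq h _; rewrite add0r mul1r subr0.
move: qa; rewrite /qsym => /eqP; rewrite addrC addr_eq0 => /eqP h.
by rewrite mulrDr h addrC mulrA expr2.
Qed.

(** On the unit circle 1 = zeta conj(zeta), hence q(zeta) = zeta (conj(zeta) + p(zeta) - lam): a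
    zero of q is a zero of the symbol minus lam, at which test functions can concentrate. *)
Lemma boundary_nonzero (zeta : C) : fin_codim_range (fun z => Num.conj z + p z) lam ->
  cabs zeta = 1 -> qsym zeta != 0.
Proof.
move=> codim ze; apply/eqP => qz.
have [M [hp pM]] := disk_algebra_bounded dp.
have cphi z : cabs z < 1 -> ccont (fun z => Num.conj z + p z) z.
  by move=> z1; apply: ccontD (holo_ccont hp z1); apply: ccont_conj; exact: ccont_id.
have phiM z : cabs z < 1 -> cabs (Num.conj z + p z - lam) <= 1 + M + cabs lam.
  move=> z1; apply: le_trans (cabsB _ _) _; rewrite lerD2r.
  apply: le_trans (cabsD _ _) _; rewrite cabs_conj.
  by apply: lerD; [exact: ltW|exact: pM].
have phi0 : Num.conj zeta + p zeta - lam = 0.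
  have zz : zeta * Num.conj zeta = 1 by rewrite -sqr_cabs ze expr1n.
  have z0 : zeta != 0 by rewrite -cabs_gt0 ze.
  apply: (mulfI z0); rewrite mulr0 -[RHS]qz /qsym -zz.
  by move: (Num.conj zeta) (p zeta) => x y; ring.
apply: (fin_codim_no_concentration cphi phiM codim).
have cphi' z : cabs z < 1 -> ccont (fun z => Num.conj z + p z - lam) z.
  by move=> z1; exact: ccontB (cphi z z1) (@ccont_cst R _ z).
apply: (concentration cphi' phiM ze).
move=> e e0; have e2 : 0 < e / 2 by rewrite divr_gt0.
have [|d d0 hd] := disk_algebra_continuous dp (z := zeta) _ e2; first by rewrite ze.
exists (Order.min d (e / 2)); first by rewrite lt_min d0.
move=> z z1; rewrite lt_min => /andP[/(hd z (ltW z1)) h1 h2].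
rewrite -[_ - lam]subr0 -phi0.
have -> : Num.conj z + p z - lam - (Num.conj zeta + p zeta - lam) =
    Num.conj (z - zeta) + (p z - p zeta).
  by rewrite conjB; move: (Num.conj z) (Num.conj zeta) (p z) (p zeta) => x y x' y'; ring.
by apply: le_trans (cabsD _ _) _; rewrite cabs_conj; lra.
Qed.

(** The function |q(z)| + 1 - |z| is positive on the closed disk, by its part 1 - |z| inside and by
    [boundary_nonzero] on the circle. Its minimum m gives |q| >= m / 2 where 1 - |z| <= m / 2. *)
Lemma qsym_bounded_below : fin_codim_range (fun z => Num.conj z + p z) lam ->
  exists rho d, bounded_below qsym rho d.
Proof.
move=> codim.
have [|c c1 hc] := @cdisk_EVT R (fun z => cabs (qsym z) + (1 - cabs z)) 1 ler01.
  move=> z z1 e e0.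
  have e3 : 0 < Order.min 1 (e / 3) by rewrite lt_min ltr01 divr_gt0.
  have [d d0 hd] := disk_algebra_continuous dp z1 e3.
  pose B := cabs (p z) + 1 + cabs lam.
  have B0 : 0 < B.
    by rewrite /B; have := cabs_ge0 (p z); have := cabs_ge0 lam; lra.
  have e4 : 0 < e / 3 / B by rewrite !divr_gt0.
  exists (Order.min d (Order.min (e / 3) (e / 3 / B))).
    by rewrite !lt_min d0 e4 divr_gt0.
  move=> w w1; rewrite !lt_min => /and3P[/(hd w w1)]; rewrite lt_min => /andP[h1 h2] h3 h4.
  have q1 : cabs (qsym w - qsym z) < e / 3 + e / 3.
    have -> : qsym w - qsym z = (w - z) * (p w - lam) + z * (p w - p z).
      by rewrite /qsym; move: (p w) (p z) => x y; ring.
    apply: le_lt_trans (cabsD _ _) _; rewrite !cabsM; apply: ler_ltD.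
      have : cabs (p w - lam) <= B.
        have -> : p w - lam = (p w - p z) + p z - lam by move: (p w) (p z) => x y; ring.
        have n3 := cabsB (p w - p z + p z) lam; have n4 := cabsD (p w - p z) (p z).
        by rewrite /B; lra.
      move=> h; apply: (@le_trans _ _ (e / 3 / B * B)); last by rewrite divfK// gt_eqF.
      by apply: ler_pM; rewrite ?cabs_ge0// ltW.
    by apply: le_lt_trans h2; rewrite ler_piMl// cabs_ge0.
  have n1 := cabs_dist (qsym w) (qsym z); have n2 := cabs_dist w z.
  have -> : cabs (qsym w) + (1 - cabs w) - (cabs (qsym z) + (1 - cabs z)) =
      (cabs (qsym w) - cabs (qsym z)) - (cabs w - cabs z) by ring.
  by apply: le_lt_trans (ler_normB _ _) _; lra.
pose m := cabs (qsym c) + (1 - cabs c).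
have m0 : 0 < m.
  rewrite /m; move: c1; rewrite le_eqVlt => /orP[/eqP c1|c1].
    by rewrite c1 subrr addr0 cabs_gt0 boundary_nonzero.
  by rewrite ltr_wpDl ?cabs_ge0// subr_gt0.
(* The maximum with 1/2 keeps the radius positive. *)
exists (Order.max 2^-1 (1 - m / 2)), (m / 2); split.
- by rewrite lt_max gt_max invr_gt0 ltr0n /=; apply/andP; split; lra.
- by rewrite divr_gt0.
- move=> z; rewrite ge_max => /andP[/andP[_ h1] h2].
  by have := hc z (ltW h2); rewrite -/m; lra.
Qed.
End Symbol.
End DiskAlgebra.

(** * Eigenvalues and the zeros of q *)

Unset Implicit Arguments.

Theorem theorem2p4 (R : realType) (p : complex R -> complex R) (lam : complex R) :
  disk_algebra p ->
  ~ ess_spec (fun z => Num.conj z + p z) lam ->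
  (toeplitz_eigenvalue (fun z => Num.conj z + p z) lam <->
   let q := fun z : complex R => 1 + z * (p z - lam) in
   (exists s : seq (complex R), forall z, (inD z /\ q z = 0) <-> z \in s) /\
   (forall z, inD z -> q z = 0 ->
      'D_1 (q : (complex R)^o -> (complex R)^o) z != 0 /\
      exists n : nat,
        z ^+ 2 * 'D_1 (p : (complex R)^o -> (complex R)^o) z
        = n.+2%:R / n.+1%:R)).
Proof.
move=> dp /contrapT[_ _ codim].
have [M [hp pM]] := disk_algebra_bounded dp.
have [rho [d qbb]] := qsym_bounded_below dp codim.
have [N qN] := qsym_bholo lam dp.
have q0 := qsym0 p lam.
rewrite -/(qsym p lam) /=; change (fun z => 1 + z * (p z - lam)) with (qsym p lam).
set q := qsym p lam in qbb qN q0 *.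
split=> [[f [bf fn0 /(eigen_ode hp pM bf)[F [F0 dF ode]]]]|[[s sE] hz]].
  split.
    (* The empty list is the case without zeros, so one finite list covers both alternatives. *)
    have [s us sE] := finite_zeros qN q0 qbb; exists s => z; rewrite -sE.
    by split=> -[/inD_cabs z1 qz].
  move=> z /inD_cabs z1 qz.
  have z0 : z != 0 by apply/eqP => z0; move: qz; rewrite z0 q0 => /eqP; rewrite oner_eq0.
  (* If F vanished identically, so would its derivative f. *)
  have Fn0 : exists2 z, cabs z < 1 & F z != 0.
    apply: contrapT => nex; apply: fn0 => w /inD_cabs w1.
    apply: (cder_unique (dF w w1)); apply: cder_ext (cder_cst 0 w).
    have [e e0 he] := near_disk w1; exists e => // v /he v1.
    by apply/eqP; rewrite eq_sym; apply: contrapT => /negP Fv; apply: nex; exists v.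
  have [k kE] := ode_order qN.1 z1 z0 qz dF ode Fn0.
  split.
    (* The relation k z q'(z) = 1 excludes q'(z) = 0, so the zero is simple. *)
    apply/eqP => dq; move: kE; rewrite /cd dq mulr0 mulr0 => /esym/eqP.
    by rewrite oner_eq0.
  (* The same relation excludes k = 0. With k = n + 1 it reads (n + 1)(z^2 p'(z) - 1) = 1, which is
     the stated quotient. *)
  move: kE; rewrite (qsym_zero_order dp z1 qz); case: k => [|n] kE.
    by move: kE; rewrite mul0r => /esym/eqP; rewrite oner_eq0.
  exists n; have n0 : n.+1%:R != 0 :> complex R by rewrite pnatr_eq0.
  apply: (canRL (mulfK n0)); rewrite -[n.+2%:R]natr1 -/(cd p z).
  by rewrite -[X in _ + X]kE; move: (cd p z) => x; ring.
(* [s] may list a zero several times; the product in the eigenfunction takes each zero once, with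
   its own exponent. *)
have sD z : (cabs z < 1 /\ q z = 0) <-> z \in undup s.
  by rewrite mem_undup -sE; split=> -[/inD_cabs z1 qz].
have ex a : exists n : nat, a \in undup s -> (n.+1)%:R * (a * cd q a) = 1.
  have [as_|_] := boolP (a \in undup s); last by exists 0%N.
  have [a1 qa] := (sD a).2 as_.
  have [_ [n hn]] := hz a ((inD_cabs a).2 a1) qa; exists n => _.
  rewrite (qsym_zero_order dp a1 qa) /cd hn mulrBr mulr1 mulrC divfK ?pnatr_eq0//.
  by rewrite -natr1 addrAC subrr add0r.
have [n hn] := choice ex.
have [f [F [bf f0 F0 dF ode]]] := eigenfunction_exists (k := fun a => (n a).+1) qN q0 qbb
  (undup_uniq s) sD hn.
exists f; split => //; last exact: (ode_eigen hp pM bf F0 dF ode).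
move=> fe; have := fe 0; move=> /(_ ((inD_cabs 0).2 _)) E.
by move: f0; rewrite E ?eqxx// cabs0.
Qed.
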